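(* Let $H$ be a finite-dimensional factorizable ribbon Hopf algebra over $\mathbb{C}$ with $R$-matrix $R=a_i\otimes b_i$ and ribbon element $v$, let $g\ge1$ and let $\triangleright$ be the action of $\mathcal{L}_{g,0}(H)$ on $(H^* )^{\otimes g}$. For all $\varphi_1,\dots,\varphi_g\in H^*$ and $1\le i\le g$ (with $i\ge2$ for the two last formulas): $$v_{A(i)}^{-1}\triangleright(\varphi_1\otimes\cdots\otimes\varphi_g)=\varphi_1\otimes\cdots\otimes\varphi_{i-1}\otimes(v_A^{-1}\triangleright\varphi_i)\otimes\varphi_{i+1}\otimes\cdots\otimes\varphi_g,$$ $$v_{B(i)}^{-1}\triangleright(\varphi_1\otimes\cdots\otimes\varphi_g)=\varphi_1\otimes\cdots\otimes\varphi_{i-1}\otimes(v_B^{-1}\triangleright\varphi_i)\otimes\varphi_{i+1}\otimes\cdots\otimes\varphi_g,$$ $$v_{D_i}^{-1}\triangleright(\varphi_1\otimes\cdots\otimes\varphi_g)=\varphi_1\otimes\cdots\otimes\varphi_{i-2}\otimes\varphi_{i-1}\big(S^{-1}(a_j)a_k\,?\,b_kv''^{-1}b_j\big)\otimes\varphi_i\big(S^{-1}(a_l)S^{-1}(v'^{-1})a_m\,?\,b_mb_l\big)\otimes\varphi_{i+1}\otimes\cdots\otimes\varphi_g,$$ $$v_{E_i}^{-1}\triangleright(\varphi_1\otimes\cdots\otimes\varphi_g)=\varphi_1\big(S^{-1}(v^{(2i-2)-1})\,?\,v^{(2i-1)-1}\big)\otimes\cdots\otimes\varphi_{i-1}\big(S^{-1}(v^{(2)-1})\,?\,v^{(3)-1}\big)\otimes\varphi_i\big(S^{-1}(a_j)S^{-1}(v^{(1)-1})a_k\,?\,b_kb_j\big)\otimes\varphi_{i+1}\otimes\cdots\otimes\varphi_g,$$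 where $v'^{-1}\otimes v''^{-1}=\Delta(v^{-1})$ and $v^{(1)-1}\otimes\cdots\otimes v^{(2i-1)-1}=\Delta^{(2i-2)}(v^{-1})$.
   Context: **Hopf algebra.** $H$ has coproduct $\Delta$, counit $\varepsilon$, antipode $S$, $R=a_i\otimes b_i$ (implicit summation; different index letters denote independent copies of $R$), $R'=b_i\otimes a_i$, and ribbon element $v$: $v$ is central invertible, $v^2=uS(u)$ with $u=S(b_i)a_i$, $\Delta(v)=(R'R)^{-1}(v\otimes v)$, $S(v)=v$. Factorizable means that $H^*\to H$, $\varphi\mapsto(\varphi\otimes\mathrm{id})(RR')$ is bijective. Sweedler notation: $\Delta(x)=x'\otimes x''$, $\Delta^{(n)}(x)=x^{(1)}\otimes\cdots\otimes x^{(n+1)}$. All modules are finite-dimensional. The symbol ''?'' denotes the variable of a linear form, e.g. $\varphi(x?y)$ is $h\mapsto\varphi(xhy)$. **Matrices.** For an $H$-module $I$ (with a chosen basis), $\overset{I}{x}$ is the matrix of $x\in H$ acting on $I$, and $\overset{I}{T}$ is the matrix with entries in $H^*$ such that $\overset{I}{T}(x)=\overset{I}{x}$; the entries of all $\overset{I}{T}$ span $H^*$. For matrices $M,N$ over an algebra, $M_1$ and $N_2$ denote $M$ and $N$ acting on the first and second factor of $\mathrm{Mat}_m(\mathbb{C})\otimes\mathrm{Mat}_n(\mathbb{C})$, so $(M_1N_2)^{ik}_{jl}=M^i_jN^k_l$. $\overset{IJ}{X}_{12}$ is the action of $X\in H\otimes H$ on $I\otimes J$. **The algebra.** $\mathcal{L}_{g,0}(H)$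 is the associative unital algebra generated by $2g$ copies of the vector space $H^*$; the images of $\overset{I}{T}$ in these copies are the matrices $\overset{I}{A}(i),\overset{I}{B}(i)$, $1\le i\le g$ (equal to $1$ for $I$ the trivial module), and the relations are, for all $I,J$: $\overset{I\otimes J}{U}(i)_{12}=\overset{I}{U}(i)_1\overset{IJ}{R'}_{12}\overset{J}{U}(i)_2(\overset{IJ}{R'})_{12}^{-1}$ ($U=A$ or $B$); $\overset{IJ}{R}_{12}\overset{I}{U}(i)_1\overset{IJ}{R}{}_{12}^{-1}\overset{J}{V}(j)_2=\overset{J}{V}(j)_2\overset{IJ}{R}_{12}\overset{I}{U}(i)_1\overset{IJ}{R}{}_{12}^{-1}$ for $i<j$ ($U,V\in\{A,B\}$); $\overset{IJ}{R}_{12}\overset{I}{B}(i)_1\overset{IJ}{R'}_{12}\overset{J}{A}(i)_2=\overset{J}{A}(i)_2\overset{IJ}{R}_{12}\overset{I}{B}(i)_1\overset{IJ}{R}{}_{12}^{-1}$. The matrices $\overset{I}{A}(i),\overset{I}{B}(i)$ are invertible. For $g=1$ write $A=A(1)$, $B=B(1)$. **Representation.** Let $\mathcal{O}(H)$ be $H^*$ with the dual Hopf algebra structure. The Heisenberg double $\mathcal{H}(\mathcal{O}(H))=\mathcal{O}(H)\otimes H$ is the algebra containing $\mathcal{O}(H)$ and $H$ as subalgebras, with $h\psi=\psi(?h')h''$; it acts faithfully on $H^*$ by $\psi\triangleright\varphi=\psi\varphi$, $h\triangleright\varphi=\varphi(?h)$ (identifying it with $\mathrm{End}_{\mathbb{C}}(H^*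 )$). For $h\in H$, $\widetilde h\in\mathcal{H}(\mathcal{O}(H))$ is defined by $\widetilde h\triangleright\varphi=\varphi(S^{-1}(h)?)$. Put $\overset{I}{L}{}^{(+)}=\overset{I}{a_i}b_i$, $\overset{I}{L}{}^{(-)}=\overset{I}{S^{-1}(b_i)}a_i$, $\overset{I}{\widetilde L}{}^{(-)}=\overset{I}{S^{-1}(b_i)}\widetilde{a_i}$, and write $(k)$ for the embedding in the $k$-th factor of $\mathcal{H}(\mathcal{O}(H))^{\otimes g}$. With $\overset{I}{\Lambda}_i=\overset{I}{L}{}^{(-)}(1)\overset{I}{\widetilde L}{}^{(-)}(1)\cdots\overset{I}{L}{}^{(-)}(i-1)\overset{I}{\widetilde L}{}^{(-)}(i-1)$, there is an algebra isomorphism $\Psi_{g,0}:\mathcal{L}_{g,0}(H)\to\mathcal{H}(\mathcal{O}(H))^{\otimes g}$, $\overset{I}{A}(i)\mapsto\overset{I}{\Lambda}_i\overset{I}{L}{}^{(+)}(i)\overset{I}{L}{}^{(-)}(i)^{-1}\overset{I}{\Lambda}{}_i^{-1}$, $\overset{I}{B}(i)\mapsto\overset{I}{\Lambda}_i\overset{I}{L}{}^{(+)}(i)\overset{I}{T}(i)\overset{I}{L}{}^{(-)}(i)^{-1}\overset{I}{\Lambda}{}_i^{-1}$. The action $\triangleright$ of $\mathcal{L}_{g,0}(H)$ on $(H^* )^{\otimes g}$ is $\Psi_{g,0}$ followed by the componentwise action of $\mathcal{H}(\mathcal{O}(H))^{\otimes g}$. **Elements $x_N$.** For a family $\overset{I}{N}=\overset{I}{v}{}^m\overset{I}{N}{}_1^{n_1}\cdots\overset{I}{N}{}_l^{n_l}$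 ($m,n_k\in\mathbb{Z}$, each $N_k$ one of the generating matrices), let $j_N:H^*\to\mathcal{L}_{g,0}(H)$ be the linear map sending $\overset{I}{T}$ to $\overset{I}{N}$ entrywise for all $I$; for $x\in H$ put $x_N=j_N(\varphi_x)$ with $\varphi_x\in H^*$ the unique form such that $(\varphi_x\otimes\mathrm{id})(RR')=x$. Write $v_N^{-1}=(v^{-1})_N$. Here, for $i\ge2$, $\overset{I}{D}_i=\overset{I}{v}{}^2\overset{I}{A}(i-1)\overset{I}{B}(i)\overset{I}{A}(i)^{-1}\overset{I}{B}(i)^{-1}$ and $\overset{I}{E}_i=\overset{I}{v}{}^2\overset{I}{C}(1)\cdots\overset{I}{C}(i-1)\overset{I}{B}(i)\overset{I}{A}(i)^{-1}\overset{I}{B}(i)^{-1}$, with $\overset{I}{C}(k)=\overset{I}{v}{}^2\overset{I}{B}(k)\overset{I}{A}(k)^{-1}\overset{I}{B}(k)^{-1}\overset{I}{A}(k)$. **The case $g=1$.** $v_A^{-1}=j_A(\varphi_{v^{-1}})$ and $v_B^{-1}=j_B(\varphi_{v^{-1}})$ in $\mathcal{L}_{1,0}(H)$ act on $H^*$ through the algebra isomorphism $\Psi_{1,0}:\mathcal{L}_{1,0}(H)\to\mathcal{H}(\mathcal{O}(H))$, $\overset{I}{A}\mapsto\overset{I}{L}{}^{(+)}(\overset{I}{L}{}^{(-)})^{-1}$, $\overset{I}{B}\mapsto\overset{I}{L}{}^{(+)}\overset{I}{T}(\overset{I}{L}{}^{(-)})^{-1}$, followed by the action of $\mathcal{H}(\mathcal{O}(H))$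 on $H^*$ given by $\psi\triangleright\varphi=\psi\varphi$, $h\triangleright\varphi=\varphi(?h)$ for $\psi\in\mathcal{O}(H)$, $h\in H$. Their action is known: $v_A^{-1}\triangleright\varphi=\varphi(v^{-1}?)$ and $v_B^{-1}\triangleright\varphi=\mu^l(v)^{-1}\big(\mu^l(\kappa^{-1}v\,?)\,\varphi^v\big)^{v^{-1}}$, where $\varphi^h=\varphi(h?)$, the product is that of $\mathcal{O}(H)$, $\kappa=uv^{-1}$ is the pivotal element, and $\mu^l\in H^*$ is the left integral ($\varphi\mu^l=\varphi(1)\mu^l$ for all $\varphi\in\mathcal{O}(H)$), unique up to scalar. *)

(* Defs.v *)
From HB Require Import structures.
From mathcomp Require Export all_boot ssralg matrix vector falgebra.
From mathcomp Require Export reals complex.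
From mathcomp Require Import ssrnum generic_quotient mxtens boolp classical_sets.

Set Implicit Arguments.
Unset Strict Implicit.
Unset Printing Implicit Defensive.
Import GRing.Theory.
Local Open Scope quotient_scope.
Local Open Scope ring_scope.

(** The product of ['End(V)] in [falgebra] is [(f * g) u = g (f u)]; here it is
    the usual composition. *)
Definition endo (K : fieldType) (V : vectType K) : Type := 'End(V).

Section Endo.
Variables (K : fieldType) (V : vectType K).

HB.instance Definition _ := GRing.Lmodule.on (endo V).
HB.instance Definition _ := GRing.Zmodule_isPzRing.Build (endo V)
  (@comp_lfunA K V V V V) (@comp_lfun1l K V V) (@comp_lfun1r K V V)
  (@comp_lfunDl K V V V) (@comp_lfunDr K V V V).

End Endo.

(** * Tensor powers

    [tpow V n] is the [n]-th tensor power of [V], an element being given by its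
    coordinates in the basis of tensors of elements of [vbasis {:V}].
    [tlift F] is the linear map on [tpow V n] induced by a multilinear [F]. *)

Section TensorPowers.
Variables (K : fieldType) (V : vectType K).

Definition tpow (n : nat) : Type :=
  {ffun {ffun 'I_n -> 'I_(\dim {:V})} -> K^o}.
HB.instance Definition _ n := Vector.on (tpow n).

Definition tens n (x : 'I_n -> V) : tpow n :=
  [ffun m : {ffun 'I_n -> 'I_(\dim {:V})} =>
     \prod_(k < n) coord (vbasis {:V}) (m k) (x k)].

Definition tlift (W : lmodType K) n (F : ('I_n -> V) -> W) (t : tpow n) : W :=
  \sum_(m : {ffun 'I_n -> 'I_(\dim {:V})})
     t m *: F (fun k => (vbasis {:V})`_(m k)).

Definition sweedler (W : lmodType K) (t : tpow 2) (F : V -> V -> W) : W :=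
  tlift (fun x => F (x ord0) (x ord_max)) t.

Definition tens2 (a b : V) : tpow 2 := tens (fun k => [:: a; b]`_k).
Definition tens3 (a b c : V) : tpow 3 := tens (fun k => [:: a; b; c]`_k).

Definition tcons n (a : V) (t : tpow n) : tpow n.+1 :=
  tlift (fun x => tens (fun k => oapp x a (unlift ord0 k))) t.

(* [X] acting on the [k]-th tensor factor *)
Definition emb n (k : 'I_n) (X : endo V) : endo (tpow n) :=
  linfun (tlift (fun x => tens (fun l => if l == k then X (x l) else x l))).

End TensorPowers.

(** [\sw_(a, b <- t) E] is [E] with implicit summation over [t = a (x) b]; it is
    used only when [E] is bilinear in [(a, b)]. *)
Notation "'\sw_' ( a , b <- t ) E" := (sweedler t (fun a b => E))
  (at level 36, E at level 36, a name, b name, t at level 50,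
   format "'\sw_' ( a ,  b  <-  t )  E") : ring_scope.

Definition flip2 (K : fieldType) (V : vectType K) (t : tpow V 2) : tpow V 2 :=
  \sw_(a, b <- t) tens2 b a.

Definition tmul (K : fieldType) (H : falgType K) (s t : tpow H 2) : tpow H 2 :=
  \sw_(a, b <- s) \sw_(c, d <- t) tens2 (a * c) (b * d).

(** * Ribbon Hopf algebras *)

Record ribbonHopf (K : fieldType) (H : falgType K) := RibbonHopf {
  cop : 'Hom(H, tpow H 2);
  cou : 'Hom(H, K^o);
  anti : 'End(H);
  Rmat : tpow H 2;
  Rinv : tpow H 2;
  rib : H;

  cop_coassoc : forall x,
    \sw_(a, b <- cop x) \sw_(c, d <- cop a) tens3 c d b =
    \sw_(a, b <- cop x) \sw_(c, d <- cop b) tens3 a c d;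
  cop_counitl : forall x, \sw_(a, b <- cop x) (cou a *: b) = x;
  cop_counitr : forall x, \sw_(a, b <- cop x) (cou b *: a) = x;
  cop_unit : cop 1 = tens2 1 1;
  cop_mul : forall x y, cop (x * y) = tmul (cop x) (cop y);
  cou_unit : cou 1 = 1;
  cou_mul : forall x y, cou (x * y) = cou x * cou y;
  anti_l : forall x, \sw_(a, b <- cop x) (anti a * b) = cou x *: 1;
  anti_r : forall x, \sw_(a, b <- cop x) (a * anti b) = cou x *: 1;

  RmatV : tmul Rmat Rinv = tens2 1 1;
  VRmat : tmul Rinv Rmat = tens2 1 1;
  Rmat_cop : forall x, tmul Rmat (cop x) = tmul (flip2 (cop x)) Rmat;
  (* (Delta (x) id)(R) = R13 R23 *)
  Rmat_copl : \sw_(a, b <- Rmat) \sw_(c, d <- cop a) tens3 c d b =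
              \sw_(a, b <- Rmat) \sw_(c, d <- Rmat) tens3 a c (b * d);
  (* (id (x) Delta)(R) = R13 R12 *)
  Rmat_copr : \sw_(a, b <- Rmat) \sw_(c, d <- cop b) tens3 a c d =
              \sw_(a, b <- Rmat) \sw_(c, d <- Rmat) tens3 (a * c) d b;

  rib_unit : rib \is a GRing.unit;
  rib_central : forall x, rib * x = x * rib;
  rib_sqr : rib ^+ 2 = (\sw_(a, b <- Rmat) (anti b * a)) *
                       anti (\sw_(a, b <- Rmat) (anti b * a));
  (* Delta(v) = (R'R)^-1 (v (x) v) *)
  rib_cop : cop rib = tmul (tmul Rinv (flip2 Rinv)) (tens2 rib rib);
  rib_anti : anti rib = rib
}.

Section RibbonHopfTheory.
Variables (K : fieldType) (H : falgType K) (X : ribbonHopf H).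

Local Notation "'Delta'" := (cop X).
Local Notation "'R'" := (Rmat X).
Local Notation dual := 'Hom(H, K^o).

Definition antiV : 'End(H) := ((anti X)^-1)%VF.

(* [itcop n] is Delta^(n), with Delta^(0) = id *)
Fixpoint itcop (n : nat) (x : H) : tpow H n.+1 :=
  if n is n'.+1 then \sw_(a, b <- Delta x) tcons a (itcop n' b)
  else tens (fun=> x).

Definition drinfeld (phi : dual) : H :=
  \sw_(a, b <- tmul R (flip2 R)) (phi a *: b).

Definition factorizable : Prop := bijective drinfeld.

(* the form phi_x with (phi_x (x) id)(RR') = x *)
Definition form_of (x : H) : dual := ((linfun drinfeld)^-1)%VF x.

(* phi(x ? y) *)
Definition shift (phi : dual) (x y : H) : dual :=
  linfun (fun h => phi (x * h * y)).

Definition dmul (phi psi : dual) : dual :=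
  linfun (fun x => \sw_(a, b <- Delta x) (phi a * psi b : K^o)).

(** ** Modules with a chosen basis, as matrix representations *)

Definition mxrep (n : nat) : Type := {lrmorphism H -> 'M[K]_n}.

Definition Tmx n (rho : H -> 'M[K]_n) : 'M[dual]_n :=
  \matrix_(p, q) linfun (fun x => rho x p q : K^o).

Definition tens_rep m n (I : mxrep m) (J : mxrep n) (x : H) : 'M[K]_(m * n) :=
  \sw_(a, b <- Delta x) (I a *t J b).

Definition mx12 m n (I : mxrep m) (J : mxrep n) (t : tpow H 2) :
    'M[K]_(m * n) :=
  \sw_(a, b <- t) (I a *t J b).

(** ** Matrices over a (noncommutative) algebra *)

Section Matrices.
Variable B : pzRingType.

Definition fst_mx m n (M : 'M[B]_m) : 'M[B]_(m * n) := M *t (1%:M : 'M_n).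
Definition snd_mx m n (N : 'M[B]_n) : 'M[B]_(m * n) := (1%:M : 'M_m) *t N.
(* the two-sided inverse of [M] if there is one, and [M] otherwise *)
Definition mxinv n (M : 'M[B]_n) : 'M[B]_n :=
  xget M [set N | M *m N = 1%:M /\ N *m M = 1%:M]%classic.

End Matrices.

(** ** The algebra [L_{g,0}(H)]

    MathComp's [algType] requires [1 <> 0], which for an algebra given by
    generators and relations would have to be proved. So [Lg0] below is only
    given its [pzRingType] and [lmodType] structures, together with
    [Lg0_scaleAl] and [Lg0_scaleAr]. *)

Variant handle := handleA | handleB.

Section Lg0.
Variable g : nat.

(* The relations are stated in a ring [B] with scalars embedded by [iota];
   [U c i phi] is the image of [phi] in the copy of the dual labelled [c], [i]. *)
Record Lg0_relations (B : pzRingType) (iota : K -> B)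
    (U : handle -> 'I_g -> dual -> B) : Prop := Lg0Relations {
  rel_unit : forall c i, U c i (cou X) = 1;
  rel_fusion : forall c i m n (I : mxrep m) (J : mxrep n),
    map_mx (U c i) (Tmx (tens_rep I J)) =
      fst_mx n (map_mx (U c i) (Tmx I)) *m
      map_mx iota (mx12 I J (flip2 R)) *m
      snd_mx m (map_mx (U c i) (Tmx J)) *m
      map_mx iota (invmx (mx12 I J (flip2 R)));
  rel_exchange : forall c d (i j : 'I_g) m n (I : mxrep m) (J : mxrep n),
    (i < j)%N ->
    map_mx iota (mx12 I J R) *m fst_mx n (map_mx (U c i) (Tmx I)) *m
      map_mx iota (invmx (mx12 I J R)) *m snd_mx m (map_mx (U d j) (Tmx J)) =
    snd_mx m (map_mx (U d j) (Tmx J)) *m map_mx iota (mx12 I J R) *m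
      fst_mx n (map_mx (U c i) (Tmx I)) *m map_mx iota (invmx (mx12 I J R));
  rel_handle : forall (i : 'I_g) m n (I : mxrep m) (J : mxrep n),
    map_mx iota (mx12 I J R) *m fst_mx n (map_mx (U handleB i) (Tmx I)) *m
      map_mx iota (mx12 I J (flip2 R)) *m
      snd_mx m (map_mx (U handleA i) (Tmx J)) =
    snd_mx m (map_mx (U handleA i) (Tmx J)) *m map_mx iota (mx12 I J R) *m
      fst_mx n (map_mx (U handleB i) (Tmx I)) *m
      map_mx iota (invmx (mx12 I J R))
}.

Inductive Lg0_expr :=
  | EGen of handle & 'I_g & dual
  | EOne
  | EAdd of Lg0_expr & Lg0_expr
  | EMul of Lg0_expr & Lg0_expr
  | EScale of K & Lg0_expr.

HB.instance Definition _ := gen_eqMixin Lg0_expr.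
HB.instance Definition _ := gen_choiceMixin Lg0_expr.

Fixpoint Lg0_eval (B : algType K) (U : handle -> 'I_g -> {linear dual -> B})
    (e : Lg0_expr) : B :=
  match e with
  | EGen c i phi => U c i phi
  | EOne => 1
  | EAdd e1 e2 => Lg0_eval U e1 + Lg0_eval U e2
  | EMul e1 e2 => Lg0_eval U e1 * Lg0_eval U e2
  | EScale k e1 => k *: Lg0_eval U e1
  end.

(* Two expressions in the generators are equal in the algebra presented by the
   relations iff they are equal in every algebra satisfying these relations.
   [Lg0_gen_relations] and [Lg0_universal] below check that the quotient is the
   presented algebra. *)
Definition Lg0_eqv (e1 e2 : Lg0_expr) : bool :=
  `[< forall (B : algType K) (U : handle -> 'I_g -> {linear dual -> B}),
        Lg0_relations (in_alg B) U -> Lg0_eval U e1 = Lg0_eval U e2 >].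

Lemma Lg0_eqv_refl : reflexive Lg0_eqv.
Proof. by move=> e; apply/asboolP. Qed.
Lemma Lg0_eqv_sym : symmetric Lg0_eqv.
Proof.
by move=> e1 e2; apply/asboolP/asboolP => h B U hU; rewrite (h B U hU).
Qed.
Lemma Lg0_eqv_trans : transitive Lg0_eqv.
Proof.
move=> e2 e1 e3 /asboolP h /asboolP h'; apply/asboolP => B U hU.
by rewrite (h B U hU) (h' B U hU).
Qed.

Canonical Lg0_eqv_rel := EquivRel Lg0_eqv Lg0_eqv_refl Lg0_eqv_sym Lg0_eqv_trans.

Definition Lg0 : Type := {eq_quot Lg0_eqv_rel}.
HB.instance Definition _ := Choice.on Lg0.
HB.instance Definition _ := EqQuotient.on Lg0.

Definition Lg0_ev (B : algType K) (U : handle -> 'I_g -> {linear dual -> B})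
  (x : Lg0) : B := Lg0_eval U (repr x).

Lemma Lg0_evE (B : algType K) (U : handle -> 'I_g -> {linear dual -> B}) e :
  Lg0_relations (in_alg B) U -> Lg0_ev U (\pi_Lg0 e) = Lg0_eval U e.
Proof.
move=> hU; rewrite /Lg0_ev.
have: Lg0_eqv (repr (\pi_Lg0 e)) e.
  by have /eqmodP := reprK (\pi_Lg0 e).
by move/asboolP/(_ B U hU).
Qed.

Lemma Lg0_ext (x y : Lg0) :
  (forall (B : algType K) (U : handle -> 'I_g -> {linear dual -> B}),
     Lg0_relations (in_alg B) U -> Lg0_ev U x = Lg0_ev U y) -> x = y.
Proof.
move=> h; rewrite -[x]reprK -[y]reprK; apply/eqmodP; apply/asboolP => B U hU.
exact: h.
Qed.

Definition Lg0_one : Lg0 := \pi_Lg0 EOne.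
Definition Lg0_scale (k : K) (x : Lg0) : Lg0 := \pi_Lg0 (EScale k (repr x)).
Definition Lg0_zero : Lg0 := Lg0_scale 0 Lg0_one.
Definition Lg0_opp (x : Lg0) : Lg0 := Lg0_scale (-1) x.
Definition Lg0_add (x y : Lg0) : Lg0 := \pi_Lg0 (EAdd (repr x) (repr y)).
Definition Lg0_mul (x y : Lg0) : Lg0 := \pi_Lg0 (EMul (repr x) (repr y)).

Section Eval.
Variables (B : algType K) (U : handle -> 'I_g -> {linear dual -> B}).
Hypothesis hU : Lg0_relations (in_alg B) U.

Lemma ev_one : Lg0_ev U Lg0_one = 1. Proof. exact: Lg0_evE. Qed.
Lemma ev_scale k x : Lg0_ev U (Lg0_scale k x) = k *: Lg0_ev U x.
Proof. exact: Lg0_evE. Qed.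
Lemma ev_zero : Lg0_ev U Lg0_zero = 0.
Proof. by rewrite ev_scale scale0r. Qed.
Lemma ev_opp x : Lg0_ev U (Lg0_opp x) = - Lg0_ev U x.
Proof. by rewrite ev_scale scaleN1r. Qed.
Lemma ev_add x y : Lg0_ev U (Lg0_add x y) = Lg0_ev U x + Lg0_ev U y.
Proof. exact: Lg0_evE. Qed.
Lemma ev_mul x y : Lg0_ev U (Lg0_mul x y) = Lg0_ev U x * Lg0_ev U y.
Proof. exact: Lg0_evE. Qed.

End Eval.

Local Ltac by_ev :=
  let hU := fresh in move=> *; apply: Lg0_ext => ? ? hU;
  rewrite ?(ev_add hU, ev_mul hU, ev_opp hU, ev_zero hU, ev_scale hU, ev_one hU).

Fact Lg0_addA : associative Lg0_add. Proof. by by_ev; rewrite addrA. Qed.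
Fact Lg0_addC : commutative Lg0_add. Proof. by by_ev; rewrite addrC. Qed.
Fact Lg0_add0 : left_id Lg0_zero Lg0_add. Proof. by by_ev; rewrite add0r. Qed.
Fact Lg0_addN : left_inverse Lg0_zero Lg0_opp Lg0_add.
Proof. by by_ev; rewrite addNr. Qed.
HB.instance Definition _ :=
  GRing.isZmodule.Build Lg0 Lg0_addA Lg0_addC Lg0_add0 Lg0_addN.

Fact Lg0_mulA : associative Lg0_mul. Proof. by by_ev; rewrite mulrA. Qed.
Fact Lg0_mul1 : left_id Lg0_one Lg0_mul. Proof. by by_ev; rewrite mul1r. Qed.
Fact Lg0_1mul : right_id Lg0_one Lg0_mul. Proof. by by_ev; rewrite mulr1. Qed.
Fact Lg0_mulDl : left_distributive Lg0_mul Lg0_add.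
Proof. by by_ev; rewrite mulrDl. Qed.
Fact Lg0_mulDr : right_distributive Lg0_mul Lg0_add.
Proof. by by_ev; rewrite mulrDr. Qed.
HB.instance Definition _ := GRing.Zmodule_isPzRing.Build Lg0
  Lg0_mulA Lg0_mul1 Lg0_1mul Lg0_mulDl Lg0_mulDr.

Fact Lg0_scaleA k l (x : Lg0) :
  Lg0_scale k (Lg0_scale l x) = Lg0_scale (k * l) x.
Proof. by by_ev; rewrite scalerA. Qed.
Fact Lg0_scale1 : left_id 1 Lg0_scale. Proof. by by_ev; rewrite scale1r. Qed.
Fact Lg0_scaleDr : right_distributive Lg0_scale +%R.
Proof. by by_ev; rewrite scalerDr. Qed.
Fact Lg0_scaleDl x : {morph Lg0_scale^~ x : k l / k + l}.
Proof. by by_ev; rewrite scalerDl. Qed.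
HB.instance Definition _ := GRing.Zmodule_isLmodule.Build K Lg0
  Lg0_scaleA Lg0_scale1 Lg0_scaleDr Lg0_scaleDl.

Fact Lg0_scaleAl (k : K) (x y : Lg0) : k *: (x * y) = (k *: x) * y.
Proof. by move: k x y; by_ev; rewrite scalerAl. Qed.
Fact Lg0_scaleAr (k : K) (x y : Lg0) : k *: (x * y) = x * (k *: y).
Proof. by move: k x y; by_ev; rewrite scalerAr. Qed.
Definition Lg0_scalar (k : K) : Lg0 := k *: (1 : Lg0).

Definition Lg0_gen (c : handle) (i : 'I_g) (phi : dual) : Lg0 :=
  \pi_Lg0 (EGen c i phi).

Fact Lg0_gen_linear c i : linear (Lg0_gen c i).
Proof.
move=> k phi psi; apply: Lg0_ext => B U hU.
by rewrite (ev_add hU) (ev_scale hU) !(Lg0_evE _ hU) /= linearP.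
Qed.
HB.instance Definition _ c i :=
  GRing.isLinear.Build K dual Lg0 *:%R (Lg0_gen c i) (Lg0_gen_linear c i).

Section Universal.
Variables (B : algType K) (U : handle -> 'I_g -> {linear dual -> B}).
Hypothesis hU : Lg0_relations (in_alg B) U.

Let ev (x : Lg0) : B := Lg0_ev U x.
Fact ev_is_zmod_morphism : zmod_morphism ev.
Proof. by move=> x y; rewrite /ev (ev_add hU) (ev_opp hU). Qed.
Fact ev_is_monoid_morphism : monoid_morphism ev.
Proof.
by split=> [|x y]; [exact: (ev_one hU) | exact: (ev_mul hU)].
Qed.

HB.instance Definition _ :=
  GRing.isZmodMorphism.Build Lg0 B ev ev_is_zmod_morphism.
HB.instance Definition _ :=
  GRing.isMonoidMorphism.Build Lg0 B ev ev_is_monoid_morphism.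
Definition ev_rmorphism : {rmorphism Lg0 -> B} := ev.

Lemma ev_rmorphism_gen c i phi : ev_rmorphism (Lg0_gen c i phi) = U c i phi.
Proof. exact: Lg0_evE. Qed.
Lemma ev_rmorphism_scale k x : ev_rmorphism (k *: x) = k *: ev_rmorphism x.
Proof. exact: (ev_scale hU). Qed.

End Universal.

Lemma Lg0_gen_relations :
  Lg0_relations Lg0_scalar Lg0_gen.
Proof.
have mapT (B B' : pzRingType) (f : {rmorphism B -> B'}) p q (M : 'M[B]_p)
    (N : 'M[B]_q) : map_mx f (M *t N) = map_mx f M *t map_mx f N.
  by apply/matrixP => r s; rewrite !mxE rmorphM.
have mapG (B : algType K) (U : handle -> 'I_g -> {linear dual -> B})
    (hU : Lg0_relations (in_alg B) U) c i p (M : 'M[dual]_p) :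
    map_mx (ev_rmorphism hU) (map_mx (Lg0_gen c i) M) = map_mx (U c i) M.
  by apply/matrixP => r s; rewrite !mxE ev_rmorphism_gen.
have mapS (B : algType K) (U : handle -> 'I_g -> {linear dual -> B})
    (hU : Lg0_relations (in_alg B) U) p (M : 'M[K]_p) :
    map_mx (ev_rmorphism hU) (map_mx Lg0_scalar M) =
    map_mx (in_alg B) M.
  by apply/matrixP => r s; rewrite !mxE ev_rmorphism_scale rmorph1.
have ext p (M N : 'M[Lg0]_p) :
    (forall (B : algType K) (U : handle -> 'I_g -> {linear dual -> B})
      (hU : Lg0_relations (in_alg B) U),
    map_mx (ev_rmorphism hU) M = map_mx (ev_rmorphism hU) N) -> M = N.
  move=> h; apply/matrixP => r s; apply: Lg0_ext => B U hU.
  by move/matrixP: (h B U hU) => /(_ r s); rewrite !mxE.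
split.
- by move=> c i; apply: Lg0_ext => B U hU; rewrite (Lg0_evE _ hU) (ev_one hU)
    /= (rel_unit hU).
- move=> c i m n I J; apply: ext => B U hU.
  by rewrite !map_mxM !mapT !map_mx1 !mapG !mapS (rel_fusion hU).
- move=> c d i j m n I J ij; apply: ext => B U hU.
  by rewrite !map_mxM !mapT !map_mx1 !mapG !mapS (rel_exchange hU).
- move=> i m n I J; apply: ext => B U hU.
  by rewrite !map_mxM !mapT !map_mx1 !mapG !mapS (rel_handle hU).
Qed.

Lemma Lg0_universal (B : algType K)
    (U : handle -> 'I_g -> {linear dual -> B}) :
  Lg0_relations (in_alg B) U ->
  exists! f : Lg0 -> B, [/\ linear f, monoid_morphism f &
    forall c i phi, f (Lg0_gen c i phi) = U c i phi].
Proof.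
move=> hU; exists (ev_rmorphism hU); split.
  split; last exact: ev_rmorphism_gen.
    by move=> k x y; rewrite rmorphD ev_rmorphism_scale.
  exact: ev_is_monoid_morphism.
move=> f [fL [f1 fM] fG]; apply/funext => x; rewrite -[x]reprK.
elim: (repr x) => [c i phi||e1 IH1 e2 IH2|e1 IH1 e2 IH2|k e IH].
- by rewrite ev_rmorphism_gen fG.
- by rewrite rmorph1 f1.
- have -> : \pi_Lg0 (EAdd e1 e2) = \pi_Lg0 e1 + \pi_Lg0 e2.
    by apply: Lg0_ext => B' U' hU'; rewrite (ev_add hU') !(Lg0_evE _ hU').
  rewrite rmorphD IH1 IH2; have := fL 1 (\pi_Lg0 e1) (\pi_Lg0 e2).
  by rewrite !scale1r.
- have -> : \pi_Lg0 (EMul e1 e2) = \pi_Lg0 e1 * \pi_Lg0 e2.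
    by apply: Lg0_ext => B' U' hU'; rewrite (ev_mul hU') !(Lg0_evE _ hU').
  by rewrite rmorphM IH1 IH2 fM.
- have -> : \pi_Lg0 (EScale k e) = k *: \pi_Lg0 e.
    by apply: Lg0_ext => B' U' hU'; rewrite (ev_scale hU') !(Lg0_evE _ hU').
  have f0 : f 0 = 0.
    have := fL (-1) 0 0.
    by rewrite scaler0 addr0 scaleN1r => ->; rewrite addrC subrr.
  by rewrite ev_rmorphism_scale IH -[k *: \pi_Lg0 e]addr0 fL f0 addr0.
Qed.

(** ** The elements [x_N] *)

Local Notation family := (forall n, mxrep n -> 'M[Lg0]_n).

Definition Lgmx (c : handle) (i : 'I_g) : family :=
  fun n I => map_mx (Lg0_gen c i) (Tmx I).

Local Notation A := (Lgmx handleA).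
Local Notation B := (Lgmx handleB).

(* the matrix of [x] acting on [I], with entries viewed in [Lg0] *)
Definition Lg0_act n (I : mxrep n) (x : H) : 'M[Lg0]_n :=
  map_mx Lg0_scalar (I x).

(* the linear map sending the matrix T of [I] to [N I] entrywise, for all [I];
   it is unique because the entries of these matrices span the dual *)
Definition jmap (N : family) : dual -> Lg0 :=
  xget (fun=> 0) [set j : dual -> Lg0 |
    linear j /\ forall n (I : mxrep n), map_mx j (Tmx I) = N n I]%classic.

Definition elt (N : family) (x : H) : Lg0 := jmap N (form_of x).

Definition fam_C (k : 'I_g) : family := fun n I =>
  Lg0_act I (rib X ^+ 2) *m B k I *m mxinv (A k I) *m mxinv (B k I) *m A k I.

(* D_i, where [i'] stands for i - 1 *)
Definition fam_D (i' i : 'I_g) : family := fun n I =>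
  Lg0_act I (rib X ^+ 2) *m A i' I *m B i I *m mxinv (A i I) *m mxinv (B i I).

Definition fam_E (i : 'I_g) : family := fun n I =>
  Lg0_act I (rib X ^+ 2) *m (\big[mulmx/1%:M]_(k < g | (k < i)%N) fam_C k I) *m
  B i I *m mxinv (A i I) *m mxinv (B i I).

End Lg0.

(** ** The representation

    The Heisenberg double of O(H) is identified with the algebra of
    endomorphisms of the dual through its faithful action, and its [g]-th
    tensor power with the endomorphisms of the [g]-th tensor power of the
    dual. *)

Definition act_form (psi : dual) : endo dual := linfun (dmul psi).
Definition act_H (h : H) : endo dual := linfun (fun phi => shift phi 1 h).
Definition act_Ht (h : H) : endo dual :=
  linfun (fun phi => shift phi (antiV h) 1).

Section LMatrices.
(* [e] embeds the Heisenberg double in an algebra of endomorphisms *)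
Variables (V : vectType K) (e : endo dual -> endo V).
Variables (n : nat) (I : mxrep n).

Definition Lplus : 'M[endo V]_n :=
  \matrix_(p, q) \sw_(a, b <- R) (I a p q *: e (act_H b)).
Definition Lminus : 'M[endo V]_n :=
  \matrix_(p, q) \sw_(a, b <- R) (I (antiV b) p q *: e (act_H a)).
Definition Lminust : 'M[endo V]_n :=
  \matrix_(p, q) \sw_(a, b <- R) (I (antiV b) p q *: e (act_Ht a)).
Definition Tmat : 'M[endo V]_n :=
  \matrix_(p, q) e (act_form (Tmx I p q)).

End LMatrices.

Definition Lambda g (i : 'I_g) n (I : mxrep n) : 'M[endo (tpow dual g)]_n :=
  \big[mulmx/1%:M]_(k < g | (k < i)%N)
    (Lminus (emb k) I *m Lminust (emb k) I).

Definition is_Psi g (Psi : Lg0 g -> endo (tpow dual g)) : Prop :=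
  [/\ linear Psi, monoid_morphism Psi, bijective Psi &
    forall n (I : mxrep n) (i : 'I_g),
      map_mx Psi (Lgmx handleA i I) =
        Lambda i I *m Lplus (emb i) I *m mxinv (Lminus (emb i) I) *m
        mxinv (Lambda i I) /\
      map_mx Psi (Lgmx handleB i I) =
        Lambda i I *m Lplus (emb i) I *m Tmat (emb i) I *m
        mxinv (Lminus (emb i) I) *m mxinv (Lambda i I)].

(* the case g = 1, with values in the Heisenberg double itself *)
Definition is_Psi1 (Psi : Lg0 1 -> endo dual) : Prop :=
  [/\ linear Psi, monoid_morphism Psi, bijective Psi &
    forall n (I : mxrep n),
      map_mx Psi (Lgmx handleA ord0 I) = Lplus id I *m mxinv (Lminus id I) /\
      map_mx Psi (Lgmx handleB ord0 I) =
        Lplus id I *m Tmat id I *m mxinv (Lminus id I)].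

End RibbonHopfTheory.

(* Main.v *)
(** Applying a linear form to the leg in [H], a family of matrices with entries
    in an algebra [E], one for each [H]-module and natural in it, is an element
    of [H (x) E]. In this language the images of [A(i)], [B(i)] under [Psi] are
    products of copies of [R^{+-1}] acting through [H] (leg 0), [h |-> h] and
    [h |-> h~] in the [i]-th factor, and of [T]. Exchanging [T] with
    [Delta(h)] turns [v^2 B A^-1 B^-1] into [W^-1 (RR')_{0,~} W], where [W] is
    the [R]-matrix between the two commuting copies of [H] in a factor; the
    ribbon relation for [Delta(v)] removes the monodromies that appear. By the
    Yang-Baxter equation [C(k)] becomes [R_{0,k} R_{0,~k} R_{~k,0} R_{k,0}] up
    to conjugation by [Lambda_k], the product of the [C(k)] telescopes, and
    [(id (x) Delta)(RR')] collects everything into one iterated coproduct.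

    The conjugations by [Lambda_i] that remain are invisible: as [v] is
    central, the form [phi] with [(phi (x) id)(RR') = v^-1] satisfies
    [phi(S^-1(h'') ? h') = eps(h) phi], and [(id (x) Delta)(R) = R13 R12] then
    shows that conjugating by an [R]-matrix does not change the value at
    [phi]. *)

Require Import Defs.
From HB Require Import structures.
From mathcomp Require Import boolp classical_sets.

Set Implicit Arguments.
Unset Strict Implicit.
Unset Printing Implicit Defensive.
Import GRing.Theory.
Local Open Scope ring_scope.

(** * Linear and multilinear maps *)

(** Leg notation is rendered by evaluation. Two commuting algebra maps from H to an algebra M send a
    tensor in H (x) H to M, and all the R-matrices between leg 0 and the copies of H in the g
    factors live in one such M, the matrices over the endomorphisms of the tensor power. Each
    identity is then proved once for abstract maps f, t, a, the coproduct becoming the convolution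
    of maps.

    [jmap] is only a choice, so a family is controlled by exhibiting a linear map j on the dual that
    produces its matrices; bijectivity of Psi pulls j back to [Lg0]. The invariance of phi is
    likewise used on j, at one form, and not on matrices.

    Bijectivity of the antipode is not a field of [ribbonHopf]. It is derived from u S(u) = v^2 and
    S^2(x) u = u x; that S reverses products and that the counit is trivial on either leg of R are
    derived as well. *)

Definition lin (K : pzRingType) (U V : lmodType K) (f : U -> V) : Prop :=
  forall k x y, f (k *: x + y) = k *: f x + f y.

Section LinearMaps.
Variable K : fieldType.
Implicit Types U V W : lmodType K.

Lemma lin0 U V (f : U -> V) : lin f -> f 0 = 0.
Proof.
move=> fl; have := fl (-1) 0 0.
by rewrite scaler0 addr0 scaleN1r => ->; rewrite addrC subrr.
Qed.

Lemma linD U V (f : U -> V) : lin f -> {morph f : x y / x + y}.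
Proof. by move=> fl x y; have := fl 1 x y; rewrite !scale1r. Qed.

Lemma linZ U V (f : U -> V) : lin f -> forall k, {morph f : x / k *: x}.
Proof. by move=> fl k x; have := fl k x 0; rewrite !addr0 (lin0 fl) addr0. Qed.

Lemma lin_sum U V (f : U -> V) J (r : seq J) (P : pred J) (F : J -> U) :
  lin f -> f (\sum_(j <- r | P j) F j) = \sum_(j <- r | P j) f (F j).
Proof. by move=> fl; apply: big_morph; [exact: linD | exact: lin0]. Qed.

Lemma lin_linear U V (f : {linear U -> V}) : lin f.
Proof. by move=> k x y; rewrite linearP. Qed.

Lemma lin_id U : lin (fun x : U => x).
Proof. by []. Qed.

Lemma lin_comp U V W (g : V -> W) (f : U -> V) :
  lin g -> lin f -> lin (fun x => g (f x)).
Proof. by move=> gl fl k x y; rewrite fl gl. Qed.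

Lemma lin_scale U V (c : K) (f : U -> V) : lin f -> lin (fun x => c *: f x).
Proof. by move=> fl k x y; rewrite fl scalerDr !scalerA mulrC. Qed.

Lemma lin_scalel U V (w : V) (f : U -> K^o) : lin f -> lin (fun x => f x *: w).
Proof. by move=> fl k x y; rewrite fl scalerDl -scalerA. Qed.

End LinearMaps.

Section Tensors.
Variables (K : fieldType) (V : vectType K).
Implicit Types W : lmodType K.
Local Notation d := (\dim {:V}).
Local Notation bas := (vbasis {:V}).

(** The function inside [tcons], named so that multilinearity can be defined by recursion on the
    number of arguments. *)
Definition fcons (n : nat) (a : V) (y : 'I_n -> V) : 'I_n.+1 -> V :=
  fun k => oapp y a (unlift ord0 k).

Lemma fcons0 n a (y : 'I_n -> V) : fcons a y ord0 = a.
Proof. by rewrite /fcons unlift_none. Qed.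

Lemma fconsS n a (y : 'I_n -> V) k : fcons a y (lift ord0 k) = y k.
Proof. by rewrite /fcons liftK. Qed.

Lemma fcons_eta n (x : 'I_n.+1 -> V) :
  fcons (x ord0) (fun k => x (lift ord0 k)) = x.
Proof.
apply/funext => k; rewrite /fcons.
by case: unliftP => [j ->|->].
Qed.

Fixpoint multilinear W n : (('I_n -> V) -> W) -> Prop :=
  if n is n'.+1 then fun F =>
    (forall y, lin (fun a => F (fcons a y))) /\
    (forall a, multilinear (fun y => F (fcons a y)))
  else fun=> True.

Lemma tlift_lin W n (F : ('I_n -> V) -> W) : lin (tlift F).
Proof.
move=> k s t; rewrite /tlift scaler_sumr -big_split; apply: eq_bigr => m _.
by rewrite /= !ffunE scalerDl scalerA.
Qed.

Lemma eq_tlift W n (F G : ('I_n -> V) -> W) t :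
  (forall x, F x = G x) -> tlift F t = tlift G t.
Proof. by move=> FG; apply: eq_bigr => m _; rewrite FG. Qed.

Lemma lin_tlift W W' n (L : W -> W') (F : ('I_n -> V) -> W) t :
  lin L -> L (tlift F t) = tlift (fun x => L (F x)) t.
Proof.
by move=> Ll; rewrite /tlift lin_sum //; apply: eq_bigr => m _; rewrite linZ.
Qed.

Lemma tens_bas n (c : tpow V n) :
  c = \sum_m c m *: tens (fun k => bas`_(m k)).
Proof.
apply/ffunP => m'; rewrite sum_ffunE (bigD1 m') //= big1 ?addr0 => [|m1 ne].
  rewrite !ffunE big1 ?mulr1; first by rewrite /GRing.scale /= mulr1.
  by move=> k _; rewrite (coord_free _ _ (basis_free (vbasisP _))) eqxx.
rewrite !ffunE; have [k nek] : exists k, m1 k != m' k.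
  by apply/existsP; apply: contra_neqT ne; rewrite negb_exists => /forallP e;
    apply/ffunP => k; apply/eqP; have := e k; rewrite negbK.
rewrite (bigD1 k) //= (coord_free _ _ (basis_free (vbasisP _))).
by have [e|_] := eqVneq (m1 k); [case/eqP: nek | rewrite mul0r scaler0].
Qed.

(** The universal property of the tensor power: the first argument is expanded in the basis, the
    others are handled by induction. *)
Lemma tlift_tens W n (F : ('I_n -> V) -> W) (x : 'I_n -> V) :
  multilinear F -> tlift F (tens x) = F x.
Proof.
elim: n F x => [|n IH] F x.
  move=> _; rewrite /tlift.
  have e (y : 'I_0 -> V) : y = x by apply/funext => - [].
  rewrite (eq_bigr (fun=> F x)) => [|m _]; last first.
    by rewrite ffunE big_ord0 scale1r (e (fun=> _)).
  by rewrite sumr_const card_ffun !card_ord expn0.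
move=> [Fl Fm]; set y := fun k => x (lift ord0 k).
have -> : F x = \sum_(j < d) coord bas j (x ord0) *: F (fcons bas`_j y).
  rewrite -{1}(fcons_eta x) -/y {1}(coord_vbasis (memvf (x ord0))).
  rewrite (lin_sum (f := fun a => F (fcons a y))) //.
  by apply: eq_bigr => j _; rewrite (linZ (Fl y)).
under eq_bigr => j _.
  rewrite -(IH (fun z => F (fcons bas`_j z)) y (Fm _)) /tlift scaler_sumr; over.
rewrite pair_bigA /= /tlift.
(* A head and a tail index make up a multi-index of length n + 1; [h'] is the inverse bijection. *)
pose h (p : 'I_d * {ffun 'I_n -> 'I_d}) : {ffun 'I_n.+1 -> 'I_d} :=
  [ffun k => oapp p.2 p.1 (unlift ord0 k)].
pose h' (m : {ffun 'I_n.+1 -> 'I_d}) : 'I_d * {ffun 'I_n -> 'I_d} :=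
  (m ord0, [ffun k => m (lift ord0 k)]).
rewrite (reindex h); last first.
  exists h' => [[j m] _|m _].
    congr pair; first by rewrite ffunE unlift_none.
    by apply/ffunP => k; rewrite !ffunE liftK.
  apply/ffunP => k; rewrite ffunE; case: unliftP => [l ->|->] //=.
  by rewrite ffunE.
apply: eq_bigr => -[j m] _ /=; rewrite scalerA; congr (_ *: F _).
  rewrite !ffunE big_ord_recl ffunE unlift_none /=; congr (_ * _).
  by apply: eq_bigr => k _; rewrite !ffunE liftK.
apply/funext => k; rewrite /fcons ffunE; by case: unliftP.
Qed.

(** In the induction [c] collects the factors of the arguments already fixed, while the index type
    [J] stays the same as [n] decreases. *)
Lemma multilinear_prod (J : finType) n (c : J -> K) (l : 'I_n -> J -> V -> K) :
  (forall k m, lin (l k m : V -> K^o)) ->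
  multilinear (W := {ffun J -> K^o})
    (fun x => [ffun m => c m * \prod_(k < n) l k m (x k)]).
Proof.
elim: n c l => [|n IH] c l ll //=; split=> [y k u v|a].
  have e a m : \prod_(i < n) l (lift ord0 i) m (fcons a y (lift ord0 i)) =
      \prod_(i < n) l (lift ord0 i) m (y i).
    by apply: eq_bigr => i _; rewrite fconsS.
  apply/ffunP => m; rewrite !ffunE !big_ord_recl !fcons0 ll !e.
  by rewrite mulrDl mulrDr /GRing.scale /= -!mulrA [c m * (k * _)]mulrCA.
have := IH (fun m => c m * l ord0 m a) (fun k => l (lift ord0 k))
  (fun k m => ll _ _).
congr multilinear; apply/funext => y; apply/ffunP => m.
rewrite !ffunE big_ord_recl fcons0 mulrA; congr (_ * _).
by apply: eq_bigr => k _; rewrite fconsS.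
Qed.

Lemma multilinear_tens n (L : 'I_n -> V -> V) :
  (forall k, lin (L k)) -> multilinear (fun x => tens (fun k => L k (x k))).
Proof.
move=> Ll.
rewrite (_ : (fun x => _) = fun x : 'I_n -> V =>
  [ffun m : {ffun 'I_n -> 'I_d} =>
     1 * \prod_(k < n) coord bas (m k) (L k (x k))]); last first.
  by apply/funext => x; apply/ffunP => m; rewrite !ffunE mul1r.
apply: (@multilinear_prod {ffun 'I_n -> 'I_d} n (fun=> 1)
  (fun k m v => coord bas (m k) (L k v))).
by move=> k m u v w; rewrite Ll linearP.
Qed.

End Tensors.

(** * Sweedler sums *)

(* Unlike in an [algType], 1 = 0 is allowed, because of ['M_0]. *)
HB.mixin Record Lmodule_hasMul (K : pzRingType) A of GRing.Lmodule K A := {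
  pzone : A;
  pzmul : A -> A -> A;
  pzmulA : associative pzmul;
  pzmul1l : left_id pzone pzmul;
  pzmul1r : right_id pzone pzmul;
  pzmulDl : left_distributive pzmul +%R;
  pzmulDr : right_distributive pzmul +%R;
  pzscaleAl : forall (k : K) x y, k *: (pzmul x y) = pzmul (k *: x) y;
  pzscaleAr : forall (k : K) x y, k *: (pzmul x y) = pzmul x (k *: y)
}.
#[short(type="pzAlgType")]
HB.structure Definition PzAlgebra (K : pzRingType) :=
  {A of GRing.Lmodule K A & Lmodule_hasMul K A}.

HB.instance Definition _ (K : pzRingType) (A : pzAlgType K) :=
  GRing.Zmodule_isPzRing.Build (PzAlgebra.sort A) (@pzmulA K A) (@pzmul1l K A)
    (@pzmul1r K A) (@pzmulDl K A) (@pzmulDr K A).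

Section PzAlgebraTheory.
Variables (K : pzRingType) (A : pzAlgType K).
Lemma pzscalerAl (k : K) (x y : A) : k *: (x * y) = (k *: x) * y.
Proof. exact: pzscaleAl. Qed.
Lemma pzscalerAr (k : K) (x y : A) : k *: (x * y) = x * (k *: y).
Proof. exact: pzscaleAr. Qed.
End PzAlgebraTheory.

Section LinearProducts.
Variable K : fieldType.

Lemma lin_mull (U : lmodType K) (M : algType K) (c : M) (f : U -> M) :
  lin f -> lin (fun x => c * f x).
Proof. by move=> fl k x y; rewrite fl mulrDr scalerAr. Qed.

Lemma lin_mulr (U : lmodType K) (M : algType K) (c : M) (f : U -> M) :
  lin f -> lin (fun x => f x * c).
Proof. by move=> fl k x y; rewrite fl mulrDl scalerAl. Qed.

Lemma pzlin_mull (U : lmodType K) (M : pzAlgType K) (c : M) (f : U -> M) :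
  lin f -> lin (fun x => c * f x).
Proof. by move=> fl k x y; rewrite fl mulrDr pzscalerAr. Qed.

Lemma pzlin_mulr (U : lmodType K) (M : pzAlgType K) (c : M) (f : U -> M) :
  lin f -> lin (fun x => f x * c).
Proof. by move=> fl k x y; rewrite fl mulrDl pzscalerAl. Qed.

Lemma lin_sweedler (V : vectType K) (U W : lmodType K) t (F : U -> V -> V -> W) :
  (forall a b, lin (fun x => F x a b)) -> lin (fun x => sweedler t (F x)).
Proof.
move=> Fl k x y; rewrite /sweedler /tlift scaler_sumr -big_split.
by apply: eq_bigr => m _ /=; rewrite Fl scalerDr !scalerA mulrC.
Qed.

Lemma lin_sweedler_arg (V : vectType K) (U W : lmodType K) (t : U -> tpow V 2)
  (F : V -> V -> W) : lin t -> lin (fun x => sweedler (t x) F).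
Proof. by move=> tl k x y; rewrite /sweedler tl tlift_lin. Qed.

End LinearProducts.

(* Not [lazymatch]: the pattern [?c * @?f x] also matches a [c] that depends on
   [x], and [refine] has to reject it. *)
Ltac linear_step := match goal with
  | |- lin (fun x => x) => refine (@lin_id _ _)
  | |- lin (fun x => ?c * @?f x) =>
      first [refine (@lin_mull _ _ _ c f _) | refine (@pzlin_mull _ _ _ c f _)]
  | |- lin (fun x => @?f x * ?c) =>
      first [refine (@lin_mulr _ _ _ c f _) | refine (@pzlin_mulr _ _ _ c f _)]
  | |- lin (fun x => ?c *: @?f x) => refine (@lin_scale _ _ _ c f _)
  | |- lin (fun x => @?f x *: ?w) => refine (@lin_scalel _ _ _ w f _)
  | |- lin (fun x => sweedler ?t (@?F x)) =>
      refine (@lin_sweedler _ _ _ _ t F _); intro; intro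
  | |- lin (fun x => sweedler (@?t x) ?F) =>
      refine (@lin_sweedler_arg _ _ _ _ t F _)
  | Fl : forall b, lin (fun a => ?F a b) |- lin (fun x => ?F (@?f x) ?c) =>
      refine (@lin_comp _ _ _ _ (fun z => F z c) f (Fl c) _)
  | Fr : forall a, lin (?F a) |- lin (fun x => ?F ?c (@?f x)) =>
      refine (@lin_comp _ _ _ _ (F c) f (Fr c) _)
  | |- lin (fun x => ?L (@?f x)) =>
      first [assumption
            | refine (@lin_comp _ _ _ _ L f _ _); [first [assumption | exact: lin_linear]|]
            | exact: lin_linear]
  | |- lin ?f => first [assumption | exact: lin_linear]
  end.
Ltac intros_to_lin := lazymatch goal with
  | |- lin _ => idtac
  | |- forall _, _ => intro; intros_to_lin
  | |- _ => idtac
  end.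
Ltac linear_tac := intros_to_lin; cbv beta; repeat (linear_step; cbv beta).

Section Sweedler.
Variables (K : fieldType) (H : falgType K) (W : lmodType K).

Definition bilinear_fun (F : H -> H -> W) :=
  (forall b, lin (F^~ b)) /\ (forall a, lin (F a)).

Definition trilinear_fun (T : H -> H -> H -> W) :=
  [/\ forall b c, lin (fun a => T a b c), forall a c, lin (fun b => T a b c) &
      forall a b, lin (T a b)].

(** [tlift (eval3 T)] is the linear map that contracts with [T] the axioms stated as equalities of
    [tens3]. *)
Definition eval3 (T : H -> H -> H -> W) (x : 'I_3 -> H) : W :=
  T (x ord0) (x (lift ord0 ord0)) (x (lift ord0 (lift ord0 ord0))).

Lemma eq_sw (t : tpow H 2) (F G : H -> H -> W) :
  (forall a b, F a b = G a b) -> sweedler t F = sweedler t G.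
Proof. by move=> FG; apply: eq_tlift => x; rewrite FG. Qed.

Lemma sw_lin (W' : lmodType K) (L : W -> W') (t : tpow H 2) F : lin L ->
  L (sweedler t F) = sweedler t (fun a b => L (F a b)).
Proof. by move=> Ll; rewrite /sweedler lin_tlift. Qed.

Lemma sw_tens2 F a b : bilinear_fun F -> sweedler (tens2 a b) F = F a b.
Proof.
move=> [Fl Fr]; rewrite /sweedler /tens2.
have e (x : 'I_2 -> H) : x ord_max = x (lift ord0 ord0) by congr x; exact: val_inj.
rewrite tlift_tens //=; split=> [y k u v|u].
  by rewrite !e !(fcons0, fconsS) Fl.
by split=> // y k v w; rewrite !e !(fcons0, fconsS) Fr.
Qed.

Lemma tlift_tens3 T a b c : trilinear_fun T ->
  tlift (eval3 T) (tens3 a b c) = T a b c.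
Proof.
move=> [T1 T2 T3]; rewrite tlift_tens //=; split=> [y k u v|u].
  by rewrite /eval3 !(fcons0, fconsS) T1.
split=> [y k v w|v]; first by rewrite /eval3 !(fcons0, fconsS) T2.
by split=> // y k w z; rewrite /eval3 !(fcons0, fconsS) T3.
Qed.

Lemma sw_exch (s t : tpow H 2) (F : H -> H -> H -> H -> W) :
  \sw_(a, b <- s) \sw_(c, d <- t) F a b c d =
  \sw_(c, d <- t) \sw_(a, b <- s) F a b c d.
Proof.
rewrite /sweedler /tlift.
under eq_bigr do rewrite scaler_sumr.
rewrite exchange_big /=; apply: eq_bigr => m _; rewrite scaler_sumr.
by apply: eq_bigr => m' _; rewrite !scalerA mulrC.
Qed.

End Sweedler.

Section Sweedler2.
Variables (K : fieldType) (H : falgType K) (W : lmodType K).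

Lemma sw_flip (t : tpow H 2) (F : H -> H -> W) : bilinear_fun F ->
  sweedler (flip2 t) F = \sw_(a, b <- t) F b a.
Proof.
move=> Fb; rewrite /flip2 (sw_lin (L := fun t => sweedler t F)).
  by apply: eq_sw => a b; rewrite sw_tens2.
exact: tlift_lin.
Qed.

Lemma sw_tmul (s t : tpow H 2) (F : H -> H -> W) : bilinear_fun F ->
  sweedler (tmul s t) F = \sw_(a, b <- s) \sw_(c, d <- t) F (a * c) (b * d).
Proof.
move=> Fb; have l : lin (fun t : tpow H 2 => sweedler t F) by exact: tlift_lin.
rewrite /tmul (sw_lin (L := fun t => sweedler t F)) //.
apply: eq_sw => a b; rewrite (sw_lin (L := fun t => sweedler t F)) //.
by apply: eq_sw => c d; rewrite sw_tens2.
Qed.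

Lemma sw_scale (t : tpow H 2) k (F : H -> H -> W) :
  \sw_(a, b <- t) (k *: F a b) = k *: sweedler t F.
Proof. by rewrite (sw_lin (L := fun z => k *: z)) //; linear_tac. Qed.

End Sweedler2.

Section SweedlerMul.
Variables (K : fieldType) (H : falgType K).

Lemma sw_mull (M : pzAlgType K) (t : tpow H 2) (c : M) (F : H -> H -> M) :
  \sw_(a, b <- t) (c * F a b) = c * sweedler t F.
Proof. by rewrite (sw_lin (L := fun z : M => c * z)) //; linear_tac. Qed.

Lemma sw_mulr (M : pzAlgType K) (t : tpow H 2) (c : M) (F : H -> H -> M) :
  \sw_(a, b <- t) (F a b * c) = sweedler t F * c.
Proof. by rewrite (sw_lin (L := fun z : M => z * c)) //; linear_tac. Qed.

End SweedlerMul.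

(** * Contracted forms of the axioms; the antipode reverses products *)

Section Hopf.
Variables (K : fieldType) (H : falgType K) (X : ribbonHopf H).
Local Notation "'Delta'" := (cop X).
Local Notation "'R'" := (Rmat X).
Local Notation S := (anti X).
Local Notation eps := (cou X).

Section HopfSums.
Variable W : lmodType K.

Lemma tri_sw (G1 G2 : H -> H -> tpow H 2) (F1 F2 : H -> H -> H -> H -> tpow H 3)
  (s1 s2 : tpow H 2) (T : H -> H -> H -> W) :
  \sw_(a, b <- s1) \sw_(c, d <- G1 a b) F1 a b c d =
  \sw_(a, b <- s2) \sw_(c, d <- G2 a b) F2 a b c d ->
  \sw_(a, b <- s1) \sw_(c, d <- G1 a b) tlift (eval3 T) (F1 a b c d) =
  \sw_(a, b <- s2) \sw_(c, d <- G2 a b) tlift (eval3 T) (F2 a b c d).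
Proof.
move=> e; have l : lin (tlift (eval3 T)) by exact: tlift_lin.
have := congr1 (tlift (eval3 T)) e; rewrite !(sw_lin _ _ l).
under eq_sw => a b do rewrite (sw_lin _ _ l).
by under [X in _ = X -> _]eq_sw => a b do rewrite (sw_lin _ _ l).
Qed.

Lemma sw_coassoc x (T : H -> H -> H -> W) : trilinear_fun T ->
  \sw_(a, b <- Delta x) \sw_(c, d <- Delta a) T c d b =
  \sw_(a, b <- Delta x) \sw_(c, d <- Delta b) T a c d.
Proof.
move=> Tl; have := tri_sw T (cop_coassoc X x).
under eq_sw => a b do under eq_sw => c d do rewrite (tlift_tens3 _ _ _ Tl).
by under [X in _ = X -> _]eq_sw => a b do under eq_sw => c d do
  rewrite (tlift_tens3 _ _ _ Tl).
Qed.

Lemma sw_Rcopl (T : H -> H -> H -> W) : trilinear_fun T ->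
  \sw_(a, b <- R) \sw_(c, d <- Delta a) T c d b =
  \sw_(a, b <- R) \sw_(c, d <- R) T a c (b * d).
Proof.
move=> Tl; have := tri_sw T (Rmat_copl X).
under eq_sw => a b do under eq_sw => c d do rewrite (tlift_tens3 _ _ _ Tl).
by under [X in _ = X -> _]eq_sw => a b do under eq_sw => c d do
  rewrite (tlift_tens3 _ _ _ Tl).
Qed.

Lemma sw_Rcopr (T : H -> H -> H -> W) : trilinear_fun T ->
  \sw_(a, b <- R) \sw_(c, d <- Delta b) T a c d =
  \sw_(a, b <- R) \sw_(c, d <- R) T (a * c) d b.
Proof.
move=> Tl; have := tri_sw T (Rmat_copr X).
under eq_sw => a b do under eq_sw => c d do rewrite (tlift_tens3 _ _ _ Tl).
by under [X in _ = X -> _]eq_sw => a b do under eq_sw => c d do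
  rewrite (tlift_tens3 _ _ _ Tl).
Qed.

Lemma sw_counitl x (L : H -> W) : lin L ->
  \sw_(a, b <- Delta x) (eps a *: L b) = L x.
Proof.
move=> Ll; rewrite -{2}(cop_counitl X x) (sw_lin _ _ Ll).
by apply: eq_sw => a b; rewrite linZ.
Qed.

Lemma sw_counitr x (L : H -> W) : lin L ->
  \sw_(a, b <- Delta x) (eps b *: L a) = L x.
Proof.
move=> Ll; rewrite -{2}(cop_counitr X x) (sw_lin _ _ Ll).
by apply: eq_sw => a b; rewrite linZ.
Qed.

Lemma sw_antil x (L : H -> W) : lin L ->
  \sw_(a, b <- Delta x) L (S a * b) = eps x *: L 1.
Proof. by move=> Ll; rewrite -(sw_lin _ _ Ll) anti_l linZ. Qed.

Lemma sw_antir x (L : H -> W) : lin L ->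
  \sw_(a, b <- Delta x) L (a * S b) = eps x *: L 1.
Proof. by move=> Ll; rewrite -(sw_lin _ _ Ll) anti_r linZ. Qed.

Lemma sw_copM x y (F : H -> H -> W) : bilinear_fun F ->
  \sw_(a, b <- Delta (x * y)) F a b =
  \sw_(a, b <- Delta x) \sw_(c, d <- Delta y) F (a * c) (b * d).
Proof. by move=> Fb; rewrite cop_mul sw_tmul. Qed.

End HopfSums.

Lemma anti1 : S 1 = 1.
Proof.
have := anti_l X 1; rewrite cop_unit sw_tens2 ?mulr1 ?cou_unit ?scale1r //.
by split=> [b|a]; linear_tac.
Qed.

(** On H (x) H both S(xy) and S(y) S(x) are convolution inverse to the product. [P] is the triple
    convolution of S(xy), the product and S(y) S(x), and it collapses from either side. *)
Lemma antiM x y : S (x * y) = S y * S x.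
Proof.
pose P := \sw_(a, b <- Delta x) \sw_(c, d <- Delta y)
  \sw_(a1, a2 <- Delta a) \sw_(c1, c2 <- Delta c)
    (S (a1 * c1) * (a2 * c2) * (S d * S b)).
transitivity P; rewrite /P; last first.
  transitivity (\sw_(a, b <- Delta x) \sw_(c, d <- Delta y)
     (eps a *: (eps c *: (S d * S b)))).
    apply: eq_sw => a b; apply: eq_sw => c d.
    rewrite -(@sw_copM _ a c (fun p q => S p * q * (S d * S b))); last first.
      by split; linear_tac.
    by rewrite (@sw_antil _ _ (fun z => z * (S d * S b))) ?cou_mul -?scalerA
      ?mul1r //; linear_tac.
  transitivity (\sw_(a, b <- Delta x) (eps a *: (S y * S b))).
    apply: eq_sw => a b; rewrite sw_scale.
      by rewrite (@sw_counitl _ y (fun d => S d * S b)) //; linear_tac.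
  by rewrite (@sw_counitl _ x (fun b => S y * S b)) //; linear_tac.
(* Towards S(xy): coassociativity makes the last two legs of each coproduct adjacent, so that a1 (c1
   S(c2)) S(a2) collapses. *)
transitivity (\sw_(c, d <- Delta y) \sw_(a, b <- Delta x)
  \sw_(c1, c2 <- Delta c) \sw_(a1, a2 <- Delta a)
    (S (a1 * c1) * (a2 * c2) * (S d * S b))); last first.
  rewrite sw_exch; apply: eq_sw => a b; apply: eq_sw => c d; exact: sw_exch.
transitivity (\sw_(c, d <- Delta y) \sw_(c1, c2 <- Delta c)
   \sw_(a, b <- Delta x) \sw_(a1, a2 <- Delta b)
    (S (a * c1) * (a1 * c2) * (S d * S a2))); last first.
  apply: eq_sw => c d; rewrite [RHS]sw_exch; apply: eq_sw => c1 c2.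
  symmetry; apply: (@sw_coassoc _ x
    (fun a a1 a2 => S (a * c1) * (a1 * c2) * (S d * S a2))).
  by split; linear_tac.
rewrite (@sw_coassoc _ y (fun c1 c2 d => \sw_(a, b <- Delta x) \sw_(a1, a2 <- Delta b)
    (S (a * c1) * (a1 * c2) * (S d * S a2)))); last by split; linear_tac.
transitivity (\sw_(c, d <- Delta y) \sw_(a, b <- Delta x) (eps d *: (eps b *: S (a * c)))).
  rewrite -[LHS](@sw_counitr _ y (fun c => S (x * c))); last by linear_tac.
  apply: eq_sw => c d; rewrite sw_scale.
  by rewrite (@sw_counitr _ x (fun a => S (a * c))) //; linear_tac.
apply: eq_sw => c d; rewrite [RHS]sw_exch; apply: eq_sw => a b.
under [RHS]eq_sw => c1 c2.
  under eq_sw => a1 a2. 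
    rewrite (_ : _ * _ * _ = S (a * c) * (a1 * (c1 * S c2) * S a2)); last by rewrite !mulrA.
  over. over.
rewrite sw_exch.
under [RHS]eq_sw => a1 a2.
  rewrite (@sw_antir _ _ (fun z => S (a * c) * (a1 * z * S a2))); last by linear_tac.
  rewrite mulr1.
over.
rewrite sw_scale.
rewrite (@sw_antir _ _ (fun z => S (a * c) * z)); last by linear_tac.
by rewrite mulr1.
Qed.

End Hopf.

(** * The antipode and the R-matrix *)

Lemma linfunE (K : fieldType) (U V : vectType K) (f : U -> V) x :
  lin f -> linfun f x = f x.
Proof.
move=> fl; pose ff : {linear U -> V} :=
  HB.pack f (GRing.isLinear.Build K U V *:%R f fl).
exact: (lfunE ff x).
Qed.

Lemma lin_eval (K : fieldType) (U V : vectType K) (x : U) :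
  lin (fun f : 'Hom(U, V) => f x).
Proof. by move=> k f g; rewrite add_lfunE scale_lfunE. Qed.

Section Antipode.
Variables (K : fieldType) (H : falgType K) (X : ribbonHopf H).
Local Notation "'Delta'" := (cop X).
Local Notation "'R'" := (Rmat X).
Local Notation S := (anti X).
Local Notation eps := (cou X).
Local Notation "'v'" := (rib X).

Lemma sw_Rcop (W : lmodType K) x (F : H -> H -> W) : bilinear_fun F ->
  \sw_(a, b <- R) \sw_(c, d <- Delta x) F (a * c) (b * d) =
  \sw_(c, d <- Delta x) \sw_(a, b <- R) F (d * a) (c * b).
Proof.
move=> Fb; rewrite -sw_tmul // Rmat_cop sw_tmul // sw_flip //.
by case: Fb => Fl Fr; split; linear_tac.
Qed.

(** The counit on the first leg of (Delta (x) id)(R) = R13 R23 gives R = (1 (x) e) R, and R can be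
    cancelled. *)
Lemma counitRl : \sw_(a, b <- R) (eps a *: b) = 1.
Proof.
set e := LHS.
have eR (W : lmodType K) (F : H -> H -> W) : bilinear_fun F ->
    \sw_(a, b <- R) F a (e * b) = \sw_(a, b <- R) F a b.
  move=> [Fl Fr]; transitivity
    (\sw_(a, b <- R) \sw_(c, d <- R) (eps a *: F c (b * d))).
    rewrite sw_exch; apply: eq_sw => c d.
    rewrite /e (sw_lin (L := fun z => F c (z * d))); last first.
      by linear_tac.
    apply: eq_sw => a b; rewrite -scalerAl; exact: linZ.
  rewrite -(@sw_Rcopl _ _ X _ (fun a c b => eps a *: F c b)); last first.
    by split; linear_tac.
  apply: eq_sw => a b; rewrite (@sw_counitl _ _ X _ a (fun z => F z b)) //.
have := eR _ (fun a b => \sw_(c, d <- Rinv X) (eps (a * c) *: (b * d))).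
rewrite -(@sw_tmul _ _ _ R (Rinv X) (fun a b => eps a *: b)); last by split; linear_tac.
rewrite RmatV sw_tens2; last by split; linear_tac.
rewrite cou_unit scale1r => <-; last by split; linear_tac.
under eq_sw => a b do under eq_sw => c d do rewrite -mulrA.
rewrite -(@sw_tmul _ _ _ R (Rinv X) (fun a b => eps a *: (e * b))); last by split; linear_tac.
by rewrite RmatV sw_tens2 ?cou_unit ?scale1r ?mulr1 //; split; linear_tac.
Qed.

(** The same argument with (id (x) Delta)(R) = R13 R12; R is now cancelled from the left. *)
Lemma counitRr : \sw_(a, b <- R) (eps b *: a) = 1.
Proof.
set e := LHS.
have eR (W : lmodType K) (F : H -> H -> W) : bilinear_fun F ->
    \sw_(a, b <- R) F (a * e) b = \sw_(a, b <- R) F a b.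
  move=> [Fl Fr]; transitivity
    (\sw_(a, b <- R) \sw_(c, d <- R) (eps d *: F (a * c) b)).
    apply: eq_sw => a b.
    rewrite /e (sw_lin (L := fun z => F (a * z) b)); last first.
      by linear_tac.
    apply: eq_sw => c d; rewrite -scalerAr; exact: (linZ (Fl b)).
  rewrite -(@sw_Rcopr _ _ X _ (fun a d b => eps d *: F a b)); last first.
    by split; linear_tac.
  by apply: eq_sw => a b; rewrite (@sw_counitl _ _ X _ b (F a)).
have /eR : bilinear_fun (fun a b => \sw_(c, d <- Rinv X) (eps (d * b) *: (c * a))).
  by split; linear_tac.
rewrite [RHS]sw_exch.
rewrite -(@sw_tmul _ _ _ (Rinv X) R (fun a b => eps b *: a)); last by split; linear_tac.
rewrite VRmat sw_tens2 ?cou_unit ?scale1r; last by split; linear_tac.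
move=> <-; rewrite sw_exch; under eq_sw => a b do under eq_sw => c d do rewrite mulrA.
rewrite -(@sw_tmul _ _ _ (Rinv X) R (fun a b => eps b *: (a * e))); last by split; linear_tac.
by rewrite VRmat sw_tens2 ?cou_unit ?scale1r ?mul1r //; split; linear_tac.
Qed.

Let u := \sw_(a, b <- R) (S b * a).

(** [P] is S^2(x''') S(b x'') a x' with a (x) b = R. Collapsing S(x'' S(x''')) leaves u x. Moving R
    through the coproduct of the first two legs makes S(x') x'' collapse instead and leaves S^2(x)
    u. *)
Lemma anti2_drinfeld_element x : S (S x) * u = u * x.
Proof.
pose P := \sw_(p, q <- Delta x) \sw_(c, d <- Delta p) \sw_(a, b <- R)
  (S (S q) * S (b * d) * (a * c)).
transitivity P; last first; rewrite /P.
  rewrite (@sw_coassoc _ _ X _ x (fun c d q => \sw_(a, b <- R)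
    (S (S q) * S (b * d) * (a * c)))); last by split; linear_tac.
  transitivity (\sw_(c, r <- Delta x) (eps r *: (u * c))); last first.
    by rewrite (@sw_counitr _ _ X _ x (fun c => u * c)) //; linear_tac.
  apply: eq_sw => c r; rewrite sw_exch.
  rewrite /u (sw_lin (L := fun z => eps r *: (z * c))); last by linear_tac.
  apply: eq_sw => a b.
  under eq_sw => d q.
    rewrite antiM (_ : _ * _ * _ = S (d * S q) * (S b * a * c)); last first.
      by rewrite antiM !mulrA.
    over.
  rewrite (@sw_antir _ _ X _ r (fun z => S z * (S b * a * c))); last by linear_tac.
  by rewrite anti1 mul1r.
transitivity (\sw_(p, q <- Delta x) (eps p *: (S (S q) * u))).
  by rewrite (@sw_counitl _ _ X _ x (fun q => S (S q) * u)) //; linear_tac.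
apply: eq_sw => p q.
under [RHS]eq_sw => c d do under eq_sw => a b do rewrite -mulrA.
rewrite [RHS]sw_exch.
rewrite (@sw_Rcop _ p (fun a b => S (S q) * (S b * a))); last by split; linear_tac.
rewrite sw_exch /u (sw_lin (L := fun z => eps p *: (S (S q) * z))); last by linear_tac.
apply: eq_sw => a b.
under [RHS]eq_sw => c d.
  rewrite antiM (_ : _ * _ = S (S q) * S b * (S c * d) * a); last first.
    by rewrite !mulrA.
  over.
rewrite (@sw_antil _ _ X _ p (fun z => S (S q) * S b * z * a)); last by linear_tac.
by rewrite mulr1 !mulrA.
Qed.

(* S^2(x) u = u x, where u is a unit because u S(u) = v^2. *)
Lemma anti_inj : injective S.
Proof.
have e : u * S u = v ^+ 2 by rewrite rib_sqr.
have v2 y : v ^+ 2 * y = y * v ^+ 2.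
  by rewrite expr2 -mulrA rib_central -mulrA rib_central -mulrA.
have vU : v ^+ 2 \is a GRing.unit by rewrite unitrX // rib_unit.
(* The previous lemma at x = S(u). Cancelling the central unit v^2 then gives S^3(u) = S(u), so S(u)
   u = v^2 and u can be cancelled on the left. *)
have e3 : S (S (S u)) * u = v ^+ 2 by rewrite anti2_drinfeld_element.
have e2 : S (S (S u)) = S u.
  have : S (S (S u)) * (u * S u) = v ^+ 2 * S u by rewrite mulrA e3.
  by rewrite e v2 => /(mulIr vU).
have Su : S u * u = v ^+ 2 by rewrite -e2.
move=> x y /(congr1 S) /(congr1 (fun z => z * u)); rewrite !anti2_drinfeld_element.
move=> /(congr1 (fun z => S u * z)); rewrite !mulrA Su; exact: mulrI.
Qed.

Let kerS : lker S == 0%VS. Proof. exact/lker0P/anti_inj. Qed.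

Lemma antiK : cancel S (antiV X).
Proof. exact: lker0_lfunK. Qed.

Lemma antiVK : cancel (antiV X) S.
Proof. exact: lker0_lfunVK. Qed.

Local Notation Si := (antiV X).

Lemma antiV1 : Si 1 = 1.
Proof. by rewrite -{1}(anti1 X) antiK. Qed.

Lemma antiVM x y : Si (x * y) = Si y * Si x.
Proof. by apply: anti_inj; rewrite antiM !antiVK. Qed.

Lemma antiV_rib : Si v = v.
Proof. by rewrite -{1}(rib_anti X) antiK. Qed.

Section Sums.
Variable W : lmodType K.

Lemma sw_antiVl x (L : H -> W) : lin L ->
  \sw_(a, b <- Delta x) L (Si b * a) = eps x *: L 1.
Proof.
move=> Ll; have := @sw_antil _ _ X _ x (fun z => L (Si z)).
rewrite antiV1 => <-; last by linear_tac.
by apply: eq_sw => a b; rewrite antiVM antiK.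
Qed.

Lemma sw_antiVr x (L : H -> W) : lin L ->
  \sw_(a, b <- Delta x) L (b * Si a) = eps x *: L 1.
Proof.
move=> Ll; have := @sw_antir _ _ X _ x (fun z => L (Si z)).
rewrite antiV1 => <-; last by linear_tac.
by apply: eq_sw => a b; rewrite antiVM antiK.
Qed.

(* That is, Delta(S^-1(h)) = S^-1(h'') (x) S^-1(h'), contracted with h''. *)
Lemma sw_cop_antiV h (F : H -> H -> W) : bilinear_fun F ->
  \sw_(a, b <- Delta h) \sw_(c, d <- Delta (Si a)) F (b * c) d = F 1 (Si h).
Proof.
move=> [Fl Fr].
(* [P] collapses in two ways: b1 c (x) b2 d is the coproduct of b S^-1(a), and S^-1(q) b2 becomes a
   counit after reassociation. *)
pose P := \sw_(p, q <- Delta h) \sw_(a, b <- Delta p) \sw_(b1, b2 <- Delta b)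
  \sw_(c, d <- Delta (Si a)) F (b1 * c) (Si q * (b2 * d)).
transitivity P; rewrite /P; last first.
  rewrite -(@sw_counitl _ _ X _ h (fun q => F 1 (Si q))); last by linear_tac.
  apply: eq_sw => p q.
  transitivity (\sw_(a, b <- Delta p) \sw_(y, z <- Delta (b * Si a)) F y (Si q * z)).
    apply: eq_sw => a b.
    by rewrite (@sw_copM _ _ X _ b (Si a) (fun y z => F y (Si q * z))) //; split; linear_tac.
  rewrite (@sw_antiVr p (fun w => \sw_(y, z <- Delta w) F y (Si q * z))); last by linear_tac.
  rewrite cop_unit sw_tens2 ?mulr1 //; by split; linear_tac.
rewrite (@sw_coassoc _ _ X _ h (fun a b q => \sw_(b1, b2 <- Delta b)
  \sw_(c, d <- Delta (Si a)) F (b1 * c) (Si q * (b2 * d)))); last by split; linear_tac.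
apply: eq_sw => a r.
rewrite (@sw_coassoc _ _ X _ r (fun b1 b2 q =>
  \sw_(c, d <- Delta (Si a)) F (b1 * c) (Si q * (b2 * d)))); last by split; linear_tac.
rewrite -(@sw_counitr _ _ X _ r (fun b => \sw_(c, d <- Delta (Si a)) F (b * c) d)); last by linear_tac.
apply: eq_sw => b s; rewrite [RHS]sw_exch.
transitivity (\sw_(c, d <- Delta (Si a)) (eps s *: F (b * c) d)).
  by rewrite sw_scale.
apply: eq_sw => c d.
under [RHS]eq_sw => b2 q do rewrite mulrA.
by rewrite (@sw_antiVl s (fun z => F (b * c) (z * d))) ?mul1r //; linear_tac.
Qed.

End Sums.

(** * Invariant forms *)

Local Notation dual := 'Hom(H, K^o).

Lemma shiftE (phi : dual) x y h : shift phi x y h = phi (x * h * y).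
Proof. by rewrite /shift linfunE //; linear_tac. Qed.

Lemma shift_lin x y : lin (fun phi : dual => shift phi x y).
Proof.
by move=> k f g; apply/lfunP => h; rewrite add_lfunE scale_lfunE !shiftE add_lfunE scale_lfunE.
Qed.

Lemma shift_linl (phi : dual) y : lin (fun x => shift phi x y).
Proof.
move=> k f g; apply/lfunP => h; rewrite add_lfunE scale_lfunE !shiftE.
by rewrite !mulrDl linearD -!scalerAl linearZ.
Qed.

Lemma shift_linr (phi : dual) x : lin (fun y => shift phi x y).
Proof.
move=> k f g; apply/lfunP => h; rewrite add_lfunE scale_lfunE !shiftE.
by rewrite !mulrDr linearD -!scalerAr linearZ.
Qed.

Local Notation D := (drinfeld X).

Lemma drinfeld_lin : lin D.
Proof.
rewrite /drinfeld; apply: lin_sweedler => a b.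
by refine (@lin_scalel _ _ _ b (fun phi : dual => phi a) _); exact: lin_eval.
Qed.

Lemma sw_Q (W : lmodType K) (F : H -> H -> W) : bilinear_fun F ->
  \sw_(a, b <- tmul R (flip2 R)) F a b =
  \sw_(a, b <- R) \sw_(c, d <- R) F (a * d) (b * c).
Proof.
move=> Fb; have [Fl Fr] := Fb; rewrite sw_tmul //; apply: eq_sw => a b.
by rewrite sw_flip //; split; linear_tac.
Qed.

(** R R' commutes with the opposite coproduct: moving past R' turns it into Delta, and moving past R
    turns it back. *)
Lemma sw_Qcop (W : lmodType K) h (F : H -> H -> W) : bilinear_fun F ->
  \sw_(a, b <- tmul R (flip2 R)) \sw_(c, d <- Delta h) F (a * d) (b * c) =
  \sw_(c, d <- Delta h) \sw_(a, b <- tmul R (flip2 R)) F (d * a) (c * b).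
Proof.
move=> [Fl Fr]; rewrite sw_Q; last by split; linear_tac.
transitivity (\sw_(a, b <- R) \sw_(p, q <- Delta h) \sw_(c, d <- R)
    F (a * (p * d)) (b * (q * c))).
  apply: eq_sw => a b.
  have := @sw_Rcop _ h (fun y x => F (a * x) (b * y)).
  move=> <-; last by split; linear_tac.
  by apply: eq_sw => c d; apply: eq_sw => p q; rewrite !mulrA.
have := @sw_Rcop _ h (fun x y => \sw_(c, d <- R) F (x * d) (y * c)).
under eq_sw => a b do under eq_sw => p q do under eq_sw => c d do rewrite -!mulrA.
move=> ->; last by split; linear_tac.
apply: eq_sw => p q; rewrite sw_Q; last by split; linear_tac.
by apply: eq_sw => a b; apply: eq_sw => c d; rewrite !mulrA.
Qed.

Definition coad (phi : dual) (h : H) : dual :=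
  \sw_(c, d <- Delta h) shift phi (Si d) c.

(** Since R R' commutes with the opposite coproduct, the factors c and S^-1(d) introduced by [coad]
    become adjacent and collapse; this gives [A], that D(coad phi x'') x' = x z. Convolving with
    S^-1 isolates D(coad phi h), and the central z comes out. *)
Lemma drinfeld_coad (phi : dual) z h : (forall x, z * x = x * z) ->
  D phi = z -> D (coad phi h) = eps h *: z.
Proof.
move=> zC Dz.
have DE psi : D psi = \sw_(a, b <- tmul R (flip2 R)) (psi a *: b) by [].
have Dc r : D (coad phi r) = \sw_(c, d <- Delta r)
    \sw_(a, b <- tmul R (flip2 R)) (phi (Si d * (a * c)) *: b).
  rewrite /coad (sw_lin _ _ drinfeld_lin); apply: eq_sw => c d.
  by apply: eq_sw => a b; rewrite shiftE mulrA.
have linD : lin (fun r => D (coad phi r)).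
  rewrite (_ : (fun r => _) = (fun r => \sw_(c, d <- Delta r)
    \sw_(a, b <- tmul R (flip2 R)) (phi (Si d * (a * c)) *: b))); last first.
    by apply/funext => r; rewrite Dc.
  by linear_tac.
have A x : \sw_(p, r <- Delta x) (D (coad phi r) * p) = x * z.
  pose G p c d : H := \sw_(a, b <- tmul R (flip2 R)) (phi (Si d * (a * c)) *: (b * p)).
  transitivity (\sw_(p, r <- Delta x) \sw_(c, d <- Delta r) G p c d).
    apply: eq_sw => p r; rewrite Dc (sw_lin (L := fun y : H => y * p)); last by linear_tac.
    apply: eq_sw => c d; rewrite (sw_lin (L := fun y : H => y * p)); last by linear_tac.
    by apply: eq_sw => a b; rewrite scalerAl.
  rewrite -(@sw_coassoc _ _ X _ x G); last by rewrite /G; split; linear_tac.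
  transitivity (\sw_(s, d <- Delta x) \sw_(p, c <- Delta s)
      \sw_(a, b <- tmul R (flip2 R)) (phi (Si d * (c * a)) *: (p * b))).
    apply: eq_sw => s d; rewrite /G sw_exch.
    by rewrite (@sw_Qcop _ s (fun y w => phi (Si d * y) *: w)) //; split; linear_tac.
  rewrite (@sw_coassoc _ _ X _ x (fun p c d => 
      \sw_(a, b <- tmul R (flip2 R)) (phi (Si d * (c * a)) *: (p * b)))); last first.
    by split; linear_tac.
  rewrite -(@sw_counitr _ _ X _ x (fun p => p * z)); last by linear_tac.
  apply: eq_sw => p r; rewrite sw_exch -Dz DE.
  rewrite (sw_lin (L := fun y : H => eps r *: (p * y))); last by linear_tac.
  apply: eq_sw => a b; under eq_sw => c d do rewrite mulrA.
  rewrite (@sw_antiVl _ r (fun y => phi (y * a) *: (p * b))); last by linear_tac.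
  by rewrite mul1r scalerAr.
transitivity (\sw_(a, s <- Delta h) (s * z * Si a)); last first.
  transitivity (\sw_(a, s <- Delta h) (z * (s * Si a))).
    by apply: eq_sw => a s; rewrite mulrA zC.
  by rewrite (@sw_antiVr _ h (fun y => z * y)) ?mulr1 //; linear_tac.
transitivity (\sw_(a, s <- Delta h) \sw_(p, r <- Delta s) (D (coad phi r) * p * Si a)); last first.
  apply: eq_sw => a s; rewrite -A (sw_lin (L := fun y : H => y * Si a)) //; by linear_tac.
rewrite -(@sw_coassoc _ _ X _ h (fun a p r => D (coad phi r) * p * Si a)); last by split; linear_tac.
rewrite -[LHS](@sw_counitl _ _ X _ h (fun r => D (coad phi r))) //.
apply: eq_sw => t r; under [RHS]eq_sw => a p do rewrite -mulrA.
by rewrite (@sw_antiVr _ t (fun y => D (coad phi r) * y)) ?mulr1 //; linear_tac.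
Qed.

Hypothesis Xfact : factorizable X.

Lemma drinfeld_inj : injective D.
Proof. exact: bij_inj. Qed.

Lemma drinfeld_form_of x : D (form_of X x) = x.
Proof.
have DE y : linfun D y = D y by rewrite linfunE //; exact: drinfeld_lin.
rewrite /form_of -DE limg_lfunVK //; have [D' _ D'K] := Xfact.
by apply/memv_imgP; exists (D' x); rewrite ?memvf // DE D'K.
Qed.

(** Both sides have image eps(h) x under the Drinfeld map, which is injective. *)
Lemma coad_form_of x h : (forall y, x * y = y * x) ->
  coad (form_of X x) h = eps h *: form_of X x.
Proof.
move=> xC; apply: drinfeld_inj.
by rewrite (drinfeld_coad _ xC) ?(linZ drinfeld_lin) drinfeld_form_of.
Qed.

End Antipode.

(** * R-matrices under commuting algebra maps *)

Section RingIdentities.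
Variable M : pzRingType.
Implicit Types c L LV N NV A B P : M.

Lemma conj_mul3 L LV A B A' : LV * L = 1 ->
  L * A * LV * (L * B * LV) * (L * A' * LV) = L * (A * B * A') * LV.
Proof. by move=> LVL; rewrite !mulrA -!(mulrA _ LV L) LVL !mulr1. Qed.

(** The pattern of D_i: [L] is Lambda_{i-1}, [L * N] is Lambda_i, [A1] comes from A(i-1), and [c] is
    v^2 in leg 0. *)
Lemma conj_step c L LV N NV A1 A B A' : LV * L = 1 -> NV * LV * (L * N) = 1 ->
  c * L = L * c -> c * A1 = A1 * c -> c * N = N * c ->
  c * (L * A1 * LV) * (L * N * A * (NV * LV)) * (L * N * B * (NV * LV)) *
    (L * N * A' * (NV * LV)) =
  L * (A1 * N * (c * A * B * A') * NV) * LV.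
Proof.
move=> LVL LVL1 cL cA cN.
rewrite -(mulrA (c * _)) -mulrA conj_mul3 //.
rewrite (_ : _ * _ = c * L * A1 * (LV * L) * N * (A * B * A') * (NV * LV)); last by rewrite !mulrA.
by rewrite LVL mulr1 cL -(mulrA L c) cA !mulrA -(mulrA _ c N) cN !mulrA.
Qed.

(** The pattern of C(k), whose four matrices are conjugated by the same [L]. *)
Lemma conj_commutator c L LV A B A' A1 : LV * L = 1 -> c * L = L * c ->
  c * (L * A * LV) * (L * B * LV) * (L * A' * LV) * (L * A1 * LV) =
  L * (c * A * B * A' * A1) * LV.
Proof.
move=> LVL cL; rewrite -(mulrA c) -(mulrA c) conj_mul3 //.
by rewrite !mulrA -(mulrA _ LV L) LVL mulr1 cL.
Qed.

Lemma telescope_last c P L LV A B A' : LV * L = 1 -> c * P = P * c ->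
  c * (P * LV) * (L * A * LV) * (L * B * LV) * (L * A' * LV) =
  P * (c * A * B * A') * LV.
Proof.
move=> LVL cP; rewrite -(mulrA (c * _)) -mulrA conj_mul3 //.
by rewrite !mulrA -(mulrA _ LV L) LVL mulr1 cP.
Qed.

Lemma mul_regroup A B P L : L * (A * B) * P = L * A * (B * P).
Proof. by rewrite !mulrA. Qed.

Lemma mul_regroup5 P LV A A' B B' c :
  P * (A * B) * c * (B' * A' * LV) = P * (A * (B * c * B') * A') * LV.
Proof. by rewrite !mulrA. Qed.

Lemma commute_conj P LV A A' B : A * P = P * A -> A' * LV = LV * A' ->
  P * (A * B * A') * LV = A * (P * B * LV) * A'.
Proof. by move=> AP ALV; rewrite !mulrA AP -!mulrA ALV. Qed.

Lemma conj_mul L LV A B : LV * L = 1 -> L * LV = 1 -> A * B = 1 ->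
  L * A * LV * (L * B * LV) = 1.
Proof.
by move=> LVL LLV AB; rewrite !mulrA -(mulrA _ LV L) LVL mulr1 -(mulrA L A B) AB mulr1.
Qed.

Lemma telescope_step L LV A B P : LV * L = 1 -> P * LV * (L * A * B) = P * A * B.
Proof. by move=> LVL; rewrite !mulrA -(mulrA _ LV L) LVL mulr1. Qed.

Lemma mul_inv3 (a a' b b' d d' : M) :
  a * a' = 1 -> b * b' = 1 -> d * d' = 1 -> a * b * d * (d' * b' * a') = 1.
Proof.
by move=> aa bb dd; rewrite !mulrA -(mulrA _ d d') dd mulr1 -(mulrA a b b') bb mulr1.
Qed.

End RingIdentities.

Section AlgebraMaps.
Variables (K : fieldType) (H : falgType K) (X : ribbonHopf H) (M : pzAlgType K).
Local Notation "'Delta'" := (cop X).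
Local Notation "'R'" := (Rmat X).
Local Notation "'v'" := (rib X).
Implicit Types f g h : H -> M.

(** A predicate rather than a bundled morphism, because a convolution of algebra maps is
    multiplicative only under a commutation hypothesis. *)
Record algmap f : Prop := AlgMap {
  am_lin : lin f; am_one : f 1 = 1; am_mul : forall x y, f (x * y) = f x * f y }.

Definition commuting f g := forall x y, f x * g y = g y * f x.

Lemma commutingC f g : commuting f g -> commuting g f.
Proof. by move=> fg x y; rewrite fg. Qed.

(** If f and g embed H in the legs k and l, this is the element usually written t_{kl}; [conv] is
    then the coproduct placed in these legs. *)
Definition tm f g (t : tpow H 2) : M := \sw_(a, b <- t) (f a * g b).
Definition conv f g (x : H) : M := tm f g (Delta x).

Lemma bilin_mul f g : lin f -> lin g -> bilinear_fun (fun a b => f a * g b).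
Proof. by move=> fl gl; split; linear_tac. Qed.

Lemma conv_lin f g : lin (conv f g).
Proof. by rewrite /conv /tm; linear_tac. Qed.

Lemma tm_tens2 f g a b : lin f -> lin g -> tm f g (tens2 a b) = f a * g b.
Proof. by move=> fl gl; rewrite /tm sw_tens2 //; apply: bilin_mul. Qed.

Lemma tm_flip f g t : lin f -> lin g -> commuting f g ->
  tm f g (flip2 t) = tm g f t.
Proof.
move=> fl gl fg; rewrite /tm sw_flip; last exact: bilin_mul.
by apply: eq_sw => a b; rewrite fg.
Qed.

Lemma commute_tm f g t m : (forall x, f x * m = m * f x) ->
  (forall x, g x * m = m * g x) -> tm f g t * m = m * tm f g t.
Proof.
move=> fm gm; rewrite /tm -sw_mull -sw_mulr; apply: eq_sw => a b.
by rewrite -mulrA gm !mulrA fm.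
Qed.

Lemma tm_commute f g f' g' s s' :
  commuting f f' -> commuting f g' -> commuting g f' -> commuting g g' ->
  tm f g s * tm f' g' s' = tm f' g' s' * tm f g s.
Proof.
move=> ff fg gf gg; apply: commute_tm => x; symmetry.
  by apply: commute_tm => y; rewrite (ff, fg).
by apply: commute_tm => y; rewrite (gf, gg).
Qed.

Lemma tm_mul f g s t : algmap f -> algmap g -> commuting f g ->
  tm f g (tmul s t) = tm f g s * tm f g t.
Proof.
move=> [fl _ fM] [gl _ gM] fg; rewrite /tm sw_tmul; last exact: bilin_mul.
rewrite -sw_mulr; apply: eq_sw => a b; rewrite -sw_mull; apply: eq_sw => c d.
by rewrite fM gM !mulrA -[f a * f c * _]mulrA fg mulrA.
Qed.

Lemma tm_one f g : algmap f -> algmap g -> tm f g (tens2 1 1) = 1.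
Proof. by move=> [fl f1 _] [gl g1 _]; rewrite tm_tens2 // f1 g1 mulr1. Qed.

Lemma conv_algmap f g : algmap f -> algmap g -> commuting f g ->
  algmap (conv f g).
Proof.
move=> fA gA fg; split; first exact: conv_lin.
  by rewrite /conv cop_unit tm_one.
by move=> x y; rewrite /conv cop_mul tm_mul.
Qed.

Lemma conv_commuting f g h : commuting f h -> commuting g h ->
  commuting (conv f g) h.
Proof. by move=> fh gh x y; apply: commute_tm => z; [exact: fh | exact: gh]. Qed.

Lemma convA f g h x : lin f -> lin g -> lin h ->
  conv (conv f g) h x = conv f (conv g h) x.
Proof.
move=> fl gl hl.
transitivity (\sw_(a, b <- Delta x) \sw_(c, d <- Delta a) (f c * g d * h b)).
  by apply: eq_sw => a b; rewrite sw_mulr.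
rewrite (@sw_coassoc _ _ X _ x (fun c d b => f c * g d * h b)); last first.
  by split; linear_tac.
apply: eq_sw => a b; rewrite -sw_mull; apply: eq_sw => c d.
by rewrite mulrA.
Qed.

Lemma tm_central g h x s : (forall y, x * y = y * x) ->
  algmap g -> algmap h -> commuting g h ->
  tm g h s * g x = g x * tm g h s /\ tm g h s * h x = h x * tm g h s.
Proof.
move=> xC gA hA gh; split; apply: commute_tm => y.
- by rewrite -!am_mul // xC.
- by rewrite gh.
- by rewrite gh.
- by rewrite -!am_mul // xC.
Qed.

Definition Rm f g : M := tm f g R.
Definition Ri f g : M := tm f g (Rinv X).

Section Pairs.
Variables f g : H -> M.
Hypotheses (fA : algmap f) (gA : algmap g) (fg : commuting f g).

Lemma RmK : Rm f g * Ri f g = 1.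
Proof. by rewrite /Rm /Ri -tm_mul // RmatV tm_one. Qed.

Lemma RiK : Ri f g * Rm f g = 1.
Proof. by rewrite /Rm /Ri -tm_mul // VRmat tm_one. Qed.

Lemma Ri_uniqr m : m * Rm f g = 1 -> m = Ri f g.
Proof. by move=> e; rewrite -[m]mulr1 -RmK mulrA e mul1r. Qed.

Lemma Rm_conv x : Rm f g * conv f g x = conv g f x * Rm f g.
Proof.
rewrite /Rm /conv -tm_mul // Rmat_cop tm_mul // tm_flip //; first exact: am_lin.
exact: am_lin.
Qed.

Lemma conv_rib : conv f g v = Ri f g * Ri g f * (f v * g v).
Proof.
have [fl _ _] := fA; have [gl _ _] := gA.
by rewrite /conv rib_cop !tm_mul // tm_flip // tm_tens2.
Qed.

(** Multiplied by R on the right, the sum becomes a contraction of R13 R12 = (id (x) Delta)(R), in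
    which S^-1(b'') b' collapses. It identifies [Lminus] and [Lminust] as inverse R-matrices. *)
Lemma sw_antiV_Ri : \sw_(a, b <- R) (g (antiV X b) * f a) = Ri f g.
Proof.
apply: Ri_uniqr; have [fl f1 fM] := fA; have [gl g1 gM] := gA.
rewrite /Rm /tm -sw_mulr.
transitivity (\sw_(a, b <- R) \sw_(c, d <- R) (f (a * c) * g (antiV X b * d))).
  apply: eq_sw => a b; rewrite -sw_mull; apply: eq_sw => c d.
  by rewrite fM gM -(fg a) !mulrA -[f a * f c * _]mulrA (fg c) mulrA.
rewrite -(@sw_Rcopr _ _ X _ (fun x y z => f x * g (antiV X z * y))); last first.
  by split; linear_tac.
transitivity (\sw_(a, b <- R) (cou X b *: f a)).
  apply: eq_sw => a b; rewrite (@sw_antiVl _ _ X _ b (fun z => f a * g z)).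
    by rewrite g1 mulr1.
  by linear_tac.
rewrite -f1 -(counitRr X) (sw_lin _ _ fl).
by apply: eq_sw => a b; rewrite (linZ fl).
Qed.

(** The mirror argument, with (Delta (x) id)(R) and S(a') a''. This is the form of the inverse that
    produces the explicit formulas. *)
Lemma sw_anti_Ri : \sw_(a, b <- R) (f (anti X a) * g b) = Ri f g.
Proof.
apply: Ri_uniqr; have [fl f1 fM] := fA; have [gl g1 gM] := gA.
rewrite /Rm /tm -sw_mulr.
transitivity (\sw_(a, b <- R) \sw_(c, d <- R) (f (anti X a * c) * g (b * d))).
  apply: eq_sw => a b; rewrite -sw_mull; apply: eq_sw => c d.
  by rewrite fM gM !mulrA -[f _ * f c * _]mulrA (fg c) mulrA.
rewrite -(@sw_Rcopl _ _ X _ (fun x y z => f (anti X x * y) * g z)); last first.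
  by split; linear_tac.
transitivity (\sw_(a, b <- R) (cou X a *: g b)).
  apply: eq_sw => a b; rewrite (@sw_antil _ _ X _ a (fun z => f z * g b)).
    by rewrite f1 mul1r.
  by linear_tac.
rewrite -g1 -(counitRl X) (sw_lin _ _ gl).
by apply: eq_sw => a b; rewrite (linZ gl).
Qed.

End Pairs.

Section Triples.
Variables f g h : H -> M.
Hypotheses (fA : algmap f) (gA : algmap g) (hA : algmap h).
Hypotheses (fg : commuting f g) (fh : commuting f h) (gh : commuting g h).

Lemma Rm_convl : Rm (conv f g) h = Rm f h * Rm g h.
Proof.
have [fl f1 fM] := fA; have [gl g1 gM] := gA; have [hl h1 hM] := hA.
transitivity (\sw_(a, b <- R) \sw_(c, d <- Delta a) (f c * g d * h b)).
  by apply: eq_sw => a b; rewrite sw_mulr.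
rewrite (@sw_Rcopl _ _ X _ (fun c d b => f c * g d * h b)); last by split; linear_tac.
rewrite /Rm /tm -sw_mulr; apply: eq_sw => a b.
rewrite -sw_mull; apply: eq_sw => c d.
by rewrite hM !mulrA -[f a * g c * _]mulrA gh mulrA.
Qed.

Lemma Rm_convr : Rm f (conv g h) = Rm f h * Rm f g.
Proof.
have [fl f1 fM] := fA; have [gl g1 gM] := gA; have [hl h1 hM] := hA.
transitivity (\sw_(a, b <- R) \sw_(c, d <- Delta b) (f a * (g c * h d))).
  by apply: eq_sw => a b; rewrite sw_mull.
rewrite (@sw_Rcopr _ _ X _ (fun a c d => f a * (g c * h d))); last by split; linear_tac.
rewrite /Rm /tm -sw_mulr; apply: eq_sw => a b.
rewrite -sw_mull; apply: eq_sw => c d.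
by rewrite fM gh !mulrA -[f a * f c * _]mulrA fh mulrA.
Qed.

(** On either side the two R-matrices with second leg h merge into one, whose first leg carries the
    coproduct or its opposite; the R-matrix of f and g exchanges the two. *)
Lemma yang_baxter : Rm f g * Rm f h * Rm g h = Rm g h * Rm f h * Rm f g.
Proof.
have [fl f1 fM] := fA; have [gl g1 gM] := gA; have [hl h1 hM] := hA.
have h_fg b : h b * Rm f g = Rm f g * h b.
  by symmetry; apply: commute_tm => x; [exact: fh | exact: gh].
have e : Rm g h * Rm f h = Rm (conv g f) h.
  rewrite /Rm /tm -sw_mulr; transitivity (\sw_(a, b <- R) \sw_(c, d <- Delta a) (g c * f d * h b)).
    rewrite (@sw_Rcopl _ _ X _ (fun c d b => g c * f d * h b)); last by split; linear_tac.
    apply: eq_sw => a b; rewrite -sw_mull; apply: eq_sw => c d.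
    by rewrite hM !mulrA -[g a * f c * _]mulrA fh mulrA.
  by apply: eq_sw => a b; rewrite sw_mulr.
rewrite e -mulrA -Rm_convl {2 3}/Rm /tm -sw_mull -sw_mulr; apply: eq_sw => a b.
by rewrite -mulrA h_fg !mulrA Rm_conv.
Qed.

End Triples.

(** The monodromy R R' in the legs f and g; for commuting f and g the second factor is R'. *)
Definition Qm f g : M := Rm f g * Rm g f.

Lemma Qm_conv f g h : algmap f -> algmap g -> algmap h ->
  commuting f g -> commuting f h -> commuting g h ->
  Qm f (conv g h) = Rm f h * Qm f g * Rm h f.
Proof.
move=> fA gA hA fg fh gh; by rewrite /Qm Rm_convr // Rm_convl ?mulrA //; exact: commutingC.
Qed.

End AlgebraMaps.

(* The handle in one factor: [f] is leg 0, [a] and [t] are the two copies of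
   [H], and [T_a], [T_t] say that (1 (x) h) T = T (h' (x) h'') and
   T (1 (x) h~) = (h'' (x) h'~) T. *)
Section Handle.
Variables (K : fieldType) (H : falgType K) (X : ribbonHopf H) (M : pzAlgType K).
Variables (f t a : H -> M) (T T' : M).
Hypotheses (fA : algmap f) (tA : algmap t) (aA : algmap a).
Hypotheses (ft : commuting f t) (fa : commuting f a) (ta : commuting t a).
Local Notation "'v'" := (rib X).
Local Notation Rm := (Rm X).
Local Notation Ri := (Ri X).
Local Notation Qm := (Qm X).
Hypotheses (TK : T * T' = 1) (T'K : T' * T = 1).
Hypothesis T_a : forall x, a x * T = T * conv X f a x.
Hypothesis T_t : forall x, T * t x = conv X t f x * T.
Hypothesis T_f : f v * T = T * f v.
Hypothesis t_rib : t v = a v.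

Let tf := commutingC ft.
Let af := commutingC fa.

(** T carries R in the legs (tf, a) to R in the legs (t, fa): by [T_a] and [T_t] it takes the
    coproduct from the first leg to the second. *)
Lemma handle_exchange : Rm t a * Rm f a * T = T * (Rm t a * Rm t f).
Proof.
rewrite -Rm_convl // -Rm_convr //.
rewrite {1}/Rm /tm -sw_mulr /Rm /tm -sw_mull; apply: eq_sw => c d.
by rewrite -mulrA T_a !mulrA T_t.
Qed.

Let w := v^-1.
Let vw : v * w = 1. Proof. by rewrite mulrV // rib_unit. Qed.
Let wv : w * v = 1. Proof. by rewrite mulVr // rib_unit. Qed.
Let v_central y : v * y = y * v. Proof. exact: rib_central. Qed.
Let w_central y : w * y = y * w.
Proof. by rewrite -[y * w]mul1r -wv -[LHS]mulr1 -vw !mulrA -[_ * v * y]mulrA -[w * y * v]mulrA -v_central. Qed.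

Let inv_uniq (x y z : M) : x * y = 1 -> y * z = 1 -> x = z.
Proof. by move=> xy yz; rewrite -[x]mulr1 -yz mulrA xy mul1r. Qed.

Let am_w (g : H -> M) : algmap g -> g w * g v = 1 /\ g v * g w = 1.
Proof. by move=> gA; rewrite -!am_mul // wv vw am_one. Qed.

Lemma handle_commutator :
  f (v ^+ 2) * (Rm f a * T * Rm a f) * (Ri a f * Ri f a) *
    (Ri a f * T' * Ri f a) = Ri t a * Qm f t * Rm t a.
Proof.
have cA : algmap (conv X f a) by exact: conv_algmap.
have tfA : algmap (conv X t f) by exact: conv_algmap.
have tc : commuting t (conv X f a) by apply/commutingC/conv_commuting.
(* [Z] is R in the legs t and [conv X f a], made opaque by the existential; [Z'] is its inverse. *)
have [Z defZ] : exists Z, Z = Rm t a * Rm t f by eexists.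
have [Z' defZ'] : exists Z', Z' = Ri t f * Ri t a by eexists.
have ZZ' : Z * Z' = 1 by rewrite defZ defZ' mulrA -[_ * _ * Ri t f]mulrA RmK // mulr1 RmK.
have TZ' : T' * Ri f a * Ri t a = Z' * T'.
  apply: (@inv_uniq _ (Rm t a * Rm f a * T)).
    by rewrite !mulrA -[_ * _ * Rm t a]mulrA RiK // mulr1 -[_ * _ * Rm f a]mulrA RiK // mulr1.
  by rewrite handle_exchange -defZ !mulrA -[T * Z * Z']mulrA ZZ' mulr1.
have Zc : Z * conv X f a v = conv X f a v * Z.
  rewrite defZ -Rm_convr //.
  by case: (tm_central (Rmat X) v_central tA cA tc).
have [fwv fvw] := am_w fA; have [awv avw] := am_w aA; have [twv tvw] := am_w tA.
have tw : t w = a w by apply: (inv_uniq (y := t v)) => //; rewrite t_rib.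
(* The ribbon relation trades the inverse monodromy for Delta(v) in the legs f, a, which T turns
   into a(v) alone. *)
have RR : Ri f a * Ri a f = conv X f a v * (a w * f w).
  by rewrite conv_rib // -!mulrA [a v * _]mulrA avw mul1r fvw mulr1.
have T'f : f w * T' = T' * f w.
  rewrite -[LHS]mul1r -T'K -!mulrA; congr (T' * _).
  have Tfw : T * f w = f w * T.
    by rewrite -[LHS]mul1r -fwv -mulrA [f v * _]mulrA T_f -!mulrA fvw mulr1.
  by rewrite mulrA Tfw -mulrA TK mulr1.
have Z'w : Z' * (a w * f w) = (a w * f w) * Z'.
  have hf x y : x * f w = f w * x -> x * a w = a w * x -> y * f w = f w * y -> y * a w = a w * y ->
      x * y * (a w * f w) = a w * f w * (x * y).
    move=> xf xa yf ya.
    by rewrite !mulrA -[x * y * _]mulrA ya mulrA xa -!mulrA yf [x * (f w * _)]mulrA xf !mulrA.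
  rewrite defZ'; apply: hf.
  - by case: (tm_central (Rinv X) w_central tA fA tf).
  - by apply: commute_tm => y; rewrite ?ta ?fa.
  - by apply: commute_tm => y; rewrite ?tf ?af.
  - by case: (tm_central (Rinv X) w_central tA aA ta).
have [q defq] : exists q, q = Qm f t by eexists.
(* The ribbon relation for v^-1, in the legs t, f: here the monodromy of the result is created. *)
have tfw : conv X t f w = t w * f w * q.
  apply: (inv_uniq (y := conv X t f v)); first by rewrite -am_mul // wv am_one.
  rewrite conv_rib // defq /Qm !mulrA -[_ * t v * f v * t w]mulrA.
  rewrite (_ : _ * (f v * t w) = Ri t f * Ri f t * (t v * t w) * f v); last first.
    by rewrite ft !mulrA.
  by rewrite tvw mulr1 -[_ * f v * f w]mulrA fvw mulr1 -[_ * _ * Rm f t]mulrA RiK // mulr1 RiK.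
have Qw : q * f w = f w * q.
  have [q1 _] := tm_central (Rmat X) w_central fA tA ft.
  have [_ q2] := tm_central (Rmat X) w_central tA fA tf.
  by rewrite defq /Qm /Rm -mulrA q2 mulrA q1 mulrA.
have Rtaf x : Rm t a * f x = f x * Rm t a.
  by apply: commute_tm => y; rewrite ?tf ?af.
(* With the conjugation by [Rm t a] moved to the other side, [handle_exchange] applies and only the
   monodromy [q] must remain. *)
suff e : Rm t a * (f (v ^+ 2) * (Rm f a * T * Rm a f) * (Ri a f * Ri f a) *
    (Ri a f * T' * Ri f a)) * Ri t a = q.
  rewrite -defq -e !mulrA RiK // mul1r -[LHS]mulr1 -(RiK X tA aA ta) !mulrA.
  by [].
transitivity (f (v ^+ 2) * ((Rm t a * Rm f a * T) * (Ri f a * Ri a f) *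
    (T' * Ri f a * Ri t a))).
  rewrite !mulrA Rtaf; do 3 congr (_ * _); rewrite -!mulrA; do 4 congr (_ * _).
  by rewrite [Rm a f * _]mulrA RmK // mul1r.
rewrite handle_exchange -defZ TZ' RR.
rewrite (_ : _ * _ * _ = T * (Z * conv X f a v) * (a w * f w * Z') * T'); last first.
  by rewrite !mulrA.
rewrite Zc -Z'w (_ : _ * _ * _ * _ = T * conv X f a v * (Z * Z') * (a w * f w) * T'); last first.
  by rewrite !mulrA.
rewrite ZZ' mulr1 -T_a -tw -!mulrA T'f [T * (t w * _)]mulrA T_t !mulrA.
rewrite -[_ * T * T']mulrA TK mulr1 tfw -!mulrA Qw !mulrA.
rewrite -[_ * a v * t w]mulrA -t_rib tvw mulr1 -[_ * f w * f w]mulrA -!am_mul //.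
by rewrite expr2 -mulrA [v * (w * w)]mulrA vw mul1r vw am_one // mul1r.
Qed.

Lemma handle_C : Ri t a * Qm f t * Rm t a * (Rm f a * Rm a f) =
  Rm f a * Rm f t * (Rm t f * Rm a f).
Proof.
have ybe1 := yang_baxter X tA fA aA tf ta fa.
have ybe2 := yang_baxter X fA tA aA ft fa ta.
rewrite /Qm !mulrA; congr (_ * _); rewrite -!mulrA [Rm t f * _]mulrA ybe1 !mulrA.
congr (_ * _); rewrite -!mulrA [Rm f t * _]mulrA ybe2 !mulrA RiK // mul1r.
by [].
Qed.

(** [q] stands for the contribution of the next handle. Two Yang-Baxter moves bring the R-matrix of
    t and a next to it, and commuting with [q] lets this R-matrix cancel. *)
Lemma handle_D (q : M) : Rm t a * q = q * Rm t a ->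
  Rm f a * Ri t f * q * (Rm t f * Rm a f) =
  Ri t a * (Ri t f * (Rm f a * q * Rm a f) * Rm t f) * Rm t a.
Proof.
move=> Wq.
have e1 : Rm t a * Rm f a * Ri t f = Ri t f * Rm f a * Rm t a.
  have ybe1 := yang_baxter X tA fA aA tf ta fa.
  rewrite -[LHS]mul1r -(RiK X tA fA tf) -!mulrA; congr (_ * _).
  by rewrite !mulrA ybe1 -!mulrA RmK // mulr1.
have e2 : Rm t f * Rm a f = Ri t a * (Rm a f * Rm t f) * Rm t a.
  rewrite -mulrA -(yang_baxter X tA aA fA ta tf af) !mulrA RiK // mul1r.
  by [].
rewrite e2 -[LHS]mul1r -(RiK X tA aA ta) -!mulrA; congr (_ * _).
rewrite !mulrA e1 -[_ * Rm t a * q]mulrA Wq !mulrA; congr (_ * _ * _ * _).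
by rewrite -!mulrA RmK // mulr1.
Qed.

End Handle.

(* Two neighbouring factors, [t'], [a'] being those of the first one. *)
Section TwoHandles.
Variables (K : fieldType) (H : falgType K) (X : ribbonHopf H) (M : pzAlgType K).
Variables f t' a' t a : H -> M.
Local Notation Rm := (Rm X).
Local Notation Ri := (Ri X).
Local Notation Qm := (Qm X).
Hypotheses (fA : algmap f) (t'A : algmap t') (a'A : algmap a').
Hypotheses (tA : algmap t) (aA : algmap a).
Hypotheses (ft' : commuting f t') (fa' : commuting f a').
Hypotheses (ft : commuting f t) (fa : commuting f a).
Hypotheses (t'a' : commuting t' a') (ta : commuting t a).
Hypotheses (t't : commuting t' t) (t'a : commuting t' a).
Hypotheses (a't : commuting a' t) (a'a : commuting a' a).

Let W'C : Rm t' a' * (Ri t a * Qm f t * Rm t a) = Ri t a * Qm f t * Rm t a * Rm t' a'.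
Proof.
have t'f := commutingC ft'; have a'f := commutingC fa'.
have c1 : Rm t' a' * Ri t a = Ri t a * Rm t' a' by apply: tm_commute.
have c2 : Rm t' a' * Rm f t = Rm f t * Rm t' a' by apply: tm_commute.
have c3 : Rm t' a' * Rm t f = Rm t f * Rm t' a' by apply: tm_commute.
have c4 : Rm t' a' * Rm t a = Rm t a * Rm t' a' by apply: tm_commute.
rewrite /Qm !mulrA c1 -!mulrA; congr (_ * _); rewrite !mulrA c2 -!mulrA; congr (_ * _).
by rewrite mulrA c3 -mulrA c4.
Qed.

(** [handle_D] takes the R-matrices of t' and a' outside; what remains around the monodromy of f and
    t merges with it by (id (x) Delta)(R R'). *)
Lemma two_handles :
  Rm f a' * Ri t' f * (Ri t a * Qm f t * Rm t a) * (Rm t' f * Rm a' f) =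
  Ri t' a' * Ri t a * (Ri t' f * Qm f (conv X t a') * Rm t' f) * (Rm t a * Rm t' a').
Proof.
rewrite (handle_D fA t'A a'A ft' fa' t'a' W'C) (Qm_conv X fA tA a'A ft fa' (commutingC a't)).
have at' := commutingC t'a; have tt' := commutingC t't.
have aa' := commutingC a'a; have ta' := commutingC a't.
have tf := commutingC ft; have af := commutingC fa.
have d1 : Rm f a' * Ri t a = Ri t a * Rm f a' by apply: tm_commute.
have d2 : Ri t' f * Ri t a = Ri t a * Ri t' f by apply: tm_commute.
have d3 : Rm t a * Rm a' f = Rm a' f * Rm t a by apply: tm_commute.
have d4 : Rm t a * Rm t' f = Rm t' f * Rm t a by apply: tm_commute.
rewrite !mulrA; congr (_ * _); rewrite -!mulrA; congr (_ * _).
rewrite (mulrA (Rm t a)) d3 -mulrA d4 (mulrA (Rm f a')) d1 -mulrA.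
by rewrite (mulrA (Ri t' f)) d2 -mulrA.
Qed.

(** The inner factors 1 are those of [core] for A, kept so that the statement applies to it as it
    stands. *)
Lemma two_handles_conj (c L LV B A' B' : M) :
  LV * L = 1 -> Rm t' f * Rm a' f * LV * (L * (Ri a' f * Ri t' f)) = 1 ->
  c * L = L * c -> c * (Rm f a' * 1 * Rm a' f) = Rm f a' * 1 * Rm a' f * c ->
  c * (Ri a' f * Ri t' f) = Ri a' f * Ri t' f * c ->
  c * B * A' * B' = Ri t a * Qm f t * Rm t a ->
  c * (L * (Rm f a' * 1 * Rm a' f) * LV) *
    (L * (Ri a' f * Ri t' f) * B * (Rm t' f * Rm a' f * LV)) *
    (L * (Ri a' f * Ri t' f) * A' * (Rm t' f * Rm a' f * LV)) *
    (L * (Ri a' f * Ri t' f) * B' * (Rm t' f * Rm a' f * LV)) =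
  L * (Ri t' a' * Ri t a * (Ri t' f * Qm f (conv X t a') * Rm t' f) *
    (Rm t a * Rm t' a')) * LV.
Proof.
move=> LVL LVL1 cL cA cN e; rewrite conj_step // e -two_handles; congr (_ * _ * _).
rewrite mulr1 (_ : Rm f a' * Rm a' f * (Ri a' f * Ri t' f) = Rm f a' * (Rm a' f * Ri a' f) * Ri t' f); last by rewrite !mulrA.
by rewrite (RmK X a'A fA (commutingC fa')) mulr1.
Qed.

End TwoHandles.

(** * The Heisenberg double *)

Section EndoAlgebra.
Variables (K : fieldType) (V : vectType K).

Fact endo_scaleAl (k : K) (x y : endo V) : k *: (x * y) = (k *: x) * y.
Proof. by apply/lfunP => u; rewrite !(scale_lfunE, comp_lfunE). Qed.
Fact endo_scaleAr (k : K) (x y : endo V) : k *: (x * y) = x * (k *: y).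
Proof. by apply/lfunP => u; rewrite !(scale_lfunE, comp_lfunE) linearZ. Qed.
HB.instance Definition _ := Lmodule_hasMul.Build K (endo V)
  (@mulrA (endo V)) (@mul1r (endo V)) (@mulr1 (endo V)) (@mulrDl (endo V))
  (@mulrDr (endo V)) endo_scaleAl endo_scaleAr.

Lemma endoM (x y : endo V) u : (x * y) u = x (y u).
Proof. exact: comp_lfunE. Qed.

(** An alias of the matrix type, on which the scalars are those of K and not of [endo V]. *)
Definition pmx (n : nat) : Type := 'M[endo V]_n.
Variable n : nat.
HB.instance Definition _ := GRing.Zmodule.on (pmx n).

Definition pmx_scale (k : K) (A : pmx n) : pmx n := map_mx ( *:%R k) A.
Fact pmx_scaleA k l A : pmx_scale k (pmx_scale l A) = pmx_scale (k * l) A.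
Proof. by apply/matrixP => p q; rewrite !mxE scalerA. Qed.
Fact pmx_scale1 : left_id 1 pmx_scale.
Proof. by move=> A; apply/matrixP => p q; rewrite !mxE scale1r. Qed.
Fact pmx_scaleDr : right_distributive pmx_scale +%R.
Proof. by move=> k A B; apply/matrixP => p q; rewrite !mxE scalerDr. Qed.
Fact pmx_scaleDl A : {morph pmx_scale^~ A : k l / k + l}.
Proof. by move=> k l; apply/matrixP => p q; rewrite !mxE scalerDl. Qed.
HB.instance Definition _ := GRing.Zmodule_isLmodule.Build K (pmx n)
  pmx_scaleA pmx_scale1 pmx_scaleDr pmx_scaleDl.

Fact pmx_scaleAl (k : K) (A B : pmx n) : k *: (A *m B : pmx n) = (k *: A) *m B.
Proof.
apply/matrixP => p q; rewrite !mxE scaler_sumr; apply: eq_bigr => r _.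
by rewrite !mxE endo_scaleAl.
Qed.
Fact pmx_scaleAr (k : K) (A B : pmx n) : k *: (A *m B : pmx n) = A *m (k *: B).
Proof.
apply/matrixP => p q; rewrite !mxE scaler_sumr; apply: eq_bigr => r _.
by rewrite !mxE endo_scaleAr.
Qed.
HB.instance Definition _ := Lmodule_hasMul.Build K (pmx n)
  (@mulmxA (endo V) n n n n) (@mul1mx (endo V) n n) (@mulmx1 (endo V) n n)
  (@mulmxDl (endo V) n n n) (@mulmxDr (endo V) n n n) pmx_scaleAl pmx_scaleAr.
(* Matrices are typed in [PzAlgebra.sort], not in ['M_n], so that their products
   involve only one instance of the ring structure. *)
Definition pmat_alg : pzAlgType K := pmx n.
Local Notation pmat := (PzAlgebra.sort pmat_alg).

Lemma pmat_mulE (A B : pmat) : A * B = A *m B. Proof. by []. Qed.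
Lemma pmat_addE (A B : pmat) p q : (A + B) p q = A p q + B p q.
Proof. exact: mxE. Qed.
Lemma pmat_oneE p q : (1 : pmat) p q = (p == q)%:R.
Proof. exact: mxE. Qed.
Lemma pmat_scaleE k (A : pmat) p q : (k *: A) p q = k *: A p q.
Proof. exact: mxE. Qed.

End EndoAlgebra.
Notation pmat V n := (PzAlgebra.sort (pmat_alg V n)).

Section Heisenberg.
Variables (K : fieldType) (H : falgType K) (X : ribbonHopf H).
Local Notation dual := 'Hom(H, K^o).
Local Notation "'Delta'" := (cop X).
Implicit Types (phi psi chi : dual) (x y h : H).

Local Notation Ha := (@act_H K H : H -> endo dual).
Local Notation Ht := (act_Ht X).
Local Notation O := (act_form X).

Lemma act_HE h phi x : Ha h phi x = phi (x * h).
Proof. by rewrite /act_H linfunE ?shiftE ?mul1r //; exact: shift_lin. Qed.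

Lemma act_HtE h phi x : Ht h phi x = phi (antiV X h * x).
Proof. by rewrite /act_Ht linfunE ?shiftE ?mulr1 //; exact: shift_lin. Qed.

Lemma dual_bilin phi psi : bilinear_fun (fun a b => phi a * psi b : K^o).
Proof. by split=> b; linear_tac. Qed.

Lemma dmulE phi psi x : dmul X phi psi x = \sw_(a, b <- Delta x) (phi a * psi b : K^o).
Proof. by rewrite /dmul linfunE //; have [? ?] := dual_bilin phi psi; linear_tac. Qed.

Lemma dmul_linr phi : lin (dmul X phi).
Proof.
move=> k f g; apply/lfunP => x; rewrite add_lfunE scale_lfunE !dmulE -sw_scale /sweedler /tlift.
rewrite -big_split; apply: eq_bigr => m _ /=; rewrite -scalerDr; congr (_ *: _).
by rewrite add_lfunE scale_lfunE mulrDr mulrCA.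
Qed.

Lemma dmul_linl psi : lin (fun phi => dmul X phi psi).
Proof.
move=> k f g; apply/lfunP => x; rewrite add_lfunE scale_lfunE !dmulE -sw_scale /sweedler /tlift.
rewrite -big_split; apply: eq_bigr => m _ /=; rewrite -scalerDr; congr (_ *: _).
by rewrite add_lfunE scale_lfunE mulrDl scalerAl.
Qed.

Lemma act_formE psi phi : O psi phi = dmul X psi phi.
Proof. by rewrite /act_form linfunE //; exact: dmul_linr. Qed.

Lemma act_form_lin : lin O.
Proof.
move=> k f g; apply/lfunP => phi; rewrite add_lfunE scale_lfunE !act_formE.
exact: dmul_linl.
Qed.

Lemma act_H_algmap : algmap Ha.
Proof.
split.
- move=> k x y; apply/lfunP => phi; apply/lfunP => z.
  by rewrite add_lfunE scale_lfunE add_lfunE scale_lfunE !act_HE mulrDr linearD -scalerAr linearZ.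
- by apply/lfunP => phi; apply/lfunP => z; rewrite act_HE mulr1 id_lfunE.
- by move=> x y; apply/lfunP => phi; apply/lfunP => z; rewrite endoM !act_HE mulrA.
Qed.

Lemma act_Ht_algmap : algmap Ht.
Proof.
split.
- move=> k x y; apply/lfunP => phi; apply/lfunP => z.
  rewrite add_lfunE scale_lfunE add_lfunE scale_lfunE !act_HtE.
  by rewrite linearD linearZ mulrDl linearD -scalerAl linearZ.
- by apply/lfunP => phi; apply/lfunP => z; rewrite act_HtE antiV1 mul1r id_lfunE.
- move=> x y; apply/lfunP => phi; apply/lfunP => z.
  by rewrite endoM !act_HtE antiVM mulrA.
Qed.

Lemma act_Ht_H : commuting Ht Ha.
Proof.
move=> x y; apply/lfunP => phi; apply/lfunP => z.
by rewrite !endoM act_HtE !act_HE act_HtE mulrA.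
Qed.

Lemma act_Ht_rib : Ht (rib X) = Ha (rib X).
Proof.
apply/lfunP => phi; apply/lfunP => z.
by rewrite act_HtE act_HE antiV_rib rib_central.
Qed.

Lemma act_form1 : O (cou X) = 1.
Proof.
apply/lfunP => phi; apply/lfunP => z; rewrite act_formE dmulE id_lfunE.
rewrite -[RHS](@sw_counitl _ _ X _ z phi) //; exact: lin_linear.
Qed.

Lemma act_formM phi psi : O (dmul X phi psi) = O phi * O psi.
Proof.
apply/lfunP => chi; apply/lfunP => z; rewrite endoM !act_formE !dmulE.
transitivity (\sw_(a, b <- Delta z) \sw_(c, d <- Delta a) (phi c * psi d * chi b : K^o)).
  apply: eq_sw => a b; rewrite dmulE /sweedler /tlift mulr_suml.
  by apply: eq_bigr => m _; rewrite -scalerAl.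
rewrite (@sw_coassoc _ _ X _ z (fun c d b => phi c * psi d * chi b : K^o)).
  apply: eq_sw => a b; rewrite dmulE /sweedler /tlift mulr_sumr.
  by apply: eq_bigr => m _; rewrite -mulrA -[in RHS]scalerAr.
by split; linear_tac.
Qed.

(** The relation of the Heisenberg double, read off from Delta(y h) = Delta(y) Delta(h). *)
Lemma act_H_form h psi :
  Ha h * O psi = \sw_(c, d <- Delta h) (O (shift psi 1 c) * Ha d).
Proof.
have ev (x : dual) (y : H) : lin (fun z : endo dual => z x y).
  by move=> k f g; rewrite add_lfunE scale_lfunE add_lfunE scale_lfunE.
apply/lfunP => phi; apply/lfunP => y.
rewrite endoM act_HE act_formE dmulE (sw_lin (L := fun z : endo dual => z phi y)) //.
rewrite (@sw_copM _ _ X _ y h (fun a b => psi a * phi b : K^o)); last exact: dual_bilin.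
rewrite sw_exch; apply: eq_sw => c d; rewrite endoM act_formE dmulE.
by apply: eq_sw => a b; rewrite shiftE mul1r act_HE.
Qed.

(** The counterpart for h~. The coproduct of S^-1(h) that appears is removed by [sw_cop_antiV]. *)
Lemma form_act_Ht h psi :
  O psi * Ht h = \sw_(c, d <- Delta h) (Ht c * O (shift psi d 1)).
Proof.
have ev (x : dual) (y : H) : lin (fun z : endo dual => z x y).
  by move=> k f g; rewrite add_lfunE scale_lfunE add_lfunE scale_lfunE.
apply/lfunP => phi; apply/lfunP => y.
rewrite endoM act_formE dmulE (sw_lin (L := fun z : endo dual => z phi y)) //.
pose F u w := \sw_(a, b <- Delta y) (psi (u * a) * phi (w * b) : K^o).
transitivity (F 1 (antiV X h)).
  by apply: eq_sw => a b; rewrite act_HtE mul1r.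
have Fb : bilinear_fun F by rewrite /F; split; linear_tac.
rewrite -(@sw_cop_antiV _ _ X _ h F Fb); apply: eq_sw => c d.
rewrite endoM act_HtE act_formE dmulE sw_copM; last exact: dual_bilin.
apply: eq_sw => p q; apply: eq_sw => a b.
by rewrite shiftE mulr1 mulrA.
Qed.

End Heisenberg.

(** * Matrices over the Heisenberg double *)

(** Taken with [id] for g = 1 and with [emb k] in general, so that both cases share the same
    lemmas. *)
Record algebra_morphism (K : fieldType) (U V : vectType K) (e : endo U -> endo V) : Prop :=
  AlgebraMorphism {
    mor_lin : lin e; mor_one : e 1 = 1;
    mor_mul : forall x y, e (x * y) = e x * e y }.

Section Emb.
Variables (K : fieldType) (V : vectType K) (n : nat).

Lemma tpow_ext (W : vectType K) (f g : 'Hom(tpow V n, W)) :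
  (forall x, f (tens x) = g (tens x)) -> f = g.
Proof.
move=> fg; apply/lfunP => c; rewrite (tens_bas c) !linear_sum.
by apply: eq_bigr => m _; rewrite !linearZ /= fg.
Qed.

Lemma emb_tens (k : 'I_n) (Z : endo V) x :
  emb k Z (tens x) = tens (fun l => if l == k then Z (x l) else x l).
Proof.
rewrite /emb linfunE; last exact: tlift_lin.
rewrite tlift_tens //.
apply: (@multilinear_tens _ _ _ (fun l v => if l == k then Z v else v)) => l.
by case: (l == k) => //; exact: lin_linear.
Qed.

Lemma tens_lin (k : 'I_n) (x : 'I_n -> V) c a b :
  tens (fun l => if l == k then c *: a + b else x l) =
  c *: tens (fun l => if l == k then a else x l) +
  tens (fun l => if l == k then b else x l) :> tpow V n.
Proof.
have e (m : {ffun 'I_n -> 'I_(\dim {:V})}) z :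
    \prod_l coord (vbasis {:V}) (m l) (if l == k then z else x l) =
    coord (vbasis {:V}) (m k) z *
      \prod_(l | l != k) coord (vbasis {:V}) (m l) (x l).
  rewrite (bigD1 k) //= eqxx; congr (_ * _).
  by apply: eq_bigr => l /negPf ->.
by apply/ffunP => m; rewrite !ffunE !e linearP mulrDl scalerAl.
Qed.

Lemma emb_morphism (k : 'I_n) : algebra_morphism (@emb K V n k).
Proof.
split=> [c Y Z||Y Z]; apply: tpow_ext => x.
- rewrite add_lfunE scale_lfunE !emb_tens.
  transitivity (tens (fun l => if l == k then c *: Y (x k) + Z (x k) else x l)).
    congr tens; apply/funext => l; case: eqP => // ->.
    by rewrite add_lfunE scale_lfunE.
  rewrite tens_lin; congr (_ *: tens _ + tens _);
    by apply/funext => l; case: eqP => // ->.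
- rewrite emb_tens id_lfunE; congr tens; apply/funext => l.
  by case: ifP => // _; rewrite id_lfunE.
- rewrite endoM !emb_tens; congr tens; apply/funext => l.
  by case: ifP => // _; rewrite endoM.
Qed.

Lemma emb_comm (k l : 'I_n) (Y Z : endo V) : k != l ->
  emb k Y * emb l Z = emb l Z * emb k Y.
Proof.
move=> kl; apply: tpow_ext => x; rewrite !endoM !emb_tens; congr tens.
apply/funext => j; case: (eqVneq j k) => [->|//]; first by rewrite (negPf kl).
Qed.

End Emb.

Section Matrices.
Variables (K : fieldType) (H : falgType K) (X : ribbonHopf H) (V : vectType K).
Variables (n : nat) (I : mxrep H n).

(** Leg 0 acts on the matrix indices with scalar entries, while [scal] repeats an operator along the
    diagonal; hence the two commute. *)
Definition leg0 (x : H) : pmat V n := map_mx (fun k => k *: (1 : endo V)) (I x).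
Definition scal (Z : endo V) : pmat V n := Z%:M.

Lemma leg0E x p q : leg0 x p q = I x p q *: (1 : endo V).
Proof. exact: mxE. Qed.

Lemma leg0_algmap : algmap leg0.
Proof.
split.
- move=> k x y; apply/matrixP => p q; rewrite pmat_addE pmat_scaleE !leg0E.
  by rewrite linearP !mxE scalerDl scalerA.
- by apply/matrixP => p q; rewrite leg0E rmorph1 pmat_oneE !mxE; case: (p == q); rewrite ?scale1r ?scale0r.
- move=> x y; apply/matrixP => p q; rewrite leg0E rmorphM !mxE scaler_suml.
  apply: eq_bigr => r _; rewrite !leg0E -endo_scaleAl mul1r scalerA.
  by [].
Qed.

Lemma pmat_scalr (A : pmat V n) Z p q : (A * scal Z) p q = A p q * Z.
Proof.
rewrite pmat_mulE mxE (bigD1 q) //= big1 ?addr0 => [|r /negPf rq]; rewrite mxE ?eqxx //.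
by rewrite rq mulr0.
Qed.

Lemma pmat_scall (A : pmat V n) Z p q : (scal Z * A) p q = Z * A p q.
Proof.
rewrite pmat_mulE mxE (bigD1 p) //= big1 ?addr0 => [|r /negPf rq]; rewrite mxE ?eqxx //.
by rewrite eq_sym rq mul0r.
Qed.

Lemma scal_lin : lin scal.
Proof.
move=> k x y; apply/matrixP => p q; rewrite !mxE.
by case: (p == q); rewrite ?mulr1n // !mulr0n scaler0 addr0.
Qed.

Lemma scalM x y : scal (x * y) = scal x * scal y.
Proof. by apply/matrixP => p q; rewrite pmat_scall !mxE mulrnAr. Qed.

Lemma scal_algmap (g : H -> endo V) : algmap g -> algmap (fun x => scal (g x)).
Proof.
move=> [gl g1 gM]; split=> [||x y].
- exact: lin_comp scal_lin gl.
- by rewrite g1.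
- by rewrite gM scalM.
Qed.

Lemma scal_commuting (g h : H -> endo V) : commuting g h ->
  commuting (fun x => scal (g x)) (fun x => scal (h x)).
Proof. by move=> gh x y; rewrite -!scalM gh. Qed.

Lemma leg0_scal (g : H -> endo V) : commuting leg0 (fun x => scal (g x)).
Proof.
move=> x y; apply/matrixP => p q; rewrite pmat_scalr pmat_scall leg0E.
by rewrite -endo_scaleAl -endo_scaleAr mul1r mulr1.
Qed.

Lemma sw_pmat (t : tpow H 2) (F : H -> H -> pmat V n) p q :
  (sweedler t F) p q = \sw_(a, b <- t) (F a b p q).
Proof.
rewrite (sw_lin (L := fun A : pmat V n => A p q)) // => k A B.
by rewrite pmat_addE pmat_scaleE.
Qed.

Lemma tm_leg0 (g : H -> endo V) t p q :
  tm leg0 (fun x => scal (g x)) t p q = \sw_(a, b <- t) (I a p q *: g b).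
Proof.
rewrite sw_pmat; apply: eq_sw => a b.
by rewrite pmat_scalr leg0E -endo_scaleAl mul1r.
Qed.

Lemma tm_scal (g h : H -> endo V) t :
  tm (fun x => scal (g x)) (fun x => scal (h x)) t = scal (tm g h t).
Proof. by rewrite /tm (sw_lin _ _ scal_lin); apply: eq_sw => a b; rewrite scalM. Qed.

Section Embedded.
Variable e : endo 'Hom(H, K^o) -> endo V.
Hypothesis eM : algebra_morphism e.

Definition legH (x : H) : endo V := e (act_H x).
Definition legHt (x : H) : endo V := e (act_Ht X x).

Lemma legH_algmap : algmap legH.
Proof.
have [el e1 em] := eM; have [al a1 am] := act_H_algmap H.
by split=> [||x y]; rewrite /legH ?a1 ?am ?em //; exact: lin_comp el al.
Qed.

Lemma legHt_algmap : algmap legHt.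
Proof.
have [el e1 em] := eM; have [al a1 am] := act_Ht_algmap X.
by split=> [||x y]; rewrite /legHt ?a1 ?am ?em //; exact: lin_comp el al.
Qed.

Lemma legHt_H : commuting legHt legH.
Proof. by case: eM => _ _ em x y; rewrite -!em act_Ht_H. Qed.

Lemma legHt_rib : legHt (rib X) = legH (rib X).
Proof. by rewrite /legHt act_Ht_rib. Qed.

Local Notation sH := (fun x => scal (legH x)).
Local Notation sHt := (fun x => scal (legHt x)).

Lemma LplusE : Lplus X e I = Rm X leg0 sH.
Proof. by apply/matrixP => p q; rewrite mxE tm_leg0. Qed.

Lemma LminusE : Lminus X e I = Ri X sH leg0.
Proof.
rewrite -(sw_antiV_Ri X (scal_algmap legH_algmap) leg0_algmap (commutingC (@leg0_scal _))).
apply/matrixP => p q; rewrite mxE sw_pmat; apply: eq_sw => a b.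
by rewrite pmat_scalr leg0E -endo_scaleAl mul1r.
Qed.

Lemma LminustE : Lminust X e I = Ri X sHt leg0.
Proof.
rewrite -(sw_antiV_Ri X (scal_algmap legHt_algmap) leg0_algmap (commutingC (@leg0_scal _))).
apply/matrixP => p q; rewrite mxE sw_pmat; apply: eq_sw => a b.
by rewrite pmat_scalr leg0E -endo_scaleAl mul1r.
Qed.

Definition Tm : pmat V n := Tmat X e I.
(** T composed with the antipode, an inverse of T by the antipode axioms. *)
Definition Tinv : pmat V n :=
  \matrix_(p, q) e (act_form X (linfun (fun x => I (anti X x) p q : K^o))).

Lemma mxrep_lin p q : lin (fun x => I x p q : K^o).
Proof. by move=> k x y; rewrite linearP !mxE. Qed.

Lemma TmxE p q x : Tmx I p q x = I x p q.
Proof. by rewrite mxE linfunE //; exact: mxrep_lin. Qed.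

Lemma shift_Tmxl p q c :
  shift (Tmx I p q) c 1 = \sum_r (I c p r *: Tmx I r q).
Proof.
apply/lfunP => x; rewrite shiftE mulr1 TmxE rmorphM !mxE sum_lfunE.
by apply: eq_bigr => r _; rewrite scale_lfunE TmxE.
Qed.

Lemma shift_Tmxr p q c :
  shift (Tmx I p q) 1 c = \sum_r (I c r q *: Tmx I p r).
Proof.
apply/lfunP => x; rewrite shiftE mul1r TmxE rmorphM !mxE sum_lfunE.
by apply: eq_bigr => r _; rewrite scale_lfunE TmxE mulrC.
Qed.

Let Oe psi : endo V := e (act_form X psi).
Let Oe_lin : lin Oe.
Proof. by apply: lin_comp; [exact: mor_lin eM | exact: act_form_lin]. Qed.

Lemma TmE p q : Tm p q = Oe (Tmx I p q). Proof. by rewrite mxE. Qed.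

Lemma leg0_Tm x p q : (leg0 x * Tm) p q = Oe (shift (Tmx I p q) x 1).
Proof.
rewrite shift_Tmxl (lin_sum _ _ _ Oe_lin) pmat_mulE mxE; apply: eq_bigr => r _.
by rewrite leg0E TmE (linZ Oe_lin) -endo_scaleAl mul1r.
Qed.

Lemma Tm_leg0 x p q : (Tm * leg0 x) p q = Oe (shift (Tmx I p q) 1 x).
Proof.
rewrite shift_Tmxr (lin_sum _ _ _ Oe_lin) pmat_mulE mxE; apply: eq_bigr => r _.
by rewrite leg0E TmE (linZ Oe_lin) -endo_scaleAr mulr1.
Qed.

Lemma Tm_rib : leg0 (rib X) * Tm = Tm * leg0 (rib X).
Proof.
apply/matrixP => p q; rewrite leg0_Tm Tm_leg0; congr Oe; apply/lfunP => x.
by rewrite !shiftE mulr1 mul1r rib_central.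
Qed.

(** [act_H_form] entrywise: replacing psi by psi(? h') for all matrix coefficients is right
    multiplication by h' in leg 0. *)
Lemma Tm_H x : sH x * Tm = Tm * conv X leg0 sH x.
Proof.
have [el e1 em] := eM.
apply/matrixP => p q; rewrite pmat_scall TmE /legH -em act_H_form (sw_lin _ _ el).
rewrite /conv /tm -sw_mull sw_pmat; apply: eq_sw => c d.
by rewrite mulrA pmat_scalr Tm_leg0 em.
Qed.

Lemma Tm_Ht x : Tm * sHt x = conv X sHt leg0 x * Tm.
Proof.
have [el e1 em] := eM.
apply/matrixP => p q; rewrite pmat_scalr TmE /legHt -em form_act_Ht (sw_lin _ _ el).
rewrite /conv /tm -sw_mulr sw_pmat; apply: eq_sw => c d.
by rewrite -mulrA pmat_scall leg0_Tm em.
Qed.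

Let S_lin p q : lin (fun x => I (anti X x) p q : K^o).
Proof. exact: (@lin_comp _ _ _ _ (fun x => I x p q : K^o) _ (mxrep_lin p q) (lin_linear _)). Qed.

Lemma TmK : Tm * Tinv = 1.
Proof.
have [el e1 em] := eM.
apply/matrixP => p q; rewrite pmat_mulE mxE [RHS]pmat_oneE.
transitivity (Oe (\sum_r dmul X (Tmx I p r) (linfun (fun x => I (anti X x) r q : K^o)))).
  rewrite (lin_sum _ _ _ Oe_lin); apply: eq_bigr => r _.
  by rewrite TmE /Oe act_formM em; congr (_ * _); rewrite mxE.
transitivity (Oe ((p == q)%:R *: cou X)); last first.
  by rewrite (linZ Oe_lin) /Oe act_form1 e1; case: (p == q); rewrite ?scale1r ?scale0r.
congr Oe; apply/lfunP => x; rewrite sum_lfunE scale_lfunE.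
transitivity (\sw_(a, b <- cop X x) (I (a * anti X b) p q : K^o)); last first.
  rewrite (@sw_antir _ _ X _ x (fun z => I z p q : K^o)); last exact: mxrep_lin.
  rewrite rmorph1 mxE; exact: mulrC.
rewrite /sweedler /tlift (eq_bigr _ (fun r _ => dmulE _ _ _ _)) exchange_big /=.
apply: eq_bigr => m _; rewrite -scaler_sumr; congr (_ *: _); rewrite rmorphM mxE.
by apply: eq_bigr => r _; rewrite TmxE linfunE.
Qed.

Lemma TinvK : Tinv * Tm = 1.
Proof.
have [el e1 em] := eM.
apply/matrixP => p q; rewrite pmat_mulE mxE [RHS]pmat_oneE.
transitivity (Oe (\sum_r dmul X (linfun (fun x => I (anti X x) p r : K^o)) (Tmx I r q))).
  rewrite (lin_sum _ _ _ Oe_lin); apply: eq_bigr => r _.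
  by rewrite TmE /Oe act_formM em; congr (_ * _); rewrite mxE.
transitivity (Oe ((p == q)%:R *: cou X)); last first.
  by rewrite (linZ Oe_lin) /Oe act_form1 e1; case: (p == q); rewrite ?scale1r ?scale0r.
congr Oe; apply/lfunP => x; rewrite sum_lfunE scale_lfunE.
transitivity (\sw_(a, b <- cop X x) (I (anti X a * b) p q : K^o)); last first.
  rewrite (@sw_antil _ _ X _ x (fun z => I z p q : K^o)); last exact: mxrep_lin.
  rewrite rmorph1 mxE; exact: mulrC.
rewrite /sweedler /tlift (eq_bigr _ (fun r _ => dmulE _ _ _ _)) exchange_big /=.
apply: eq_bigr => m _; rewrite -scaler_sumr; congr (_ *: _); rewrite rmorphM mxE.
by apply: eq_bigr => r _; rewrite TmxE linfunE.
Qed.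

End Embedded.
End Matrices.

(** * Families of matrices as linear maps on the dual *)

Lemma mxinvE (B : pzRingType) n (M N : 'M[B]_n) :
  M *m N = 1%:M -> N *m M = 1%:M -> mxinv M = N.
Proof.
move=> MN NM; rewrite /mxinv.
case: xgetP => [N' _ [_ e]|/(_ N) []//].
by rewrite -[N']mulmx1 -MN mulmxA e mul1mx.
Qed.

Section Families.
Variables (K : fieldType) (H : falgType K) (X : ribbonHopf H).
Local Notation dual := 'Hom(H, K^o).

Section Regular.
Local Notation d := (\dim {:H}).
Local Notation bas := (vbasis {:H}).

Definition reg (x : H) : 'M[K]_d :=
  \matrix_(p, q) coord bas p (x * bas`_q).

Fact reg_linear : linear reg.
Proof.
by move=> k x y; apply/matrixP => p q; rewrite !mxE mulrDl -scalerAl linearP.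
Qed.

Fact reg_monoid : monoid_morphism reg.
Proof.
split=> [|x y]; apply/matrixP => p q; rewrite !mxE.
  by rewrite mul1r (coord_free _ _ (basis_free (vbasisP _))) eq_sym.
rewrite -mulrA {1}(coord_vbasis (memvf (y * bas`_q))) mulr_sumr linear_sum.
by apply: eq_bigr => r _; rewrite !mxE -scalerAr linearZ mulrC.
Qed.

HB.instance Definition _ := GRing.isLinear.Build K H 'M[K]_d *:%R reg reg_linear.
HB.instance Definition _ := GRing.isMonoidMorphism.Build H 'M[K]_d reg reg_monoid.
Definition reg_rep : mxrep H d := reg.

(** phi(x) = phi(x 1), expanded in the basis on both sides of x. The regular representation alone
    thus spans the dual, whence the uniqueness of [jmap]. *)
Lemma dual_regE (phi : dual) :
  phi = \sum_(p < d) \sum_(q < d) (phi bas`_p * coord bas q 1) *: Tmx reg_rep p q.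
Proof.
apply/lfunP => x; rewrite sum_lfunE.
rewrite {1}(coord_vbasis (memvf x)) linear_sum; apply: eq_bigr => p _.
rewrite sum_lfunE linearZ /= -{1}[x]mulr1 {1}(coord_vbasis (memvf 1)) mulr_sumr.
rewrite linear_sum scaler_suml; apply: eq_bigr => q _.
by rewrite scale_lfunE TmxE mxE -scalerAr linearZ /= /GRing.scale /= mulrC mulrA.
Qed.

End Regular.

Lemma eq_on_Tmx (W : lmodType K) (j j' : dual -> W) : lin j -> lin j' ->
  (forall n (I : mxrep H n), map_mx j (Tmx I) = map_mx j' (Tmx I)) -> j =1 j'.
Proof.
move=> jl jl' e phi; rewrite (dual_regE phi) (lin_sum _ _ _ jl) (lin_sum _ _ _ jl').
apply: eq_bigr => p _; rewrite (lin_sum _ _ _ jl) (lin_sum _ _ _ jl').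
apply: eq_bigr => q _; rewrite (linZ jl) (linZ jl'); congr (_ *: _).
by have /matrixP/(_ p q) := e _ reg_rep; rewrite !mxE.
Qed.

Section Represents.
Variable V : vectType K.
Implicit Types (N : forall n, mxrep H n -> pmat V n) (j : dual -> endo V).

(** The condition defining [jmap], for families with operator entries. *)
Definition represents N j :=
  lin j /\ forall n (I : mxrep H n), map_mx j (Tmx I) = N n I.

Lemma eq_represents N N' j : (forall n I, N n I = N' n I) ->
  represents N j -> represents N' j.
Proof. by move=> e [jl jN]; split=> // n I; rewrite jN e. Qed.

Definition coad_invariant (phi : dual) := forall h, coad X phi h = cou X h *: phi.

Local Notation leg0 I := (@leg0 K H V _ I).
Local Notation sc g := (fun x => scal _ (g x)).

Lemma leg0_map n (I : mxrep H n) j x y : lin j ->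
  leg0 I x * (map_mx j (Tmx I) : pmat V n) * leg0 I y =
  \matrix_(p, q) j (shift (Tmx I p q) x y) :> 'M_n.
Proof.
move=> jl; apply/matrixP => p q; rewrite [RHS]mxE pmat_mulE mxE.
transitivity (j (\sum_s I y s q *: (\sum_r I x p r *: Tmx I r s))); last first.
  congr j; apply/lfunP => z; rewrite shiftE TmxE rmorphM mxE sum_lfunE.
  apply: eq_bigr => s _; rewrite scale_lfunE sum_lfunE rmorphM mxE mulrC.
  by congr (_ * _); apply: eq_bigr => r _; rewrite scale_lfunE TmxE.
rewrite (lin_sum _ _ _ jl); apply: eq_bigr => s _.
rewrite leg0E (linZ jl) -endo_scaleAr mulr1; congr (_ *: _).
rewrite (lin_sum _ _ _ jl) pmat_mulE mxE; apply: eq_bigr => r _.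
by rewrite leg0E (linZ jl) mxE -endo_scaleAl mul1r.
Qed.

(* The value at an invariant form of (L (x) 1) N (L (x) 1)^-1, where
   L = (g (x) id)(R)^-1, is that of N as (id (x) Delta)(R) = R13 R12. *)
Lemma represents_conj N j (g : H -> endo V) : algmap g -> represents N j ->
  (forall x phi, g x * j phi = j phi * g x) ->
  exists j', [/\
    represents (fun n I => Ri X (sc g) (leg0 I) * N n I * Rm X (sc g) (leg0 I)) j',
    forall phi, coad_invariant phi -> j' phi = j phi &
    forall Z, (forall phi, Z * j phi = j phi * Z) ->
      (forall x, Z * g x = g x * Z) -> forall phi, Z * j' phi = j' phi * Z].
Proof.
move=> gA [jl jN] gj; have [gl g1 gM] := gA.
(* Leg 0 of the two R-matrices multiplies T by S^-1(b) and d, that is, shifts the form; the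
   operators g(a) and g(c) stay outside. *)
pose j' phi := \sw_(a, b <- Rmat X) \sw_(c, d <- Rmat X)
  (g a * j (shift phi (antiV X b) d) * g c).
have js x y : lin (fun phi : dual => j (shift phi x y)).
  by refine (@lin_comp _ _ _ _ j (fun phi : dual => shift phi x y) _ _) => //; exact: shift_lin.
have jsl (phi : dual) y : lin (fun x => j (shift phi x y)).
  by refine (@lin_comp _ _ _ _ j (fun x => shift phi x y) _ _) => //; exact: shift_linl.
have jsr (phi : dual) x : lin (fun y => j (shift phi x y)).
  by refine (@lin_comp _ _ _ _ j (fun y => shift phi x y) _ _) => //; exact: shift_linr.
exists j'; split; first split.
- apply: lin_sweedler => a b; apply: lin_sweedler => c d.
  refine (@pzlin_mulr _ _ _ (g c) (fun phi : dual => g a * j (shift phi (antiV X b) d)) _).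
  exact: (@pzlin_mull _ _ _ (g a) (fun phi : dual => j (shift phi (antiV X b) d))).
- move=> n I; rewrite -(sw_antiV_Ri X (scal_algmap n gA) (leg0_algmap V I) (commutingC (@leg0_scal _ _ _ _ I g))).
  rewrite /Rm /tm -!sw_mulr; apply/matrixP => p q; rewrite mxE sw_pmat.
  apply: eq_sw => a b; rewrite -sw_mull sw_pmat; apply: eq_sw => c d.
  have l : lin (fun phi : dual => g a * j phi * g c) by linear_tac.
  have := @leg0_map n I _ (antiV X b) d l; move/matrixP/(_ p q); rewrite mxE => <-.
  rewrite -(jN n I); congr (fun_of_matrix _ p q).
  have -> : map_mx (fun phi : dual => g a * j phi * g c) (Tmx I) =
     (scal n (g a) * (map_mx j (Tmx I) : pmat V n) * scal n (g c)) :> pmat V n.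
    by apply/matrixP => r s; rewrite pmat_scalr pmat_scall !mxE.
  by rewrite !mulrA.
- move=> phi phi_inv.
  transitivity (\sw_(a, b <- Rmat X) \sw_(c, d <- Rmat X)
    (g (a * c) * j (shift phi (antiV X b) d))).
    apply: eq_sw => a b; apply: eq_sw => c d.
    by rewrite -mulrA -gj mulrA gM.
  rewrite -(@sw_Rcopr _ _ X _ (fun x y z => g x * j (shift phi (antiV X z) y))); last first.
    split=> *.
    + by linear_tac.
    + exact: pzlin_mull.
    + apply: pzlin_mull.
      by refine (@lin_comp _ _ _ _ (fun x => j (shift phi x _)) _ _ (lin_linear _)).
  transitivity (\sw_(a, b <- Rmat X) ((cou X b *: g a : endo V) * j phi)).
    apply: eq_sw => a b.
    rewrite -pzscalerAl pzscalerAr -(linZ jl) -phi_inv /coad sw_mull; congr (_ * _).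
    by rewrite (sw_lin _ _ jl).
  rewrite sw_mulr -[RHS]mul1r -g1 -(counitRr X) (sw_lin _ _ gl); congr (_ * _).
  by apply: eq_sw => a b; rewrite (linZ gl).
- move=> Z Zj Zg phi; rewrite /j' -sw_mull -sw_mulr; apply: eq_sw => a b.
  rewrite -sw_mull -sw_mulr; apply: eq_sw => c d.
  by rewrite !mulrA Zg -[g a * Z * _]mulrA Zj -!mulrA Zg.
Qed.

Lemma represents_scal N j Z Z' : represents N j ->
  represents (fun n I => scal n Z * N n I * scal n Z') (fun phi => Z * j phi * Z').
Proof.
move=> [jl jN]; split; first by linear_tac.
move=> n I; apply/matrixP => p q; rewrite pmat_scalr pmat_scall -jN !mxE.
by [].
Qed.

(** Contracting the first leg of R R' with phi is the Drinfeld map; at the form of x the value is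
    therefore G(x). *)
Lemma represents_Qm (G : H -> endo V) : algmap G ->
  represents (fun n I => Qm X (leg0 I) (sc G)) (fun phi => G (drinfeld X phi)).
Proof.
move=> GA; have [Gl _ _] := GA; split.
  exact: lin_comp Gl (drinfeld_lin X).
move=> n I; have IA := leg0_algmap V I; have sA := scal_algmap n GA.
have [Il _ _] := IA; have [sl _ _] := sA.
have c : commuting (leg0 I) (sc G) by exact: leg0_scal.
have -> : Qm X (leg0 I) (sc G) = tm (leg0 I) (sc G) (tmul (Rmat X) (flip2 (Rmat X))).
  by rewrite tm_mul // tm_flip.
apply/matrixP => p q; rewrite tm_leg0 mxE /drinfeld (sw_lin _ _ Gl).
by apply: eq_sw => a b; rewrite (linZ Gl) TmxE.
Qed.

End Represents.

Section Jmap.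
Variables (g : nat) (V : vectType K) (Psi : Lg0 X g -> endo V).
Hypotheses (Psi_lin : linear Psi) (Psi_mor : monoid_morphism Psi)
  (Psi_bij : bijective Psi).

(** As [jmap] is chosen, a map with the required property has to be exhibited: j followed by the
    inverse of Psi. Uniqueness on matrix coefficients then identifies the choice. *)
Lemma Psi_jmap (N : forall n, mxrep H n -> 'M[Lg0 X g]_n) j :
  represents (fun n I => map_mx Psi (N n I) : pmat V n) j ->
  forall phi, Psi (jmap N phi) = j phi.
Proof.
move=> [jl jN]; have [Phi PsiK PhiK] := Psi_bij.
have Phi_lin : lin Phi.
  by move=> k x y; apply: (can_inj PsiK); rewrite Psi_lin !PhiK.
have h0 : linear (Phi \o j) /\
    forall n (I : mxrep H n), map_mx (Phi \o j) (Tmx I) = N n I.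
  split=> [k x y|n I]; first by rewrite /= jl Phi_lin.
  apply/matrixP => p q; rewrite mxE /=.
  by have /matrixP/(_ p q) := jN n I; rewrite !mxE => ->; rewrite PsiK.
have [l e] := xgetPex (fun=> 0) (ex_intro
  [set j : dual -> Lg0 X g | linear j /\ forall n (I : mxrep H n), map_mx j (Tmx I) = N n I]%classic
   _ h0).
apply: (@eq_on_Tmx _ (fun phi => Psi (jmap N phi)) j) => //.
  by move=> k x y; rewrite /jmap l Psi_lin.
by move=> n I; rewrite jN -e; apply/matrixP => p q; rewrite !mxE.
Qed.

Lemma map_Psi_mul n (M N : 'M[Lg0 X g]_n) :
  map_mx Psi (M *m N) = map_mx Psi M *m map_mx Psi N.
Proof.
have [_ PM] := Psi_mor; apply/matrixP => p q; rewrite !mxE.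
rewrite (lin_sum (f := Psi)) //; apply: eq_bigr => r _.
by rewrite !mxE PM.
Qed.

Lemma map_Psi_one n : map_mx Psi (1%:M : 'M[Lg0 X g]_n) = 1%:M.
Proof.
have [P1 _] := Psi_mor; apply/matrixP => p q; rewrite !mxE.
by case: (p == q); rewrite ?P1 // (lin0 (f := Psi)).
Qed.

(** [N] pulls back along the bijection Psi to a two-sided inverse of [M], so that [mxinv] does
    return an inverse. *)
Lemma map_Psi_inv n (M : 'M[Lg0 X g]_n) (N : pmat V n) :
  (map_mx Psi M : pmat V n) * N = 1 -> N * (map_mx Psi M : pmat V n) = 1 ->
  map_mx Psi (mxinv M) = N.
Proof.
move=> MN NM; have [Phi PsiK PhiK] := Psi_bij.
have NE : N = map_mx Psi (map_mx Phi N).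
  by apply/matrixP => p q; rewrite !mxE PhiK.
have inj : injective (map_mx Psi : 'M[Lg0 X g]_n -> _).
  move=> A B /matrixP e; apply/matrixP => p q; have := e p q; rewrite !mxE.
  exact: can_inj.
rewrite (@mxinvE _ _ M (map_mx Phi N)) //.
  by apply: inj; rewrite map_Psi_mul -NE map_Psi_one.
by apply: inj; rewrite map_Psi_mul -NE map_Psi_one.
Qed.

Lemma map_Psi_act n (I : mxrep H n) x :
  map_mx Psi (Lg0_act X g I x) = leg0 V I x.
Proof.
have [P1 _] := Psi_mor; apply/matrixP => p q; rewrite !mxE.
by rewrite -P1; apply: (linZ (f := Psi)).
Qed.

End Jmap.
End Families.

(** * Conjugation by Lambda *)

(** Products over naturals allow induction on m. The default [i0] is never returned, as all indices
    are below g. *)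
Lemma big_ord_below (M : pzRingType) g (i0 : 'I_g) (F : 'I_g -> M) m : (m <= g)%N ->
  \prod_(k < g | (k < m)%N) F k = \prod_(0 <= k < m) F (insubd i0 k).
Proof.
move=> mg; rewrite (big_nat_widen _ _ g) // big_mkord.
apply: eq_big => // k _; congr F; apply: val_inj.
by rewrite val_insubd ltn_ord.
Qed.

Lemma mul_cancel3 (M : pzRingType) (x y a b c d : M) :
  b * c = 1 -> a * d = 1 -> x * y = 1 -> x * (a * b) * (c * d * y) = 1.
Proof. by move=> bc ad xy; rewrite !mulrA -[_ * b * c]mulrA bc mulr1 -[x * a * d]mulrA ad mulr1. Qed.

Lemma mul_cancel3V (M : pzRingType) (x y a b c d : M) :
  c * b = 1 -> d * a = 1 -> y * x = 1 -> c * d * y * (x * (a * b)) = 1.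
Proof. by move=> cb da yx; rewrite !mulrA -[_ * y * x]mulrA yx mulr1 -[c * d * a]mulrA da mulr1. Qed.

Section Legs.
Variables (K : fieldType) (H : falgType K) (X : ribbonHopf H).
Local Notation dual := 'Hom(H, K^o).

Section Core.
Variables (V W : vectType K) (e : endo dual -> endo V) (e' : endo V -> endo W).
Hypotheses (eM : algebra_morphism e) (eM' : algebra_morphism e').
Variables (n : nat) (I : mxrep H n).

Lemma algebra_morphism_comp : algebra_morphism (e' \o e).
Proof.
have [el e1 em] := eM; have [el' e1' em'] := eM'.
by split=> [k x y||x y]; rewrite /= ?el ?el' ?e1 ?e1' ?em ?em'.
Qed.

Lemma algebra_morphism_id : algebra_morphism (id : endo V -> endo V).
Proof. by []. Qed.

(** The image of A or B in one factor before conjugation by Lambda; the last R-matrix is the inverse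
    of [Lminus]. *)
Definition core (c : handle) (V : vectType K) (e : endo dual -> endo V) : pmat V n :=
  let a := fun x => scal n (legH e x) in
  Rm X (leg0 V I) a * (if c is handleB then Tm X I e else 1) * Rm X a (leg0 V I).

Lemma map_pmat_mul (A B : pmat V n) :
  map_mx e' (A * B) = (map_mx e' A : pmat W n) * map_mx e' B.
Proof.
have [el' e1' em'] := eM'; apply/matrixP => p q.
rewrite mxE !pmat_mulE !mxE (lin_sum _ _ _ el'); apply: eq_bigr => r _.
by rewrite !mxE em'.
Qed.

Lemma map_tm_leg0 (h : H -> endo V) t :
  map_mx e' (tm (leg0 V I) (fun x => scal n (h x)) t) =
  tm (leg0 W I) (fun x => scal n (e' (h x))) t.
Proof.
have [el' _ _] := eM'; apply/matrixP => p q; rewrite mxE !tm_leg0 (sw_lin _ _ el').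
by apply: eq_sw => a b; rewrite (linZ el').
Qed.

Lemma map_core c : map_mx e' (core c e) = core c (e' \o e).
Proof.
have [el' e1' em'] := eM'.
(* Flipping the tensor puts leg 0 first, the form treated by [map_tm_leg0]. *)
have flip (Z : vectType K) (f : endo dual -> endo Z) : algebra_morphism f ->
    Rm X (fun x => scal n (legH f x)) (leg0 Z I) =
    tm (leg0 Z I) (fun x => scal n (legH f x)) (flip2 (Rmat X)).
  move=> fM; have [al _ _] := scal_algmap n (legH_algmap fM).
  have [Il _ _] := leg0_algmap Z I; rewrite tm_flip //; exact: leg0_scal.
rewrite /core !map_pmat_mul; congr (_ * _ * _).
- exact: map_tm_leg0.
- case: c; last by apply/matrixP => p q; rewrite !mxE.
  apply/matrixP => p q; rewrite mxE !pmat_oneE.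
  by case: (p == q); rewrite ?e1' // (lin0 el').
- rewrite !flip //; first exact: map_tm_leg0.
  exact: algebra_morphism_comp.
Qed.

End Core.

Section Tower.
Variables (g : nat) (i0 : 'I_g).
Variables (V : vectType K) (E : 'I_g -> endo dual -> endo V).
Hypothesis E_mor : forall k, algebra_morphism (E k).
Hypothesis E_comm : forall k l Y Z, k != l -> E k Y * E l Z = E l Z * E k Y.

Definition opH (k : 'I_g) : H -> endo V := legH (E k).
Definition opHt (k : 'I_g) : H -> endo V := legHt X (E k).

Lemma opH_algmap k : algmap (opH k).
Proof. exact/legH_algmap/E_mor. Qed.

Lemma opHt_algmap k : algmap (opHt k).
Proof. exact/legHt_algmap/E_mor. Qed.

Lemma opHt_opH k l : commuting (opHt k) (opH l).
Proof.
have [<-|kl] := eqVneq k l; first exact/legHt_H/E_mor.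
by move=> x y; apply: E_comm.
Qed.

Lemma opH_comm k l : k != l -> commuting (opH k) (opH l).
Proof. by move=> kl x y; apply: E_comm. Qed.

Lemma opHt_comm k l : k != l -> commuting (opHt k) (opHt l).
Proof. by move=> kl x y; apply: E_comm. Qed.

Local Notation idx k := (insubd i0 k).

Lemma idx_neq (k l : nat) : (k < g)%N -> (l < g)%N -> k != l -> idx k != idx l.
Proof. by move=> kg lg; apply: contraNneq => /(congr1 val); rewrite !val_insubd kg lg => ->. Qed.

Section Matrices.
Variables (n : nat) (I : mxrep H n).
Local Notation f := (leg0 V I).
Definition mxH k x : pmat V n := scal n (opH k x).
Definition mxHt k x : pmat V n := scal n (opHt k x).

Lemma mxH_algmap k : algmap (mxH k). Proof. exact/scal_algmap/opH_algmap. Qed.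
Lemma mxHt_algmap k : algmap (mxHt k). Proof. exact/scal_algmap/opHt_algmap. Qed.
Lemma leg0_mxH k : commuting f (mxH k). Proof. exact: leg0_scal. Qed.
Lemma leg0_mxHt k : commuting f (mxHt k). Proof. exact: leg0_scal. Qed.
Lemma mxH_leg0 k : commuting (mxH k) f. Proof. exact/commutingC/leg0_mxH. Qed.
Lemma mxHt_leg0 k : commuting (mxHt k) f. Proof. exact/commutingC/leg0_mxHt. Qed.
Lemma mxHt_mxH k l : commuting (mxHt k) (mxH l).
Proof. exact/scal_commuting/opHt_opH. Qed.

(** Lambda as a recursion on naturals, with an explicit inverse; [insubd] reads a natural number as
    the index of a factor. *)
Fixpoint Lam (m : nat) : pmat V n := if m is m'.+1 then
  Lam m' * (Ri X (mxH (idx m')) f * Ri X (mxHt (idx m')) f) else 1.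
Fixpoint LamV (m : nat) : pmat V n := if m is m'.+1 then
  Rm X (mxHt (idx m')) f * Rm X (mxH (idx m')) f * LamV m' else 1.

Lemma LamK m : Lam m * LamV m = 1.
Proof.
elim: m => [|m IH] /=; first by rewrite mulr1.
apply: mul_cancel3 => //.
  exact: (RiK X (mxHt_algmap _) (leg0_algmap V I) (@mxHt_leg0 _)).
exact: (RiK X (mxH_algmap _) (leg0_algmap V I) (@mxH_leg0 _)).
Qed.

Lemma LamVK m : LamV m * Lam m = 1.
Proof.
elim: m => [|m IH] /=; first by rewrite mulr1.
apply: mul_cancel3V => //.
  exact: (RmK X (mxHt_algmap _) (leg0_algmap V I) (@mxHt_leg0 _)).
exact: (RmK X (mxH_algmap _) (leg0_algmap V I) (@mxH_leg0 _)).
Qed.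

Lemma prod_Lminus m : (m <= g)%N ->
  \prod_(k < g | (k < m)%N) (Ri X (mxH k) f * Ri X (mxHt k) f) = Lam m.
Proof.
move=> mg; rewrite (big_ord_below i0) //; elim: m mg => [|m IH] mg.
  by rewrite big_nil.
by rewrite big_nat_recr //= IH // ltnW.
Qed.

End Matrices.

(** [represents_conj] is applied twice per factor, from the innermost factor outwards; its last
    conclusion keeps the commutation with the factors still to come. *)
Lemma represents_Lam m N (j : dual -> endo V) : (m <= g)%N -> represents N j ->
  (forall k, (k < m)%N -> forall x phi, opH (idx k) x * j phi = j phi * opH (idx k) x
     /\ opHt (idx k) x * j phi = j phi * opHt (idx k) x) ->
  exists2 j', represents (fun n I => Lam I m * N n I * LamV I m) j' &
    forall phi, coad_invariant X phi -> j' phi = j phi.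
Proof.
elim: m N j => [|m IH] N j mg jN jC.
  by exists j => //; apply: eq_represents jN => n I; rewrite mul1r mulr1.
have tC x phi : opHt (idx m) x * j phi = j phi * opHt (idx m) x by case: (jC m _ x phi).
have [j1 [jN1 ji1 jC1]] := represents_conj X (opHt_algmap (idx m)) jN tC.
have aC x phi : opH (idx m) x * j1 phi = j1 phi * opH (idx m) x.
  apply: jC1 => [psi|y]; first by case: (jC m _ x psi).
  by rewrite opHt_opH.
have [j2 [jN2 ji2 jC2]] := represents_conj X (opH_algmap (idx m)) jN1 aC.
have [k km x phi|j3 jN3 ji3] := IH _ _ (ltnW mg) jN2.
  have kidx : idx k != idx m by rewrite idx_neq ?(ltn_eqF km) // (ltn_trans km).
  have [jCa jCt] : (forall psi, opH (idx k) x * j psi = j psi * opH (idx k) x) /\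
      (forall psi, opHt (idx k) x * j psi = j psi * opHt (idx k) x).
    by split=> psi; case: (jC k (ltnW km) x psi).
  split; apply: jC2 => [psi|y].
  - by apply: jC1 => // y; rewrite opHt_opH.
  - exact: opH_comm.
  - by apply: jC1 => // y; rewrite opHt_comm.
  - exact: opHt_opH.
exists j3 => [|phi phi_inv]; last by rewrite ji3 // ji2 // ji1.
by apply: eq_represents jN3 => n I /=; rewrite !mulrA.
Qed.

End Tower.

Section MxInv.
Variables (V : vectType K) (e : endo dual -> endo V) (n : nat) (I : mxrep H n).

Lemma mxinv_Lminus : algebra_morphism e ->
  mxinv (Lminus X e I) = Rm X (fun x => scal n (legH e x)) (leg0 V I).
Proof.
move=> eM; rewrite LminusE //.
have aA := scal_algmap n (legH_algmap eM); have fA := leg0_algmap V I.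
have af := commutingC (@leg0_scal _ _ _ _ I (legH e)).
by apply: mxinvE; [exact: (RiK X aA fA af) | exact: (RmK X aA fA af)].
Qed.
End MxInv.

Section Action.
Variables (g : nat) (i : 'I_g) (Psi : Lg0 X g -> endo (tpow dual g)).
Hypothesis Psi_spec : is_Psi Psi.
Variables (n : nat) (I : mxrep H n).
Local Notation V := (tpow dual g).
Local Notation E := (@emb K dual g).
Local Notation Lam := (Lam i E I).
Local Notation LamV := (LamV i E I).

Lemma LambdaE (k : 'I_g) : Lambda X k I = Lam k.
Proof.
have e : Lam k = _ := esym (prod_Lminus i E I (ltnW (ltn_ord k))).
rewrite e /Lambda; apply: eq_bigr => l _.
have eM := @emb_morphism K dual g l.
by rewrite (LminusE X I eM) (LminustE X I eM).
Qed.

Lemma mxinv_Lambda k : mxinv (Lambda X k I) = LamV k.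
Proof.
rewrite LambdaE; apply: mxinvE; first by apply: LamK => l; exact: emb_morphism.
by apply: LamVK => l; exact: emb_morphism.
Qed.

Lemma Psi_Lgmx c k : map_mx Psi (Lgmx X c k I) =
  Lam k * core I c (E k) * LamV k.
Proof.
have eM := @emb_morphism K dual g k.
have [_ _ _ /(_ n I k) [PA PB]] := Psi_spec.
case: c; rewrite ?PA ?PB mxinv_Lambda mxinv_Lminus // LambdaE LplusE // /core ?mulr1.
  by rewrite !mulrA.
by rewrite !mulrA.
Qed.

End Action.
End Legs.

(** * The matrices D and E *)

Section Tower.
Variables (K : fieldType) (H : falgType K) (X : ribbonHopf H).
Local Notation dual := 'Hom(H, K^o).
Variables (g : nat) (i0 : 'I_g) (V : vectType K) (E : 'I_g -> endo dual -> endo V).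
Hypothesis E_mor : forall k, algebra_morphism (E k).
Hypothesis E_comm : forall k l Y Z, k != l -> E k Y * E l Z = E l Z * E k Y.
Local Notation opH := (opH E).
Local Notation opHt := (opHt X E).
Local Notation idx k := (insubd i0 k).

Section Matrices.
Variables (n : nat) (I : mxrep H n).
Local Notation f := (leg0 V I).
Local Notation mxH := (mxH E n).
Local Notation mxHt := (mxHt X E n).
Local Notation Lam := (Lam X i0 E I).
Local Notation LamV := (LamV X i0 E I).
Local Notation Rm := (Rm X).
Local Notation Ri := (Ri X).
Local Notation Qm := (Qm X).
Local Notation v := (rib X).

Let fA : algmap f := leg0_algmap V I.
Let saA k : algmap (mxH k) := mxH_algmap E_mor n k.
Let stA k : algmap (mxHt k) := mxHt_algmap X E_mor n k.
Let fsa k : commuting f (mxH k) := leg0_mxH E I k.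
Let fst_ k : commuting f (mxHt k) := leg0_mxHt X E I k.
Let saf k : commuting (mxH k) f := mxH_leg0 E I k.
Let stf k : commuting (mxHt k) f := mxHt_leg0 X E I k.
Let stsa k l : commuting (mxHt k) (mxH l) := mxHt_mxH X E_mor E_comm n k l.

Definition coreV (c : handle) k : pmat V n :=
  Ri (mxH k) f * (if c is handleB then Tinv X I (E k) else 1) * Ri f (mxH k).

Lemma coreK c k : core X I c (E k) * coreV c k = 1.
Proof.
apply: mul_inv3; [exact: (RmK X fA (saA k)) | | exact: (RmK X (saA k) fA)].
by case: c; [rewrite mulr1 | exact: TmK].
Qed.

Lemma coreVK c k : coreV c k * core X I c (E k) = 1.
Proof.
apply: mul_inv3; [exact: (RiK X (saA k) fA) | | exact: (RiK X fA (saA k))].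
by case: c; [rewrite mulr1 | exact: TinvK].
Qed.

Lemma core_commutator k :
  f (v ^+ 2) * core X I handleB (E k) * coreV handleA k * coreV handleB k =
  Ri (mxHt k) (mxH k) * Qm f (mxHt k) * Rm (mxHt k) (mxH k).
Proof.
rewrite /core /coreV mulr1; apply: handle_commutator => //.
- exact: (saA k).
- exact: (fsa k).
- exact: (stsa k k).
- exact: TmK.
- exact: TinvK.
- exact: Tm_H.
- exact: Tm_Ht.
- exact: Tm_rib.
- by congr scal; apply: legHt_rib.
Qed.

Lemma core_commutator_A k :
  f (v ^+ 2) * core X I handleB (E k) * coreV handleA k * coreV handleB k *
    core X I handleA (E k) =
  Rm f (mxH k) * Rm f (mxHt k) * (Rm (mxHt k) f * Rm (mxH k) f).
Proof. by rewrite core_commutator /core mulr1; apply: (handle_C X fA (stA k) (saA k)). Qed.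

Let v2_central y : v ^+ 2 * y = y * v ^+ 2.
Proof. by rewrite expr2 -mulrA rib_central -mulrA rib_central -mulrA. Qed.

Let v2_Rmr h : algmap h -> commuting f h -> f (v ^+ 2) * Rm h f = Rm h f * f (v ^+ 2).
Proof.
by move=> hA fh; case: (tm_central (Rmat X) v2_central hA fA (commutingC fh)).
Qed.

Let v2_Rml h : algmap h -> commuting f h -> f (v ^+ 2) * Rm f h = Rm f h * f (v ^+ 2).
Proof. by move=> hA fh; case: (tm_central (Rmat X) v2_central fA hA fh). Qed.

Let v2_Rir h : algmap h -> commuting f h -> f (v ^+ 2) * Ri h f = Ri h f * f (v ^+ 2).
Proof.
by move=> hA fh; case: (tm_central (Rinv X) v2_central hA fA (commutingC fh)).
Qed.

Let v2_step k : f (v ^+ 2) * (Ri (mxH k) f * Ri (mxHt k) f) =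
  Ri (mxH k) f * Ri (mxHt k) f * f (v ^+ 2).
Proof. by rewrite mulrA v2_Rir // -mulrA v2_Rir // mulrA. Qed.

Lemma v2_Lam m : f (v ^+ 2) * Lam m = Lam m * f (v ^+ 2).
Proof.
elim: m => [|m IH] /=; first by rewrite mulr1 mul1r.
by rewrite mulrA IH -mulrA v2_step mulrA.
Qed.

Lemma v2_coreA k : f (v ^+ 2) * core X I handleA (E k) =
  core X I handleA (E k) * f (v ^+ 2).
Proof. by rewrite /core mulr1 mulrA (v2_Rml (saA k)) // -mulrA (v2_Rmr (saA k)) // mulrA. Qed.

(** The right-hand side is nested so as to be unwrapped by [represents_Lam], [represents_scal],
    [represents_conj] and [represents_Qm], in this order. *)
Lemma fam_D_core m : (m.+1 < g)%N ->
  let k' := idx m in let k := idx m.+1 in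
  f (v ^+ 2) * (Lam m * core X I handleA (E k') * LamV m) *
    (Lam m.+1 * core X I handleB (E k) * LamV m.+1) *
    (Lam m.+1 * coreV handleA k * LamV m.+1) *
    (Lam m.+1 * coreV handleB k * LamV m.+1) =
  Lam m * (scal n (Ri (opHt k') (opH k') * Ri (opHt k) (opH k)) *
    (Ri (mxHt k') f * Qm f (fun x => scal n (conv X (opHt k) (opH k') x)) * Rm (mxHt k') f) *
    scal n (Rm (opHt k) (opH k) * Rm (opHt k') (opH k'))) * LamV m.
Proof.
move=> mg k' k; have kk : k' != k by rewrite idx_neq ?(ltnW mg) ?neq_ltn ?ltnSn.
have stst : commuting (mxHt k') (mxHt k) by exact/scal_commuting/opHt_comm.
have sasa : commuting (mxH k') (mxH k) by exact/scal_commuting/opH_comm.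
have -> : (fun x => scal n (conv X (opHt k) (opH k') x)) = conv X (mxHt k) (mxH k').
  by apply/funext => x; exact/esym/tm_scal.
rewrite !scalM.
have eR l : scal n (Rm (opHt l) (opH l)) = Rm (mxHt l) (mxH l) by exact/esym/tm_scal.
have eI l : scal n (Ri (opHt l) (opH l)) = Ri (mxHt l) (mxH l) by exact/esym/tm_scal.
rewrite !eR !eI.
have := @two_handles_conj _ _ X _ _ _ _ _ _ fA (stA k') (saA k') (stA k) (fst_ k') (fsa k')
  (fst_ k) (fsa k) (stsa k' k') stst (stsa k' k)
  (commutingC (stsa k k')) sasa (f (v ^+ 2)) (Lam m) (LamV m) (core X I handleB (E k))
  (coreV handleA k) (coreV handleB k).
apply.
- exact: LamVK.
- exact: (LamVK X i0 E_mor I m.+1).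
- exact: v2_Lam.
- exact: v2_coreA.
- exact: v2_step.
- exact: core_commutator.
Qed.

(** The left halves R_{0,k} R_{0,~k} of the C(k), all that is left of their product on that side. *)
Fixpoint prod_Lplus m : pmat V n :=
  if m is m'.+1 then prod_Lplus m' * (Rm f (mxH (idx m')) * Rm f (mxHt (idx m'))) else 1.

(** The right half of C(k) is exactly the step from [LamV m] to [LamV m.+1], which lets consecutive
    factors cancel. *)
Lemma fam_C_core m :
  f (v ^+ 2) * (Lam m * core X I handleB (E (idx m)) * LamV m) *
    (Lam m * coreV handleA (idx m) * LamV m) *
    (Lam m * coreV handleB (idx m) * LamV m) *
    (Lam m * core X I handleA (E (idx m)) * LamV m) =
  Lam m * (Rm f (mxH (idx m)) * Rm f (mxHt (idx m))) * LamV m.+1.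
Proof.
rewrite conj_commutator; [|exact: LamVK|exact: v2_Lam].
apply: (etrans (congr1 (fun z => Lam m * z * LamV m) (core_commutator_A (idx m)))).
exact: mul_regroup.
Qed.

Lemma prod_fam_C m (C : nat -> pmat V n) :
  (forall l, (l < m)%N -> C l =
     Lam l * (Rm f (mxH (idx l)) * Rm f (mxHt (idx l))) * LamV l.+1) ->
  \prod_(0 <= l < m) C l = prod_Lplus m * LamV m.
Proof.
elim: m => [|m IH] CE; first by rewrite big_nil /= mulr1.
rewrite big_nat_recr // IH => [|l lm]; last by rewrite CE // ltnW.
by rewrite CE //; apply: telescope_step; exact: LamVK.
Qed.

Lemma v2_prod_Lplus m : f (v ^+ 2) * prod_Lplus m = prod_Lplus m * f (v ^+ 2).
Proof.
elim: m => [|m IH] /=; first by rewrite mulr1 mul1r.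
apply: GRing.commrM IH _; apply: GRing.commrM; exact: v2_Rml.
Qed.

Lemma tm_prod_Lplus k m s : (m <= k)%N -> (k < g)%N ->
  tm (mxHt (idx k)) (mxH (idx k)) s * prod_Lplus m = prod_Lplus m * tm (mxHt (idx k)) (mxH (idx k)) s /\
  tm (mxHt (idx k)) (mxH (idx k)) s * LamV m = LamV m * tm (mxHt (idx k)) (mxH (idx k)) s.
Proof.
move=> mk kg; elim: m mk => [|m IH] mk; first by rewrite /= !mulr1 !mul1r.
have [IHP IHL] := IH (ltnW mk).
have km : idx k != idx m by rewrite idx_neq ?(ltn_trans mk) // neq_ltn mk orbT.
have tt : commuting (mxHt (idx k)) (mxHt (idx m)) by exact/scal_commuting/opHt_comm.
have aa : commuting (mxH (idx k)) (mxH (idx m)) by exact/scal_commuting/opH_comm.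
have a_t : commuting (mxH (idx k)) (mxHt (idx m)) by exact: commutingC.
split; [apply: GRing.commrM IHP _ | apply: GRing.commrM _ IHL];
  apply: GRing.commrM; exact: tm_commute.
Qed.

End Matrices.

Lemma Qm_scal_conv n (I : mxrep H n) (G h : H -> endo V) :
  algmap G -> algmap h -> commuting G h ->
  Qm X (leg0 V I) (fun x => scal n (conv X G h x)) =
  Rm X (leg0 V I) (fun x => scal n (h x)) *
    Qm X (leg0 V I) (fun x => scal n (G x)) *
    Rm X (fun x => scal n (h x)) (leg0 V I).
Proof.
move=> GA hA Gh; rewrite -Qm_conv; first last.
- exact: scal_commuting.
- exact: leg0_scal.
- exact: leg0_scal.
- exact: scal_algmap.
- exact: scal_algmap.
- exact: leg0_algmap.
by congr (Qm _ _ _); apply/funext => x; exact/esym/tm_scal.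
Qed.

(** The convolution of G with h~ and h of the factors m - 1, ..., 0 in descending order, accumulated
    in the argument. *)
Fixpoint tower_conv m (G : H -> endo V) : H -> endo V := if m is m'.+1
  then tower_conv m' (conv X (conv X G (opHt (idx m'))) (opH (idx m'))) else G.

(** Induction from the inside: the innermost R-matrices on both sides are absorbed into G, which
    therefore has to be arbitrary. *)
Lemma tower_convE n (I : mxrep H n) m G : (m <= g)%N -> algmap G ->
  (forall l, (l < m)%N -> commuting G (opHt (idx l)) /\ commuting G (opH (idx l))) ->
  algmap (tower_conv m G) /\
  prod_Lplus I m * Qm X (leg0 V I) (fun x => scal n (G x)) * LamV X i0 E I m =
    Qm X (leg0 V I) (fun x => scal n (tower_conv m G x)).
Proof.
elim: m G => [|m IH] G mg GA Gc; first by rewrite /= mulr1 mul1r.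
have [Gt Ga] := Gc m (ltnSn m).
have tA := opHt_algmap X E_mor (idx m); have aA := opH_algmap E_mor (idx m).
have ta : commuting (opHt (idx m)) (opH (idx m)) by exact: opHt_opH.
have GtA := conv_algmap X GA tA Gt.
have Gta : commuting (conv X G (opHt (idx m))) (opH (idx m)) by exact: conv_commuting.
have GtaA := conv_algmap X GtA aA Gta.
have [l lm|A e] := IH _ (ltnW mg) GtaA.
  have lm' : idx l != idx m by rewrite idx_neq ?(ltn_trans lm) // neq_ltn lm.
  have [Gtl Gal] := Gc l (ltnW lm).
  split; apply: conv_commuting; first apply: conv_commuting => //.
  - by apply: opHt_comm => //; rewrite eq_sym.
  - by apply/commutingC/opHt_opH.
  - apply: conv_commuting => //; exact: opHt_opH.
  - by apply: opH_comm => //; rewrite eq_sym.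
split => //; apply: etrans e; rewrite (Qm_scal_conv I GtA aA Gta).
rewrite (Qm_scal_conv I GA tA Gt); exact: mul_regroup5.
Qed.

Lemma insubd_ord (i : 'I_g) : idx i = i.
Proof. by apply: val_inj; rewrite val_insubd ltn_ord. Qed.

Section Action.
Variable Psi : Lg0 X g -> endo V.
Hypotheses (PsiL : linear Psi) (PsiM : monoid_morphism Psi) (PsiB : bijective Psi).
Hypothesis PsiE : forall n (I : mxrep H n) c k, map_mx Psi (Lgmx X c k I) =
  Lam X i0 E I k * core X I c (E k) * LamV X i0 E I k.

Lemma map_Psi_Lgmx_inv n (I : mxrep H n) c (k : 'I_g) :
  map_mx Psi (mxinv (Lgmx X c k I)) =
  Lam X i0 E I k * coreV I c k * LamV X i0 E I k.
Proof.
apply: (map_Psi_inv PsiL PsiM PsiB); rewrite PsiE.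
  by apply: conj_mul; [exact: LamVK | exact: LamK | exact: coreK].
by apply: conj_mul; [exact: LamVK | exact: LamK | exact: coreVK].
Qed.

Variable phi : dual.
Hypothesis phi_inv : coad_invariant X phi.

Lemma Psi_jmap_Lgmx (k : 'I_g) c (j : dual -> endo V) :
  represents (fun n I => core X I c (E k)) j ->
  (forall l y psi, l != k -> opH l y * j psi = j psi * opH l y /\
      opHt l y * j psi = j psi * opHt l y) ->
  Psi (jmap (Lgmx X c k) phi) = j phi.
Proof.
move=> jN jC; have [l lk y psi|j' jN' <- //] := @represents_Lam _ _ X _ i0 _ _ E_mor E_comm k _ _ (ltnW (ltn_ord k)) jN.
  by apply: jC; rewrite -(insubd_ord k) idx_neq ?(ltn_trans lk) // neq_ltn lk.
apply: (Psi_jmap PsiL PsiB); apply: eq_represents jN' => n I.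
by rewrite PsiE.
Qed.

Local Notation Wm k := (Rm X (opHt k) (opH k)).
Local Notation Wi k := (Ri X (opHt k) (opH k)).

(** The form phi does not see the conjugations by leg [opHt k'] and by Lambda. The R-matrices
    between the two copies of H inside a factor do not involve leg 0 and remain. *)
Lemma Psi_jmap_D (k' k : 'I_g) : k'.+1 = k :> nat ->
  Psi (jmap (fam_D X k' k) phi) =
  Wi k' * (Wi k * conv X (opHt k) (opH k') (drinfeld X phi) * Wm k) * Wm k'.
Proof.
move=> kk; set G := conv X (opHt k) (opH k').
have ne : k' != k by rewrite -(inj_eq val_inj) /= -kk neq_ltn ltnSn.
have tA := opHt_algmap X E_mor k; have aA := opH_algmap E_mor k'.
have GA : algmap G by apply: conv_algmap => //; exact: opHt_opH.
have [x psi|j1 [jN1 ji1 jC1]] := represents_conj X (opHt_algmap X E_mor k') (represents_Qm X GA).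
  symmetry; apply: conv_commuting => //; first by apply: opHt_comm => //; rewrite eq_sym.
  by apply/commutingC/opHt_opH.
have jN2 := represents_scal (Wi k' * Wi k) (Wm k * Wm k') jN1.
have mg : (k'.+1 < g)%N by rewrite kk.
have [l lk y psi|j3 jN3 ji3] := @represents_Lam _ _ X _ i0 _ _ E_mor E_comm k' _ _ (ltnW (ltn_ord k')) jN2.
  have lk' : idx l != k' by rewrite -(insubd_ord k') idx_neq ?(ltn_trans lk) // neq_ltn lk.
  have lk2 : idx l != k.
    by rewrite -(insubd_ord k) -kk idx_neq ?(ltn_trans lk) ?neq_ltn ?(ltnW lk) // ltnS ltnW.
  (* [opH l] and [opHt l] are treated alike: both commute with all four maps of the two factors. *)
  suff C (Z : H -> endo V) : commuting Z (opHt k') -> commuting Z (opHt k) ->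
      commuting Z (opH k') -> commuting Z (opH k) ->
      Z y * (Wi k' * Wi k * j1 psi * (Wm k * Wm k')) =
      Wi k' * Wi k * j1 psi * (Wm k * Wm k') * Z y.
    split; apply: C.
    - exact/commutingC/opHt_opH. - exact/commutingC/opHt_opH. - exact: opH_comm. - exact: opH_comm.
    - exact: opHt_comm. - exact: opHt_comm. - exact: opHt_opH. - exact: opHt_opH.
  move=> Zt' Zt Za' Za.
  have Zj : Z y * j1 psi = j1 psi * Z y.
    apply: jC1 => [psi'|x]; last exact: Zt'.
    by symmetry; apply: conv_commuting; apply: commutingC.
  have W' s : Z y * tm (opHt k') (opH k') s = tm (opHt k') (opH k') s * Z y.
    by symmetry; apply: commute_tm => x; symmetry.
  have W s : Z y * tm (opHt k) (opH k) s = tm (opHt k) (opH k) s * Z y.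
    by symmetry; apply: commute_tm => x; symmetry.
  rewrite !mulrA W' -!mulrA; congr (_ * _); rewrite !mulrA W -!mulrA; congr (_ * _).
  by rewrite mulrA Zj -!mulrA; congr (_ * _); rewrite mulrA W -mulrA W'.
transitivity (j3 phi); last first.
  by rewrite ji3 // ji1 // !mulrA.
apply: (Psi_jmap PsiL PsiB); apply: eq_represents jN3 => n I.
have e := fam_D_core I mg; cbv zeta in e; rewrite kk !insubd_ord in e; rewrite -e.
rewrite /fam_D !(map_Psi_mul PsiL PsiM) (map_Psi_act PsiL PsiM) !map_Psi_Lgmx_inv !PsiE.
by [].
Qed.

Lemma map_Psi_fam_C n (I : mxrep H n) (l : 'I_g) :
  map_mx Psi (fam_C X l I) = Lam X i0 E I l * (Rm X (leg0 V I) (mxH E n l) *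
    Rm X (leg0 V I) (mxHt X E n l)) * LamV X i0 E I l.+1.
Proof.
have e := fam_C_core I l; rewrite !insubd_ord in e; rewrite -e.
rewrite /fam_C !(map_Psi_mul PsiL PsiM) (map_Psi_act PsiL PsiM) !map_Psi_Lgmx_inv !PsiE.
by [].
Qed.

Lemma map_Psi_prod n (I : mxrep H n) (k : 'I_g) :
  map_mx Psi (\big[mulmx/1%:M]_(l < g | (l < k)%N) fam_C X l I) =
  prod_Lplus I k * LamV X i0 E I k.
Proof.
rewrite (big_morph (map_mx Psi) (map_Psi_mul PsiL PsiM (n := n)) (map_Psi_one PsiL PsiM n)).
rewrite -(@prod_fam_C n I k (fun l => map_mx Psi (fam_C X (idx l) I))).
  exact: (@big_ord_below (pmat V n) g i0 (fun l => map_mx Psi (fam_C X l I)) k (ltnW (ltn_ord k))).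
move=> l lk; have vl : idx l = l :> nat by rewrite val_insubd (ltn_trans lk).
by rewrite map_Psi_fam_C vl.
Qed.

(** After telescoping, Lambda is absorbed into the tower. The R-matrices inside factor k commute
    with the factors below and move outside. *)
Lemma Psi_jmap_E (k : 'I_g) :
  Psi (jmap (fam_E X k) phi) =
  Wi k * tower_conv k (opHt k) (drinfeld X phi) * Wm k.
Proof.
have tA := opHt_algmap X E_mor k.
have tC l : (l < k)%N -> commuting (opHt k) (opHt (idx l)) /\ commuting (opHt k) (opH (idx l)).
  move=> lk; have lk' : k != idx l.
    by rewrite -{1}(insubd_ord k) idx_neq ?(ltn_trans lk) // neq_ltn lk orbT.
  by split; [exact: opHt_comm | exact: opHt_opH].
(* This part of [tower_convE] does not mention the module, so the regular representation serves as a
   witness. *)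
have GA : algmap (tower_conv k (opHt k)).
  by have [] := tower_convE (reg_rep H) (ltnW (ltn_ord k)) tA tC.
have jN := represents_scal (Wi k) (Wm k) (represents_Qm X GA).
apply: (@Psi_jmap _ _ _ _ _ _ PsiL PsiB _ (fun psi =>
  Wi k * tower_conv k (opHt k) (drinfeld X psi) * Wm k)).
apply: eq_represents jN => n I.
have [_ <-] := tower_convE I (ltnW (ltn_ord k)) tA tC.
have eR : scal n (Wm k) = Rm X (mxHt X E n k) (mxH E n k) by exact/esym/tm_scal.
have eI : scal n (Wi k) = Ri X (mxHt X E n k) (mxH E n k) by exact/esym/tm_scal.
rewrite /fam_E !(map_Psi_mul PsiL PsiM) (map_Psi_act PsiL PsiM) !map_Psi_Lgmx_inv !PsiE.
rewrite map_Psi_prod eR eI.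
have [cP _] := tm_prod_Lplus I (Rinv X) (leqnn k) (ltn_ord k).
have [_ cL] := tm_prod_Lplus I (Rmat X) (leqnn k) (ltn_ord k).
rewrite !insubd_ord in cP cL.
apply: etrans; first by symmetry; exact: (commute_conj _ cP cL).
apply: (etrans (congr1 (fun z => prod_Lplus I k * z * LamV X i0 E I k)
  (esym (core_commutator I k)))); symmetry.
exact: (@telescope_last _ _ _ (Lam X i0 E I k) (LamV X i0 E I k) _ _ _
  (LamVK X i0 E_mor I k) (v2_prod_Lplus I k)).
Qed.

End Action.
End Tower.

(** * Iterated coproducts *)

Section IteratedCoproduct.
Variables (K : fieldType) (H : falgType K) (X : ribbonHopf H) (M : pzAlgType K).
Implicit Types f : H -> M.

Definition counit_map (x : H) : M := cou X x *: (1 : M).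
Definition convs (s : seq (H -> M)) : H -> M := foldr (@conv K H X M) counit_map s.

Lemma conv_counit f x : lin f -> conv X f counit_map x = f x.
Proof.
move=> fl; rewrite -[RHS](@sw_counitr _ _ X _ x f) //; apply: eq_sw => a b.
by rewrite /counit_map -pzscalerAr mulr1.
Qed.

Lemma multilinear_prodM n (c : M) (h : nat -> H -> M) :
  (forall l, (l < n)%N -> lin (h l)) ->
  multilinear (fun v : 'I_n -> H => c * \prod_(l < n) h l (v l)).
Proof.
elim: n c h => [|n IH] c h hl //=; split=> [y|a].
  have h0 : lin (h 0%N) by exact: hl.
  rewrite (_ : (fun a => _) = fun a => c * (h 0%N a * \prod_(l < n) h l.+1 (y l))).
    by linear_tac.
  apply/funext => a; rewrite big_ord_recl fcons0; congr (_ * (_ * _)).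
  by apply: eq_bigr => l _; rewrite fconsS.
rewrite (_ : (fun y => _) = fun y => (c * h 0%N a) * \prod_(l < n) h l.+1 (y l)).
  exact: (IH (c * h 0%N a) (fun l => h l.+1) (fun l ln => hl l.+1 ln)).
apply/funext => y; rewrite big_ord_recl fcons0 mulrA; congr (_ * _).
by apply: eq_bigr => l _; rewrite fconsS.
Qed.

Lemma multilinear_prod1 n (h : nat -> H -> M) :
  (forall l, (l < n)%N -> lin (h l)) ->
  multilinear (fun v : 'I_n -> H => \prod_(l < n) h l (v l)).
Proof.
move=> hl; have := multilinear_prodM 1 hl; congr multilinear.
by apply/funext => v; rewrite mul1r.
Qed.

Lemma tlift_tcons (W : lmodType K) n (F : ('I_n.+1 -> H) -> W) a t :
  multilinear F -> tlift F (tcons a t) = tlift (fun y => F (fcons a y)) t.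
Proof.
move=> Fm; rewrite /tcons (lin_tlift (L := tlift F)); last exact: tlift_lin.
by apply: eq_tlift => y; rewrite tlift_tens.
Qed.

(** Both sides nest to the right: [itcop] comultiplies the last factor and [convs] is a right
    fold. *)
Lemma tlift_itcop n (s : seq (H -> M)) x : size s = n.+1 ->
  (forall l, (l < n.+1)%N -> lin (nth counit_map s l)) ->
  tlift (fun v : 'I_n.+1 -> H => \prod_(l < n.+1) nth counit_map s l (v l)) (itcop X n x)
  = convs s x.
Proof.
elim: n s x => [|n IH] [//|f s] x /= [sn] sl.
  have fl : lin f by exact: (sl 0%N).
  have ml := multilinear_prod1 sl.
  rewrite tlift_tens // big_ord_recl big_ord0 mulr1 /=.
  by case: s sn {sl ml} => // _; rewrite /= conv_counit.
have ml := multilinear_prod1 sl.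
rewrite (sw_lin (L := tlift _)); last exact: tlift_lin.
apply: eq_sw => a b; rewrite tlift_tcons // -IH //; last by move=> l ln; apply: (sl l.+1).
rewrite [RHS](lin_tlift (L := fun z : M => f a * z)); last by linear_tac.
apply: eq_tlift => y; rewrite [LHS]big_ord_recl fcons0; congr (_ * _).
by apply: eq_bigr => l _; rewrite fconsS.
Qed.

End IteratedCoproduct.

Section TowerConvs.
Variables (K : fieldType) (H : falgType K) (X : ribbonHopf H).
Local Notation dual := 'Hom(H, K^o).
Variables (g : nat) (i0 : 'I_g) (V : vectType K) (E : 'I_g -> endo dual -> endo V).
Hypothesis E_mor : forall k, algebra_morphism (E k).
Local Notation opH := (opH E).
Local Notation opHt := (opHt X E).
Local Notation idx k := (insubd i0 k).
Local Notation eta := (@counit_map K H X (endo V)).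

Fixpoint legs m : seq (H -> endo V) :=
  if m is m'.+1 then opHt (idx m') :: opH (idx m') :: legs m' else [::].

Lemma legs_lin m l : lin (nth eta (legs m) l).
Proof.
have eta_lin : lin eta.
  by refine (@lin_scalel _ _ _ (1 : endo V) (fun x => cou X x) (lin_linear _)).
elim: m l => [|m IH] [|[|l]] //=.
- exact: am_lin (opHt_algmap X E_mor _).
- exact: am_lin (opH_algmap E_mor _).
Qed.

Lemma size_legs m : size (legs m) = (2 * m)%N.
Proof. by elim: m => // m IH; rewrite mulnS /= IH. Qed.

(** [tower_conv] nests to the left and [convs] to the right; coassociativity passes from one to the
    other. *)
Lemma tower_convs m G x : lin G ->
  tower_conv X i0 E m G x = conv X G (convs X (legs m)) x.
Proof.
elim: m G => [|m IH] G Gl /=; first by rewrite conv_counit.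
have tl := am_lin (opHt_algmap X E_mor (idx m)); have al := am_lin (opH_algmap E_mor (idx m)).
have Yl : lin (convs X (legs m)).
  case: m {IH tl al} => [|m] /=; last exact: conv_lin.
  by refine (@lin_scalel _ _ _ (1 : endo V) (fun x => cou X x) (lin_linear _)).
rewrite IH; last exact: conv_lin.
rewrite convA //; last exact: conv_lin.
by rewrite convA //; exact: conv_lin.
Qed.

Lemma tower_conv_tlift m x : tower_conv X i0 E m (opHt (idx m)) x =
  tlift (fun v : 'I_(2 * m).+1 -> H => opHt (idx m) (v ord0) *
    \prod_(l < 2 * m) nth eta (legs m) l (v (lift ord0 l))) (itcop X (2 * m) x).
Proof.
have tl := am_lin (opHt_algmap X E_mor (idx m)).
rewrite tower_convs // -[conv _ _ _ x]/(convs X (opHt (idx m) :: legs m) x).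
rewrite -(@tlift_itcop _ _ _ _ (2 * m)) /= ?size_legs //; last first.
  by move=> [|l] _ //=; exact: legs_lin.
by apply: eq_tlift => v; rewrite big_ord_recl.
Qed.

Local Notation Wm k := (Rm X (opHt k) (opH k)).
Local Notation Wi k := (Ri X (opHt k) (opH k)).
Hypothesis E_comm : forall k l Y Z, k != l -> E k Y * E l Z = E l Z * E k Y.

(** The inverse is written with S on the leg of h~; since h~ acts through S^-1, this leg will appear
    without antipode. *)
Lemma conj_W_act k (Y : endo V) u : (Wi k * Y * Wm k) u =
  \sw_(a, b <- Rmat X) \sw_(c, d <- Rmat X)
    opHt k (anti X c) (opH k d (Y (opHt k a (opH k b u)))).
Proof.
have tA := opHt_algmap X E_mor k; have aA := opH_algmap E_mor k.
rewrite -(sw_anti_Ri X tA aA (opHt_opH X E_mor E_comm k k)).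
rewrite /Rm /tm -sw_mull (sw_lin (L := fun Z : endo V => Z u)); last exact: lin_eval.
apply: eq_sw => a b; rewrite -mulrA -sw_mulr.
rewrite (sw_lin (L := fun Z : endo V => Z u)); last exact: lin_eval.
by apply: eq_sw => c d; rewrite !endoM.
Qed.

End TowerConvs.

(** * Evaluation on pure tensors *)

Section EmbTens.
Variables (K : fieldType) (H : falgType K) (X : ribbonHopf H) (g : nat).
Local Notation dual := 'Hom(H, K^o).
Local Notation E := (@emb K dual g).
Local Notation opH := (opH E).
Local Notation opHt := (opHt X E).
Implicit Type psi : 'I_g -> dual.

Lemma opH_tens k x psi : opH k x (tens psi) =
  tens (fun l => if l == k then shift (psi k) 1 x else psi l).
Proof.
rewrite /opH /legH emb_tens; congr tens; apply/funext => l; case: eqP => // ->.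
by apply/lfunP => y; rewrite act_HE shiftE mul1r.
Qed.

Lemma opHt_tens k x psi : opHt k x (tens psi) =
  tens (fun l => if l == k then shift (psi k) (antiV X x) 1 else psi l).
Proof.
rewrite /opHt /legHt emb_tens; congr tens; apply/funext => l; case: eqP => // ->.
by apply/lfunP => y; rewrite act_HtE shiftE mulr1.
Qed.

End EmbTens.

Section Evaluation.
Variables (K : fieldType) (H : falgType K) (X : ribbonHopf H) (g : nat).
Local Notation dual := 'Hom(H, K^o).
Variables (V : vectType K) (E : 'I_g -> endo dual -> endo V).
(** Stands for [tens], known here through its two action rules. *)
Variable pure : ('I_g -> dual) -> V.
Hypothesis opH_pure : forall k x psi, opH E k x (pure psi) =
  pure (fun l => if l == k then shift (psi k) 1 x else psi l).
Hypothesis opHt_pure : forall k x psi, opHt X E k x (pure psi) =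
  pure (fun l => if l == k then shift (psi k) (antiV X x) 1 else psi l).

Lemma shift_shift (f : dual) x y x' y' :
  shift (shift f x y) x' y' = shift f (x * x') (y' * y).
Proof. by apply/lfunP => z; rewrite !shiftE !mulrA. Qed.

(** [legs] lists the factors in descending order, so the pair of factor k occupies the positions 2(m
    - k) - 2 and 2(m - k) - 1. *)
Lemma legs_pure (i0 : 'I_g) m (w : nat -> H) psi : (m <= g)%N ->
  (\prod_(0 <= l < 2 * m) nth (@counit_map K H X _) (legs X i0 E m) l (w l)) (pure psi) =
  pure (fun k : 'I_g => if (k < m)%N then
    shift (psi k) (antiV X (w (2 * (m - k)).-2)) (w (2 * (m - k)).-1) else psi k).
Proof.
elim: m w => [|m IH] w mg; first by rewrite big_nil id_lfunE.
have -> : (2 * m.+1 = (2 * m).+2)%N by rewrite mulnS.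
rewrite big_nat_recl // big_nat_recl // !endoM [nth _ _ 0]/= [nth _ _ 1]/=.
rewrite (IH (fun l => w l.+2) (ltnW mg)) opH_pure opHt_pure; congr pure; apply/funext => k.
have vm : insubd i0 m = m :> nat by rewrite val_insubd mg.
have [->|km] := eqVneq k (insubd i0 m).
  by rewrite eqxx vm ltnn leqnn subSnn muln1 shift_shift !mul1r.
have km' : (k < m.+1)%N = (k < m)%N.
  by rewrite ltnS leq_eqVlt -vm val_eqE (negPf km) vm.
rewrite km'; case: ifP => // lt; rewrite subSn ?(ltnW lt) // mulnS.
by have -> : (2 * (m - k) = (2 * (m - k)).-2.+2)%N by rewrite -(subnSK lt) mulnS.
Qed.

Hypothesis E_mor : forall k, algebra_morphism (E k).
Hypothesis E_comm : forall k l Y Z, k != l -> E k Y * E l Z = E l Z * E k Y.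
Local Notation opH := (opH E).
Local Notation opHt := (opHt X E).
Local Notation Wm k := (Rm X (opHt k) (opH k)).
Local Notation Wi k := (Ri X (opHt k) (opH k)).

Lemma D_pure (k' k : 'I_g) w psi : k' != k ->
  (Wi k' * (Wi k * conv X (opHt k) (opH k') w * Wm k) * Wm k') (pure psi) =
  \sw_(aj, bj <- Rmat X) \sw_(ak, bk <- Rmat X)
  \sw_(al, bl <- Rmat X) \sw_(am, bm <- Rmat X) \sw_(v1, v2 <- cop X w)
    pure (fun l => if l == k' then
        shift (psi k') (antiV X aj * ak) (bk * v2 * bj)
      else if l == k then
        shift (psi k) (antiV X al * antiV X v1 * am) (bm * bl)
      else psi l).
Proof.
move=> kk; rewrite (conj_W_act X E_mor E_comm).
apply: eq_sw => aj bj; apply: eq_sw => ak bk.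
rewrite (conj_W_act X E_mor E_comm).
rewrite (sw_lin (L := fun u => opHt k' (anti X ak) (opH k' bk u))); last by linear_tac.
apply: eq_sw => al bl.
rewrite (sw_lin (L := fun u => opHt k' (anti X ak) (opH k' bk u))); last by linear_tac.
apply: eq_sw => am bm.
rewrite [conv _ _ _ w]/conv /tm (sw_lin (L := fun Z : endo V =>
  opHt k' (anti X ak) (opH k' bk (opHt k (anti X am) (opH k bm
    (Z (opHt k al (opH k bl (opHt k' aj (opH k' bj (pure psi))))))))))); last first.
  move=> c Y Z; rewrite add_lfunE scale_lfunE.
  by do 4 rewrite linearD linearZ.
apply: eq_sw => v1 v2; rewrite endoM !(opH_pure, opHt_pure); congr pure; apply/funext => l.
have kk2 : (k == k') = false by rewrite eq_sym (negPf kk).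
cbv beta; rewrite ?eqxx ?kk2 ?(negPf kk) ?eqxx ?kk2 ?shift_shift ?antiK.
case: (l == k'); first by rewrite !mul1r !mulr1.
by case: (l == k); rewrite // !mul1r !mulr1 !mulrA.
Qed.

Lemma E_pure (k : 'I_g) w psi :
  (Wi k * tower_conv X k E k (opHt k) w * Wm k) (pure psi) =
  \sw_(aj, bj <- Rmat X) \sw_(ak, bk <- Rmat X)
  tlift (fun v : 'I_(2 * k).+1 -> H =>
    pure (fun l : 'I_g =>
      if (l < k)%N then
        shift (psi l) (antiV X (v (inord (2 * (k - l)).-1)))
                      (v (inord (2 * (k - l))))
      else if l == k then
        shift (psi k) (antiV X aj * antiV X (v ord0) * ak) (bk * bj)
      else psi l))
    (itcop X (2 * k) w).
Proof.
have kidx : insubd k k = k by apply: val_inj; rewrite val_insubd ltn_ord.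
rewrite (conj_W_act X E_mor E_comm); apply: eq_sw => aj bj; apply: eq_sw => ak bk.
have := @tower_conv_tlift _ _ X _ k _ _ E_mor k w; rewrite kidx => ->.
rewrite (lin_tlift (L := fun Z : endo V => opHt k (anti X ak) (opH k bk
  (Z (opHt k aj (opH k bj (pure psi))))))); last first.
  by move=> c Y Z; rewrite add_lfunE scale_lfunE; do 2 rewrite linearD linearZ.
apply: eq_tlift => v; rewrite endoM.
(* The leg 0 of the iterated coproduct belongs to factor k itself, whence the shift by one against
   the positions in [legs]. *)
pose w' l := v (inord l.+1).
have e : \prod_(l < 2 * k) nth (@counit_map K H X (endo V)) (legs X k E k) l (v (lift ord0 l)) =
    \prod_(0 <= l < 2 * k) nth (@counit_map K H X (endo V)) (legs X k E k) l (w' l).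
  rewrite big_mkord; apply: eq_bigr => l _; congr (nth _ _ _ (v _)).
  by apply: val_inj; rewrite /= inordK // ltnS ltn_ord.
rewrite e opH_pure opHt_pure (legs_pure k w' _ (ltnW (ltn_ord k))).
rewrite opHt_pure opH_pure opHt_pure; congr pure; apply/funext => l.
cbv beta; rewrite ?eqxx ?ltnn ?eqxx ?shift_shift ?antiK.
case: (ltnP l k) => lk; last by case: (l == k); rewrite // !mul1r !mulr1 !mulrA.
have -> : (l == k) = false by rewrite -val_eqE ltn_eqF.
rewrite /w'; have -> : (2 * (k - l) = (2 * (k - l)).-2.+2)%N by rewrite -(subnSK lk) mulnS.
by [].
Qed.

End Evaluation.

(** * The action on tensors *)

Section Formulas.
Variables (K : fieldType) (H : falgType K) (X : ribbonHopf H).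
Hypothesis Xfact : factorizable X.
Local Notation dual := 'Hom(H, K^o).
Local Notation w := (rib X)^-1.

Lemma ribV_central y : w * y = y * w.
Proof. by apply: (mulrI (rib_unit X)); rewrite mulVKr ?rib_unit // mulrA rib_central mulrK ?rib_unit. Qed.

Lemma form_of_ribV_invariant : coad_invariant X (form_of X w).
Proof. by move=> h; apply: coad_form_of => // y; exact: ribV_central. Qed.

Variables (g : nat) (Psi : Lg0 X g -> endo (tpow dual g)).
Hypothesis Psi_spec : is_Psi Psi.
Local Notation E := (@emb K dual g).
Local Notation phi := (form_of X w).

Let E_mor k : algebra_morphism (E k) := @emb_morphism K dual g k.
Let E_comm k l Y Z : k != l -> E k Y * E l Z = E l Z * E k Y := @emb_comm K dual g k l Y Z.

Let PsiL : linear Psi. Proof. by case: Psi_spec. Qed.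
Let PsiM : monoid_morphism Psi. Proof. by case: Psi_spec. Qed.
Let PsiB : bijective Psi. Proof. by case: Psi_spec. Qed.

Let PsiE i n (I : mxrep H n) c k : map_mx Psi (Lgmx X c k I) =
  Lam X i E I k * core X I c (E k) * LamV X i E I k.
Proof. exact: Psi_Lgmx. Qed.

(** The linear map for g = 1, followed by the embedding of factor i, represents [core], because
    [core] is natural in the embedding; the remaining conjugation by Lambda is not seen by phi. *)
Lemma Psi_elt_handle (Psi1 : Lg0 X 1 -> endo dual) (i : 'I_g) c : is_Psi1 Psi1 ->
  Psi (elt (Lgmx X c i) w) = E i (Psi1 (elt (Lgmx X c ord0) w)).
Proof.
move=> [L1 M1 B1 S1]; have eM := E_mor i.
pose j1 psi := Psi1 (@Lg0_gen K H X 1 c ord0 psi).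
have j1l : lin j1 by move=> k x y; rewrite /j1 linearP L1.
have j1N : represents (fun n I => core X I c (id : endo dual -> endo dual)) j1.
  split=> // n I; have [SA SB] := S1 n I.
  have idM := algebra_morphism_id dual.
  have -> : map_mx j1 (Tmx I) = map_mx Psi1 (Lgmx X c ord0 I).
    by apply/matrixP => p q; rewrite !mxE.
  case: c {j1 j1l}; rewrite ?SA ?SB (mxinv_Lminus X I idM) (LplusE X I id) /core ?mulr1.
    by [].
  by [].
have jN : represents (fun n I => core X I c (E i)) (fun psi => E i (j1 psi)).
  have [el _ _] := eM; split; first exact: lin_comp el j1l.
  move=> n I; rewrite -(map_core X (algebra_morphism_id dual) eM I c) -(proj2 j1N n I).
  by apply/matrixP => p q; rewrite !mxE.
have jC l y psi : l != i ->
    opH E l y * E i (j1 psi) = E i (j1 psi) * opH E l y /\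
    opHt X E l y * E i (j1 psi) = E i (j1 psi) * opHt X E l y.
  by move=> li; split; apply: E_comm.
rewrite /elt (Psi_jmap_Lgmx E_mor E_comm PsiL PsiB (PsiE i) form_of_ribV_invariant jN jC).
have j1R : represents (fun n I => map_mx Psi1 (Lgmx X c ord0 I)) j1.
  by split=> // n I; apply/matrixP => p q; rewrite !mxE.
by rewrite (Psi_jmap L1 B1 j1R).
Qed.

Lemma Psi_elt_D (i' i : 'I_g) : i'.+1 = i :> nat ->
  Psi (elt (fam_D X i' i) w) =
  Ri X (opHt X E i') (opH E i') *
  (Ri X (opHt X E i) (opH E i) * conv X (opHt X E i) (opH E i') w *
    Rm X (opHt X E i) (opH E i)) *
  Rm X (opHt X E i') (opH E i').
Proof.
move=> ii; rewrite /elt.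
rewrite (Psi_jmap_D E_mor E_comm PsiL PsiM PsiB (PsiE i) form_of_ribV_invariant ii).
by rewrite drinfeld_form_of.
Qed.

Lemma Psi_elt_E (i : 'I_g) : Psi (elt (fam_E X i) w) =
  Ri X (opHt X E i) (opH E i) * tower_conv X i E i (opHt X E i) w *
  Rm X (opHt X E i) (opH E i).
Proof.
rewrite /elt (Psi_jmap_E E_mor E_comm PsiL PsiM PsiB (PsiE i)).
by rewrite drinfeld_form_of.
Qed.

Variables (phi : 'I_g -> dual) (i : 'I_g).

Lemma elt_handle_tens (Psi1 : Lg0 X 1 -> endo dual) c : is_Psi1 Psi1 ->
  Psi (elt (Lgmx X c i) w) (tens phi) =
  tens (fun k => if k == i then Psi1 (elt (Lgmx X c ord0) w) (phi i) else phi k).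
Proof.
move=> Psi1_spec; rewrite (Psi_elt_handle i c Psi1_spec) emb_tens; congr tens.
by apply/funext => k; case: eqP => // ->.
Qed.

Lemma elt_D_tens (i' : 'I_g) : i'.+1 = i :> nat ->
  Psi (elt (fam_D X i' i) w) (tens phi) =
  \sw_(aj, bj <- Rmat X) \sw_(ak, bk <- Rmat X)
  \sw_(al, bl <- Rmat X) \sw_(am, bm <- Rmat X) \sw_(v1, v2 <- cop X w)
    tens (fun k =>
      if k == i' then
        shift (phi i') (antiV X aj * ak) (bk * v2 * bj)
      else if k == i then
        shift (phi i) (antiV X al * antiV X v1 * am) (bm * bl)
      else phi k).
Proof.
move=> ii; rewrite (Psi_elt_D ii).
have ne : i' != i by rewrite -(inj_eq val_inj) /= -ii neq_ltn ltnSn.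
exact: (D_pure (@opH_tens K H g) (@opHt_tens K H X g) E_mor E_comm w phi ne).
Qed.

Lemma elt_E_tens : Psi (elt (fam_E X i) w) (tens phi) =
  \sw_(aj, bj <- Rmat X) \sw_(ak, bk <- Rmat X)
  tlift (fun v : 'I_(2 * i).+1 -> H =>
    tens (fun k : 'I_g =>
      if (k < i)%N then
        shift (phi k) (antiV X (v (inord (2 * (i - k)).-1)))
                      (v (inord (2 * (i - k))))
      else if k == i then
        shift (phi i) (antiV X aj * antiV X (v ord0) * ak) (bk * bj)
      else phi k))
    (itcop X (2 * i) w).
Proof.
rewrite Psi_elt_E.
exact: (E_pure (@opH_tens K H g) (@opHt_tens K H X g) E_mor E_comm i w phi).
Qed.

End Formulas.

Theorem theorem5p12 (R : realType) (H : falgType R[i]) (X : ribbonHopf H)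
    (Xfact : factorizable X) (g : nat) (g_ge1 : (1 <= g)%N)
    (Psi : Lg0 X g -> endo (tpow 'Hom(H, R[i]^o) g)) (Psi_spec : is_Psi Psi)
    (Psi1 : Lg0 X 1 -> endo 'Hom(H, R[i]^o)) (Psi1_spec : is_Psi1 Psi1)
    (phi : 'I_g -> 'Hom(H, R[i]^o)) (i : 'I_g) :
  [/\ Psi (elt (Lgmx X handleA i) (rib X)^-1) (tens phi) =
        tens (fun k => if k == i
                       then Psi1 (elt (Lgmx X handleA ord0) (rib X)^-1) (phi i)
                       else phi k),
      Psi (elt (Lgmx X handleB i) (rib X)^-1) (tens phi) =
        tens (fun k => if k == i
                       then Psi1 (elt (Lgmx X handleB ord0) (rib X)^-1) (phi i)
                       else phi k),
      (forall i' : 'I_g, i'.+1 = i :> nat ->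
        Psi (elt (fam_D X i' i) (rib X)^-1) (tens phi) =
          \sw_(aj, bj <- Rmat X) \sw_(ak, bk <- Rmat X)
          \sw_(al, bl <- Rmat X) \sw_(am, bm <- Rmat X)
          \sw_(v1, v2 <- cop X (rib X)^-1)
            tens (fun k =>
              if k == i' then
                shift (phi i') (antiV X aj * ak) (bk * v2 * bj)
              else if k == i then
                shift (phi i) (antiV X al * antiV X v1 * am) (bm * bl)
              else phi k)) &
      ((0 < i)%N ->
        Psi (elt (fam_E X i) (rib X)^-1) (tens phi) =
          \sw_(aj, bj <- Rmat X) \sw_(ak, bk <- Rmat X)
          tlift (fun v : 'I_(2 * i).+1 -> H =>
            tens (fun k : 'I_g =>
              if (k < i)%N then
                shift (phi k) (antiV X (v (inord (2 * (i - k)).-1)))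
                              (v (inord (2 * (i - k))))
              else if k == i then
                shift (phi i) (antiV X aj * antiV X (v ord0) * ak) (bk * bj)
              else phi k))
            (itcop X (2 * i) (rib X)^-1))].
Proof.
split.
- exact: (elt_handle_tens Xfact Psi_spec phi i handleA Psi1_spec).
- exact: (elt_handle_tens Xfact Psi_spec phi i handleB Psi1_spec).
- exact: (elt_D_tens Xfact Psi_spec phi).
- by move=> _; exact: (elt_E_tens Xfact Psi_spec phi i).
Qed.
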